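(* Let $\delta\in(0,1)$ and let $d\ge 2$ be an integer. Then there exists $C=C(\delta,d)>0$ such that the following holds. For every $n$, let $T$ be a tree on $n$ vertices with maximum degree at most $d$, let $G_0$ be a graph on vertex set $[n]$ with minimum degree at least $\delta n$, and let $G\sim G_0\cup\mathbf{G}(n,C/n)$ be uniformly edge-coloured in $[n-1]$. Then, with probability tending to $1$ as $n\to\infty$ (uniformly over the choices of $T$ and $G_0$), $G$ contains a rainbow copy of $T$.
   Context: $\mathbf{G}(n,p)$ is the binomial random graph on $[n]$ with edge probability $p$; $G_0\cup\mathbf{G}(n,p)$ has as edge set the union of both edge sets. Uniformly edge-coloured in $\mathcal{C}$: each edge independently gets a uniformly random colour from $\mathcal{C}$. Rainbow: all edges have distinct colours. *)

(* Defs.v *)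
From mathcomp Require Import all_boot all_order all_algebra.
From mathcomp Require Import reals.

Set Implicit Arguments.
Unset Strict Implicit.
Unset Printing Implicit Defensive.

Import Order.TTheory GRing.Theory Num.Theory.
Local Open Scope ring_scope.

Notation edge E := {e | e \in E}.
Notation colouring E k := {ffun edge E -> 'I_k}.

Section Graphs.
Variable V : finType.
Implicit Types E F : {set {set V}}.

(* A simple graph on V is given by its edge set, a set of 2-element subsets
   of V; the union of two graphs is thus the union of these sets. *)
Definition vpairs : {set {set V}} := [set e : {set V} | #|e| == 2%N].

Definition is_graph E : bool := E \subset vpairs.

(* When E is a graph this is irreflexive, since #|[set x; x]| = 1. *)
Definition adj E : rel V := fun x y => [set x; y] \in E.

Definition degree E (x : V) : nat := #|[set y | adj E x y]|.

Definition acyclic E : Prop :=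
  forall s : seq V, (2 < size s)%N -> ~ ucycle (adj E) s.

Definition is_tree E : Prop :=
  [/\ is_graph E, (0 < #|V|)%N, (forall x y, connect (adj E) x y) & acyclic E].

Definition rainbow E k (c : colouring E k) F : bool :=
  dinjectiveb c [pred e : edge E | val e \in F].

End Graphs.

Definition image_graph (U V : finType) (f : U -> V) (T : {set {set U}}) :
    {set {set V}} :=
  [set f @: (e : {set U}) | e in T].

Definition has_rainbow_copy (U V : finType) (T : {set {set U}})
    (E : {set {set V}}) k (c : colouring E k) : bool :=
  [exists f : {ffun U -> V},
    [&& injectiveb f, image_graph f T \subset E & rainbow c (image_graph f T)]].

Section Probability.
Variables (R : realType) (V : finType).
Implicit Types E H : {set {set V}}.

(* Probability that the binomial random graph on V with edge probability p
   equals H; this is a probability mass function when 0 <= p <= 1. *)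
Definition gnp_mass (p : R) H : R :=
  \prod_(e in vpairs V) (if e \in H then p else 1 - p).

(* Probability of the event A when the edges of E are coloured independently
   and uniformly in 'I_k. *)
Definition colouring_prob E k (A : pred (colouring E k)) : R :=
  \sum_(c : colouring E k | A c) \prod_(e : edge E) k%:R^-1.

(* Probability of the event A for the union of E0 with a binomial random graph,
   uniformly edge-coloured in 'I_k. *)
Definition perturbed_prob E0 (p : R) k (A : forall E, pred (colouring E k)) : R :=
  \sum_(H : {set {set V}} | is_graph H)
    gnp_mass p H * colouring_prob (@A (E0 :|: H)).

End Probability.

(* Main.v *)
(* Choose a degree [D] shared by linearly many vertices of [T] (hubs) with pairwise disjoint
   2-neighbourhoods.  A density increment in [G0] gives disjoint D-tuples of vertices and a set [B]
   of the same size such that the bipartite graph "every vertex of the tuple is adjacent in [G0] to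
   the vertex of [B]" is dense in every linear-sized pair of subsets.  The neighbours of the hubs
   are placed on the tuples.

   First phase: the tree without its hubs is embedded using the remaining edges so that the
   uncovered vertices all lie in [B].  The tree is cut into pieces of bounded size, embedded one
   after the other; the only property of the random graph that is needed is that any two disjoint
   linear-sized sets are joined, besides linear degrees into small reserved sets, which [G0]
   provides.  Leftover vertices are covered by free spots of the last pieces, and unused
   reserve vertices replace vertices of [B] at absorbing spots.  Colours are handled as in
   McDiarmid's clutter argument: colouring the edges one at a time and asking the structure to be
   rainbow costs at most a constant factor in the edge probability.

   Second phase: exactly as many colours are unused as edges are missing, and the hubs have to be
   matched to the uncovered vertices by a rainbow perfect matching of the tuple-vertex graph in the
   unused colours.  Any perfect matching can be modified along many short switching chains, so two
   random perfect matchings share few edges and the second moment method applies. *)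

From HB Require Import structures.
Require Import Defs.
From mathcomp Require Import all_boot all_order all_algebra all_fingroup.
From mathcomp Require Import filter reals topology normedtype sequences exp ring lra zify.

Set Implicit Arguments.
Unset Strict Implicit.
Unset Printing Implicit Defensive.

Import Order.TTheory GRing.Theory Num.Theory numFieldNormedType.Exports.

(** * Switching along alternating cycles *)

Lemma leq_expn_subD s a n : s ^ n.+1 <= (s - a) ^ n.+1 + n.+1 * a * s ^ n.
Proof.
elim: n => [|n IH]; first by rewrite !expn1 expn0; lia.
have le_pow : (s - a) ^ n.+1 <= s ^ n.+1 by rewrite leq_exp2r ?leq_subr.
have split_s : s <= (s - a) + a by lia.
rewrite [s ^ n.+2]expnS; apply: leq_trans (leq_mul (leqnn s) IH) _.
rewrite mulnDr (_ : s * (n.+1 * a * s ^ n) = n.+1 * a * s ^ n.+1); last by rewrite expnS mulnCA.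
rewrite [n.+2 * a]mulSn mulnDl addnA leq_add2r [(s - a) ^ n.+2]expnS.
apply: leq_trans (leq_mul split_s (leqnn _)) _.
by rewrite mulnDl leq_add2l leq_mul2l le_pow orbT.
Qed.

Lemma leq_exp_ffact m n : (m - n) ^ n.+1 <= m ^_ n.+1.
Proof.
elim: n m => [|n IH] [|m] //; first by rewrite subn0 ffactn1.
by rewrite subSS expnS ffactSS leq_mul // (leq_trans (leq_subr _ _)).
Qed.

Lemma next_notin (T : eqType) (p : seq T) x : x \notin p -> next p x = x.
Proof. by rewrite next_nth => /negbTE->. Qed.

Section Switching.
Variables (V : finType) (E : rel V).
Implicit Types (t u : {perm V}) (S : {set V}) (p : seq V).

Definition perfect_matchings : {set {perm V}} :=
  [set t : {perm V} | [forall x, E x (t x)]].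

Definition alternating t : rel V := fun x y => E x (t y).

Definition switch t p : {perm V} := insubd t [ffun x => t (next p x)].

Lemma switchE t p x : uniq p -> switch t p x = t (next p x).
Proof.
move=> up; rewrite /switch -pvalE [pval _]val_insubd ifT ?ffunE //.
apply/injectiveP => y z; rewrite !ffunE => /perm_inj.
exact: (can_inj (prev_next up)).
Qed.

Lemma switch_edge t p x : uniq p -> path.cycle (alternating t) p ->
  (x \in p) || E x (t x) -> E x (switch t p x).
Proof.
move=> up cp; rewrite switchE //; case: (boolP (x \in p)) => [xp _|xp].
  exact: (next_cycle cp xp).
by rewrite next_notin.
Qed.

Lemma switch_matching t p : uniq p -> path.cycle (alternating t) p ->
  t \in perfect_matchings -> switch t p \in perfect_matchings.
Proof.
rewrite !inE => up cp /forallP tP; apply/forallP => x.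
by apply: switch_edge; rewrite ?tP ?orbT.
Qed.

Lemma switch_last t w p : uniq (w :: p) -> switch t (w :: p) (last w p) = t w.
Proof.
move=> up; rewrite switchE //; congr (t _).
by have := cycle_next up; rewrite (cycle_path w) /= => /andP[/eqP].
Qed.

Lemma switch_inj t u p : uniq p -> switch t p = switch u p -> t = u.
Proof.
move=> up tu; apply/permP => x.
by have := congr1 (fun s : {perm V} => s (prev p x)) tu; rewrite !switchE ?next_prev.
Qed.

Definition agreeing t S : {set {perm V}} :=
  [set u in perfect_matchings | [forall x in S, (u : {perm _}) x == t x]].

Definition n_agree t u := #|[set x | t x == u x]|.

Definition alternating_cycles k t w : {set k.-tuple V} :=
  [set v : k.-tuple V | path.cycle (alternating t) (w :: v)].

Lemma card_repetitive_tuples S n :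
  #|V| ^ n.+1 <=
  #|[set v : n.+1.-tuple V | all [predC S] v & uniq v]| + n.+1 * (#|S| + n) * #|V| ^ n.
Proof.
rewrite card_uniq_tuples; have -> : #|[predC S]| = #|V| - #|S| by rewrite -(cardC (mem S)) addKn.
apply: leq_trans (leq_expn_subD _ (#|S| + n) _) _.
by rewrite leq_add2r subnDA leq_exp_ffact.
Qed.

Variables (k c : nat).
Hypothesis many_cycles : forall t w, #|V| ^ k.+1 <= c * #|alternating_cycles k.+1 t w|.

Definition switching_cycles t w S : {set k.+1.-tuple V} :=
  [set v in alternating_cycles k.+1 t w | all [predC w |: S] (v : k.+1.-tuple V) && uniq v].

Definition few_fixed S := 2 * c * (k.+1 * (#|S|.+1 + k)) <= #|V|.

Lemma few_fixedW S S' : #|S| <= #|S'| -> few_fixed S' -> few_fixed S.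
Proof. by move=> SS'; apply: leq_trans; rewrite !leq_mul2l leq_add2r ltnS SS' !orbT. Qed.

Lemma uniq_switching_cycle t w S v : v \in switching_cycles t w S -> uniq (w :: v).
Proof.
rewrite !inE => /and3P[_ /allP vS uv]; rewrite /= uv andbT.
by apply/negP => /vS; rewrite !inE eqxx.
Qed.

Lemma many_switching_cycles t w S : few_fixed S ->
  #|V| ^ k.+1 <= 2 * c * #|switching_cycles t w S|.
Proof.
move=> fewS.
have spread_card := card_repetitive_tuples (w |: S) k.
have lost : #|alternating_cycles k.+1 t w| <=
    #|switching_cycles t w S| + k.+1 * (#|w |: S| + k) * #|V| ^ k.
  set A := [set v : k.+1.-tuple V | all [predC w |: S] v & uniq v] in spread_card.
  have -> : switching_cycles t w S = alternating_cycles k.+1 t w :&: A.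
    by apply/setP => v; rewrite !inE.
  rewrite -(cardsID A) leq_add2l setDE (leq_trans (subset_leq_card (subsetIr _ _))) //.
  by rewrite cardsCs setCK card_tuple leq_subLR.
have few_lost : 2 * c * (k.+1 * (#|w |: S| + k) * #|V| ^ k) <= #|V| ^ k.+1.
  rewrite mulnA (expnS _ k) leq_mul2r (leq_trans _ fewS) ?orbT //.
  by do 2![apply: leq_mul => //]; rewrite leq_add2r cardsU1 (leq_add (leq_b1 _)).
have many := many_cycles t w.
have {lost} := leq_mul (leqnn (2 * c)) lost; rewrite mulnDr.
set waste := k.+1 * _ * _ in few_lost *.
by move: many few_lost; move: waste (#|V| ^ k.+1) #|_| #|_|; clear; lia.
Qed.

Lemma perfect_matchings_gt0 : 0 < #|V| -> few_fixed set0 -> 0 < #|perfect_matchings|.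
Proof.
move=> V0 few0; pose matched t := [set x | E x (t x)].
case: (arg_maxnP (P := predT) (fun t => #|matched t|) (erefl : predT (1%g : {perm V}))).
move=> t _ tmax; apply/card_gt0P; exists t; rewrite inE; apply/forallP => w; apply: contraT => nEw.
have /card_gt0P[v vP] : 0 < #|switching_cycles t w set0|.
  have := @many_switching_cycles t w set0 few0; case: #|switching_cycles _ _ _| => //.
  by rewrite muln0 leqn0 expn_eq0 => /andP[/eqP V_eq0]; rewrite V_eq0 in V0.
have uv := uniq_switching_cycle vP; move: vP; rewrite !inE => /andP[cv _].
have /negP[] : ~~ (#|matched t| < #|matched (switch t (w :: v))|) by rewrite -leqNgt; apply: tmax.
apply: proper_card.
apply/properP; split; first by apply/subsetP => x; rewrite !inE => Ex; rewrite switch_edge ?Ex ?orbT.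
by exists w; rewrite inE // switch_edge // mem_head.
Qed.

Lemma switch_agreeing t w S u v : w \notin S ->
  u \in agreeing t (w |: S) -> v \in switching_cycles u w S ->
  switch u (w :: v) \in agreeing t S.
Proof.
move=> wS /setIdP[uM /forall_inP ut] vP; have uv := uniq_switching_cycle vP.
move: vP; rewrite !inE => /and3P[cv /allP vS _].
have -> /= : [forall x, E x (switch u (w :: v) x)].
  by have := switch_matching uv cv uM; rewrite inE.
apply/forall_inP => x xS; rewrite switchE // next_notin ?ut ?inE ?xS ?orbT // negb_or.
by apply/andP; split; [apply: contraNneq wS => <- | apply/negP => /vS; rewrite !inE xS orbT].
Qed.

(* A switched matching together with all but the last vertex of the cycle determines the original
   matching: the last vertex is the one sent to [t w] by the switched matching. *)
Lemma agreeing_switch t w S : w \notin S -> few_fixed S -> 0 < #|V| ->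
  #|V| * #|agreeing t (w |: S)| <= 2 * c * #|agreeing t S|.
Proof.
move=> wS fewS V0; pose cyc := k.+1.-tuple V.
pose P := [set uv : {perm V} * cyc | (uv.1 \in agreeing t (w |: S)) &
  (uv.2 \in switching_cycles uv.1 w S)].
pose sw (uv : {perm V} * cyc) :=
  (switch uv.1 (w :: uv.2), [tuple of belast (thead uv.2) (behead uv.2)]).
have P_lower : #|V| ^ k.+1 * #|agreeing t (w |: S)| <= 2 * c * #|P|.
  have -> : #|P| = \sum_(u in agreeing t (w |: S)) #|switching_cycles u w S|.
    rewrite -sum1dep_card -(pair_big_dep (fun u => u \in agreeing t (w |: S))
      (fun u v => v \in switching_cycles u w S) (fun _ _ => 1)) /=.
    by apply: eq_bigr => u _; rewrite sum1_card.
  rewrite mulnC -sum_nat_const big_distrr /=; apply: leq_sum => u _.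
  exact: many_switching_cycles.
have sw_inj : {in P &, injective sw}.
  move=> [u v] [u' v'] /setIdP[/= uP vP] /setIdP[/= uP' vP'] [eq_sw eq_belast].
  have tw s r : s \in agreeing t (w |: S) -> r \in switching_cycles s w S ->
      switch s (w :: r) (last w r) = t w.
    case/setIdP=> _ /forall_inP/(_ w (setU11 _ _))/eqP st rP.
    by rewrite switch_last ?(uniq_switching_cycle rP).
  have eq_last : last w v = last w v'.
    by apply: (@perm_inj _ (switch u (w :: v))); rewrite {2}eq_sw !tw.
  have eq_v : v = v'.
    apply: val_inj; case/tupleP: v eq_belast eq_last {eq_sw vP} => x v.
    case/tupleP: v' {vP'} => x' v' /=; rewrite /thead !(tnth_nth w) /= => eq_b eq_l.
    by rewrite !lastI eq_b eq_l.
  rewrite -eq_v in eq_sw *; congr (_, _).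
  exact: switch_inj (uniq_switching_cycle vP) eq_sw.
have P_upper : #|P| <= #|agreeing t S| * #|V| ^ k.
  rewrite -(card_in_imset sw_inj) -card_tuple -[#|{: k.-tuple V}|]cardsT -cardsX.
  apply/subset_leq_card/subsetP => _ /imsetP[[u v] /setIdP[/= uP vP] ->].
  by rewrite in_setX in_setT andbT; apply: switch_agreeing.
have := leq_trans P_lower (leq_mul (leqnn (2 * c)) P_upper).
by rewrite mulnA [_ * #|V| ^ k]mulnC (expnSr #|V| k) -mulnA leq_pmul2l // expn_gt0 V0.
Qed.

Lemma card_agreeing t S : 0 < #|V| -> few_fixed S ->
  #|V| ^ #|S| * #|agreeing t S| <= (2 * c) ^ #|S| * #|perfect_matchings|.
Proof.
move=> V0; have [j] := ubnP #|S|; elim: j S => // j IH S.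
have [->|/set0Pn[w wS]] := eqVneq S set0.
  by move=> _ _; rewrite cards0 !mul1n; apply/subset_leq_card/subsetP => u /setIdP[].
have cS : #|S| = #|S :\ w|.+1 by rewrite (cardsD1 w) wS.
rewrite cS ltnS => Sj fewS; have fewSw : few_fixed (S :\ w) by apply: few_fixedW fewS; rewrite cS.
have := @agreeing_switch t w (S :\ w) _ fewSw V0; rewrite setD1K // setD11 => /(_ isT) switched.
rewrite !expnS [#|V| * _]mulnC -mulnA; apply: leq_trans (leq_mul (leqnn _) switched) _.
by rewrite mulnCA -[2 * c * _ * _]mulnA leq_mul2l IH ?orbT.
Qed.

Lemma card_n_agree_ge t i : 0 < #|V| -> 2 * c * (k.+1 * (i.+1 + k)) <= #|V| ->
  #|[set u in perfect_matchings | i <= n_agree t u]| * i`! <=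
  (2 * c) ^ i * #|perfect_matchings|.
Proof.
move=> V0 fewi; pose Si := [set S : {set V} | #|S| == i].
have cover : #|[set u in perfect_matchings | i <= n_agree t u]| <=
    \sum_(S in Si) #|agreeing t S|.
  under eq_bigr => S _ do rewrite -sum1_card.
  rewrite (exchange_big_dep (mem perfect_matchings)) /=; last by move=> S u _ /setIdP[].
  rewrite -sum1dep_card big_mkcondr; apply: leq_sum => u uM; case: ifP => // iu.
  have [S] : exists2 S : {set V}, S \subset [set x | t x == u x] & #|S| == i.
    have := bin_gt0 (n_agree t u) i; rewrite iu -(cards_draws [set x | t x == u x]).
    by case/card_gt0P=> S; rewrite inE => /andP[]; exists S.
  move=> /subsetP Su Si_eq; rewrite (bigD1 S) //= [u \in agreeing t S]inE uM inE Si_eq.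
  by apply/forall_inP => x /Su; rewrite inE eq_sym.
have agree_bound : #|V| ^ i * \sum_(S in Si) #|agreeing t S| <=
    'C(#|V|, i) * ((2 * c) ^ i * #|perfect_matchings|).
  rewrite -[X in 'C(X, i)]cardsT -cards_draws (_ : [set S | _] = Si); last first.
    by apply/setP => S; rewrite !inE subsetT.
  rewrite -sum_nat_const big_distrr; apply: leq_sum => S; rewrite inE => /eqP S_i.
  by rewrite -{1 2}S_i; apply: card_agreeing; rewrite // /few_fixed S_i.
have ffact_le n j : n ^_ j <= n ^ j.
  elim: j n => [|j IH] [|n]; rewrite ?ffact0n // ffactSS expnS leq_mul //.
  by apply: leq_trans (IH n) _; case: j {IH} => // j; rewrite leq_exp2r.
have pow_gt0 : 0 < #|V| ^ i by rewrite expn_gt0 V0.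
rewrite -(leq_pmul2l pow_gt0) mulnA.
apply: leq_trans (leq_mul (leq_mul (leqnn _) cover) (leqnn _)) _.
apply: leq_trans (leq_mul agree_bound (leqnn _)) _.
by rewrite mulnAC bin_ffact leq_mul2r ffact_le orbT.
Qed.

End Switching.

(** * Dense pairs of finite sets *)

Lemma exists_subset_card (T : finType) (S : {set T}) k : k <= #|S| ->
  exists2 S' : {set T}, S' \subset S & #|S'| = k.
Proof.
rewrite -bin_gt0 -cards_draws => /card_gt0P[S']; rewrite inE => /andP[S'S /eqP].
by exists S'.
Qed.

Lemma exists_subset_between (T : finType) (S S' : {set T}) k :
  S \subset S' -> #|S| <= k <= #|S'| ->
  exists2 S0 : {set T}, S \subset S0 /\ S0 \subset S' & #|S0| = k.
Proof.
move=> SS' /andP[Sk kS'].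
have [|D DS' cD] := @exists_subset_card T (S' :\: S) (k - #|S|).
  by rewrite cardsDS // leq_sub2r.
exists (S :|: D); first by rewrite subsetUl subUset SS' (subset_trans DS') ?subsetDl.
rewrite cardsU cD (_ : S :&: D = set0) ?cards0 ?subn0 ?subnKC //.
by apply/eqP; rewrite setI_eq0 disjoint_sym (disjointWl DS') // disjoint_sym disjoints_subset setCD subsetUr.
Qed.

Section Averaging.
Variable T : finType.
Implicit Types (f : T -> nat) (A B : {set T}).

Lemma subset_ge_average f A k : k <= #|A| ->
  exists2 B : {set T}, B \subset A /\ #|B| = k &
    k * (\sum_(x in A) f x) <= #|A| * (\sum_(x in B) f x).
Proof.
move=> kA; have [j] := ubnP (#|A| - k); elim: j A kA => // j IH A kA Akj.
have [kA_eq|k_neq] := eqVneq k #|A|; first by exists A; rewrite // kA_eq.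
have lt_kA : k < #|A| by rewrite ltn_neqAle k_neq kA.
have /card_gt0P[x0 x0A] : 0 < #|A| by lia.
case: (arg_minnP (P := mem A) f x0A) => x xA xmin; rewrite {x0 x0A}/= in xA.
have cA : #|A| = #|A :\ x|.+1 by rewrite (cardsD1 x) xA.
have [||B [BA cB] avgB] := IH (A :\ x); [lia|lia|].
exists B; first by split; rewrite // (subset_trans BA) ?subD1set.
have x_le_avg : #|A :\ x| * f x <= \sum_(y in A :\ x) f y.
  by rewrite -sum_nat_const; apply: leq_sum => y /setD1P[_]; apply: xmin.
have [->|k0] := posnP k; first by rewrite mul0n.
have Ax_gt0 : 0 < #|A :\ x| by lia.
rewrite (big_setD1 x) //= -(leq_pmul2l Ax_gt0) cA.
move: avgB (leq_mul (leqnn k) x_le_avg); move: #|A :\ x| (\sum_(y in _) _) (\sum_(y in _) _) (f x).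
by clear; move=> a sA sB fx; nia.
Qed.

Lemma subset_le_average f A k : k <= #|A| ->
  exists2 B : {set T}, B \subset A /\ #|B| = k &
    #|A| * (\sum_(x in B) f x) <= k * (\sum_(x in A) f x).
Proof.
move=> kA; pose m := \sum_x f x.
have le_m x : f x <= m by rewrite /m (bigD1 x) //= leq_addr.
have [B [BA cB] avgB] := subset_ge_average (fun x => m - f x) kA.
exists B => //.
have sumC (C : {set T}) : \sum_(x in C) (m - f x) + \sum_(x in C) f x = #|C| * m.
  by rewrite -big_split /= -sum_nat_const; apply: eq_bigr => x _; rewrite subnK.
move: avgB (sumC A) (sumC B); rewrite cB.
by move: (\sum_(x in A) _) (\sum_(x in B) _) (\sum_(x in A) _) (\sum_(x in B) _); nia.
Qed.

End Averaging.

Section Pairs.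
Variables (X Y : finType).
Implicit Types (r : X -> Y -> bool) (A : {set X}) (B : {set Y}) (L M k N : nat).

Definition deg_in r B x := #|[set y in B | r x y]|.
Definition nedges r A B := \sum_(x in A) deg_in r B x.

Lemma deg_inE r B x : deg_in r B x = \sum_(y in B) (r x y : nat).
Proof. by rewrite /deg_in -sum1dep_card big_mkcondr; apply: eq_bigr => y _; case: (r x y). Qed.

Lemma nedgesE r A B : nedges r A B = \sum_(x in A) \sum_(y in B) (r x y : nat).
Proof. by apply: eq_bigr => x _; apply: deg_inE. Qed.

Lemma deg_in_le r B x : deg_in r B x <= #|B|.
Proof. by apply/subset_leq_card/subsetP => y /setIdP[]. Qed.

Lemma nedges_le r A B : nedges r A B <= #|A| * #|B|.
Proof. by rewrite -sum_nat_const; apply: leq_sum => x _; apply: deg_in_le. Qed.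

Lemma deg_in_setD r B B' x : deg_in r B x <= deg_in r B' x + #|B :\: B'|.
Proof.
apply: leq_trans (leq_card_setU _ _); apply/subset_leq_card/subsetP => y.
by rewrite !inE => /andP[-> ->]; rewrite orbC; case: (y \in B').
Qed.

Lemma nedges_setDl r A A' B :
  A' \subset A -> nedges r A B = nedges r A' B + nedges r (A :\: A') B.
Proof. by move=> A'A; rewrite /nedges (big_setID A') /= (setIidPr A'A). Qed.

End Pairs.

Definition transpose (X Y : Type) (r : X -> Y -> bool) : Y -> X -> bool := fun y x => r x y.

Lemma nedgesC (X Y : finType) (r : X -> Y -> bool) A B :
  nedges r A B = nedges (transpose r) B A.
Proof. by rewrite !nedgesE exchange_big. Qed.

Lemma nedges_setDr (X Y : finType) (r : X -> Y -> bool) A (B B' : {set Y}) :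
  B' \subset B -> nedges r A B = nedges r A B' + nedges r A (B :\: B').
Proof. by move=> B'B; rewrite !(nedgesC r) (nedges_setDl _ _ B'B). Qed.

Section Subrectangles.
Variables (X Y : finType) (r : X -> Y -> bool).
Implicit Types (A : {set X}) (B : {set Y}) (L K k N : nat).

Lemma dense_subrect A B k l : k <= #|A| -> l <= #|B| ->
  exists A' B', [/\ A' \subset A, B' \subset B, #|A'| = k, #|B'| = l &
    k * l * nedges r A B <= #|A| * #|B| * nedges r A' B'].
Proof.
move=> kA lB.
have [A' [A'A cA'] avgA] := subset_ge_average (deg_in r B) kA.
have [B' [B'B cB'] avgB] := subset_ge_average (deg_in (transpose r) A') lB.
exists A', B'; split=> //.
have {}avgA : k * nedges r A B <= #|A| * nedges r A' B := avgA.
have {}avgB : l * nedges r A' B <= #|B| * nedges r A' B' by rewrite !(nedgesC r).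
move: (leq_mul (leqnn l) avgA) (leq_mul (leqnn #|A|) avgB).
by move: #|A| #|B| (nedges r A B) (nedges r A' B) (nedges r A' B'); clear; lia.
Qed.

Lemma sparse_subrect A B k l : k <= #|A| -> l <= #|B| ->
  exists A' B', [/\ A' \subset A, B' \subset B, #|A'| = k, #|B'| = l &
    #|A| * #|B| * nedges r A' B' <= k * l * nedges r A B].
Proof.
move=> kA lB.
have [A' [A'A cA'] avgA] := subset_le_average (deg_in r B) kA.
have [B' [B'B cB'] avgB] := subset_le_average (deg_in (transpose r) A') lB.
exists A', B'; split=> //.
have {}avgA : #|A| * nedges r A' B <= k * nedges r A B := avgA.
have {}avgB : #|B| * nedges r A' B' <= l * nedges r A' B by rewrite !(nedgesC r).
move: (leq_mul (leqnn l) avgA) (leq_mul (leqnn #|A|) avgB).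
by move: #|A| #|B| (nedges r A B) (nedges r A' B) (nedges r A' B'); clear; lia.
Qed.

Definition lower_regular L N A B :=
  forall A' B', A' \subset A -> B' \subset B -> #|A'| = N %/ L -> #|B'| = N %/ L ->
    (N %/ L) ^ 2 * nedges r A B <= 2 * N ^ 2 * nedges r A' B'.

(* If one corner is sparse, then one of the two rectangles covering the rest is denser than the
   whole by a factor [1 + 1/c]. *)
Lemma sparse_corner_complement c k N A B A' B' :
  k <= N -> 2 * N ^ 2 <= c * k ^ 2 -> #|A| = N -> #|B| = N ->
  A' \subset A -> B' \subset B -> #|A'| = k -> #|B'| = k ->
  2 * N ^ 2 * nedges r A' B' < k ^ 2 * nedges r A B ->
  (c + 1) * ((N - k) * N) * nedges r A B <= c * N ^ 2 * nedges r (A :\: A') B \/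
  (c + 1) * (k * (N - k)) * nedges r A B <= c * N ^ 2 * nedges r A' (B :\: B').
Proof.
move=> kN cN cA cB A'A B'B cA' cB' sparse; set e := nedges r A B.
have split_e : e = nedges r A' B' + nedges r A' (B :\: B') + nedges r (A :\: A') B.
  by rewrite /e (nedges_setDl _ _ A'A) (nedges_setDr _ _ B'B).
case: leqP => [?|low1]; first by left.
case: leqP => [?|low2]; first by right.
exfalso; have e_gt0 : 0 < e by rewrite lt0n; apply: contraTneq low1 => ->; rewrite muln0.
have area : (N - k) * N + k * (N - k) + k ^ 2 = N ^ 2.
  by have [D ->] : exists D, N = k + D; [exists (N - k); lia | rewrite addKn -!mulnn; lia].
rewrite -/e in sparse; set q := k ^ 2 in area cN sparse; set p := N ^ 2 in area cN sparse low1 low2.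
set a := (N - k) * N in area low1; set b := k * (N - k) in area low2.
have double : 2 * (c * p) * e < (2 * ((c + 1) * (a + b)) + c * q) * e.
  rewrite [X in _ * X < _]split_e; have := leq_mul (leqnn c) (ltnW sparse).
  by move: low1 low2; clearbody e p q a b; clear; lia.
move: double; rewrite ltn_pmul2r // -area in cN *.
by clear -cN; clearbody a b q; lia.
Qed.

Lemma density_increment L N A B : 1 < L -> L <= N ->
  #|A| = N -> #|B| = N -> lower_regular L N A B \/
  exists A' B', [/\ A' \subset A, B' \subset B, #|A'| = N %/ L, #|B'| = N %/ L &
    (8 * L ^ 2 + 1) * (N %/ L) ^ 2 * nedges r A B <= 8 * L ^ 2 * N ^ 2 * nedges r A' B'].
Proof.
move=> L1 LN cA cB; set k := N %/ L; set c := 8 * L ^ 2.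
have k0 : 0 < k by rewrite divn_gt0 //; lia.
have kN2 : 2 * k <= N by have := leq_divM N L; rewrite -/k; nia.
have Nk : N < k.+1 * L by apply: ltn_ceil; lia.
pose sparse (AB : {set X} * {set Y}) := [&& AB.1 \subset A, AB.2 \subset B, #|AB.1| == k,
  #|AB.2| == k & 2 * N ^ 2 * nedges r AB.1 AB.2 < k ^ 2 * nedges r A B].
case: (pickP sparse) => [[A' B']|no_sparse]; last first.
  left=> A' B' A'A B'B cA' cB'; have := no_sparse (A', B').
  by rewrite /sparse /= A'A B'B cA' cB' !eqxx /= ltnNge => /negbFE.
case/and5P=> /= A'A B'B /eqP cA' /eqP cB' sp; right.
have denser A1 B1 : k <= #|A1| -> k <= #|B1| -> A1 \subset A -> B1 \subset B ->
    (c + 1) * (#|A1| * #|B1|) * nedges r A B <= c * N ^ 2 * nedges r A1 B1 ->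
    exists A2 B2, [/\ A2 \subset A, B2 \subset B, #|A2| = k, #|B2| = k &
      (c + 1) * k ^ 2 * nedges r A B <= c * N ^ 2 * nedges r A2 B2].
  move=> kA1 kB1 A1A B1B dense1.
  have [A2 [B2 [A2A1 B2B1 cA2 cB2 dense2]]] := dense_subrect kA1 kB1.
  exists A2, B2; split=> //; [exact: subset_trans A1A | exact: subset_trans B1B |].
  have area_gt0 : 0 < #|A1| * #|B1| by rewrite muln_gt0 !(leq_trans k0).
  rewrite -(leq_pmul2l area_gt0); move: (leq_mul (leqnn (k ^ 2)) dense1).
  have := leq_mul (leqnn (c * N ^ 2)) dense2; rewrite mulnn.
  move: (#|A1| * #|B1|) (k ^ 2) (c * N ^ 2) (c + 1); clear.
  by move: (nedges r A B) (nedges r A1 B1) (nedges r A2 B2); nia.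
have cN : 2 * N ^ 2 <= c * k ^ 2.
  have : N ^ 2 <= (2 * L * k) ^ 2 by rewrite leq_exp2r //; nia.
  by rewrite !expnMn /c; nia.
have cDA : #|A :\: A'| = N - k by rewrite cardsDS // cA cA'.
have cDB : #|B :\: B'| = N - k by rewrite cardsDS // cB cB'.
have kN : k <= N by lia.
have [dense|dense] := sparse_corner_complement kN cN cA cB A'A B'B cA' cB' sp.
  by apply: (denser (A :\: A') B); rewrite ?subsetDl ?cDA ?cB //; lia.
by apply: (denser A' (B :\: B')); rewrite ?subsetDl ?cDB ?cA' //; lia.
Qed.

Lemma bernoulli_expn c j : c ^ j * (c + j) <= (c + 1) ^ j * c.
Proof.
elim: j => [|j IH]; first by rewrite !expn0 !mul1n addn0.
rewrite !expnS; apply: leq_trans (_ : (c + 1) * (c ^ j * (c + j)) <= _); last first.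
  by rewrite -[_ * _ * c]mulnA leq_mul2l IH orbT.
by move: (c ^ j); nia.
Qed.

Definition regular_pair_ratio L K : nat := (2 * L) ^ (8 * L ^ 2 * K).+1.

Definition has_regular_subpair L K t A B := exists N A' B',
  [/\ t <= regular_pair_ratio L K * N, L <= N, A' \subset A, B' \subset B &
      [/\ #|A'| = N, #|B'| = N, lower_regular L N A' B' & N ^ 2 <= K * nedges r A' B']].

(* [c ^ j / (c + 1) ^ j] bounds the inverse of the density gained after [j] increments *)
Definition has_denser_subpair L K j t A B := let c := 8 * L ^ 2 in exists N A' B',
  [/\ t <= (2 * L) ^ j * N, A' \subset A, B' \subset B, #|A'| = N /\ #|B'| = N &
      (c + 1) ^ j * N ^ 2 <= c ^ j * (K * nedges r A' B')].

Lemma denser_subpair_step L K j t A B : 1 < L ->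
  j < 8 * L ^ 2 * K -> regular_pair_ratio L K <= t ->
  has_denser_subpair L K j t A B ->
  has_regular_subpair L K t A B \/ has_denser_subpair L K j.+1 t A B.
Proof.
move=> L1 j_lt t_ge [N [A' [B' [tN A'A B'B [cA' cB'] dense]]]]; pose c := 8 * L ^ 2.
have c0 : 0 < c by rewrite /c muln_gt0 expn_gt0; lia.
have L2 : 0 < 2 * L by lia.
have ratio_split : regular_pair_ratio L K = (2 * L) ^ j * (2 * L) ^ ((c * K).+1 - j).
  by rewrite -expnD; congr (_ ^ _); rewrite /c; lia.
have N_ge : 2 * L <= N.
  have : (2 * L) ^ j * (2 * L) <= (2 * L) ^ j * N.
    apply: leq_trans (leq_trans t_ge tN); rewrite ratio_split leq_mul2l -[X in X <= _]expn1.
    by rewrite leq_pexp2l ?orbT // /c; lia.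
  by rewrite leq_pmul2l // expn_gt0 L2.
have LN : L <= N by lia.
have [reg|[A1 [B1 [A1A B1B cA1 cB1 inc]]]] := density_increment L1 LN cA' cB'.
  left; exists N, A', B'; split=> //.
    by rewrite ratio_split (leq_trans tN) // -mulnA leq_mul2l leq_pmull ?orbT // expn_gt0 L2.
  split=> //; have cj0 : 0 < c ^ j by rewrite expn_gt0 c0.
  rewrite -(leq_pmul2l cj0); apply: leq_trans dense; rewrite leq_mul2r; apply/orP; right.
  by case: (j) => // i; rewrite leq_exp2r // leq_addr.
right; exists (N %/ L), A1, B1; split=> //.
- rewrite expnSr -mulnA (leq_trans tN) // leq_mul2l; apply/orP; right.
  have : N < (N %/ L).+1 * L by apply: ltn_ceil; lia.
  have : 0 < N %/ L by rewrite divn_gt0; lia.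
  by nia.
- exact: subset_trans A'A.
- exact: subset_trans B'B.
have N2 : 0 < N ^ 2 by rewrite expn_gt0; lia.
rewrite -/c in dense inc *; rewrite -(leq_pmul2l N2) (expnS (c + 1)) (expnS c).
have := leq_mul (leqnn ((c + 1) * (N %/ L) ^ 2)) dense.
have := leq_mul (leqnn (c ^ j * K)) inc.
move: (nedges r A' B') (nedges r A1 B1) ((c + 1) ^ j) (c ^ j) (N ^ 2) ((N %/ L) ^ 2); clear.
by move=> e1 e2 u v q p; nia.
Qed.

Lemma not_denser_subpair L K t A B : 0 < L -> 0 < t ->
  ~ has_denser_subpair L K (8 * L ^ 2 * K) t A B.
Proof.
move=> L0 t0 [N [A' [B' [tN _ _ [cA' cB']]]]]; set c := 8 * L ^ 2 => dense.
have c0 : 0 < c by rewrite /c muln_gt0 expn_gt0 L0.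
have N0 : 0 < N by rewrite lt0n; apply: contraTneq tN => ->; rewrite muln0 -ltnNge.
have dense1 : (c + 1) ^ (c * K) <= c ^ (c * K) * K.
  have N2 : 0 < N ^ 2 by rewrite expn_gt0 N0.
  rewrite -(leq_pmul2r N2) -mulnA; apply: leq_trans dense _; rewrite !leq_mul2l.
  by have := nedges_le r A' B'; rewrite cA' cB' mulnn => ->; rewrite !orbT.
have := leq_trans (bernoulli_expn c (c * K)) (leq_mul dense1 (leqnn c)).
by rewrite -mulnA leq_pmul2l ?expn_gt0 ?c0 // [K * c]mulnC; clear -c0; lia.
Qed.

Lemma lower_regular_pair L K t A B : 1 < L ->
  regular_pair_ratio L K <= t -> #|A| = t -> #|B| = t -> t ^ 2 <= K * nedges r A B ->
  has_regular_subpair L K t A B.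
Proof.
move=> L1 t_ge cA cB dense.
have t0 : 0 < t by apply: leq_trans t_ge; rewrite expn_gt0; lia.
suff iter j : j <= 8 * L ^ 2 * K -> has_regular_subpair L K t A B \/ has_denser_subpair L K j t A B.
  by case: (iter _ (leqnn _)) => // /not_denser_subpair; case=> //; lia.
elim: j => [_|j IH j_lt].
  by right; exists t, A, B; split; rewrite // !mul1n.
have [?|denser] := IH (ltnW j_lt); first by left.
exact: denser_subpair_step denser.
Qed.

End Subrectangles.

Section SuperDense.
Variables (X Y : finType).
Implicit Types (r : X -> Y -> bool) (A : {set X}) (B : {set Y}) (L k N : nat).

Definition bidense L k r A B := forall A' B', A' \subset A -> B' \subset B ->
  k <= #|A'| -> k <= #|B'| -> #|A'| * #|B'| <= L * nedges r A' B'.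

Lemma lower_regular_bidense r L K N A B : 0 < L <= N ->
  lower_regular r L N A B -> N ^ 2 <= K * nedges r A B ->
  bidense (2 * K) (N %/ L) r A B.
Proof.
move=> /andP[L0 LN] reg dense A1 B1 A1A B1B kA1 kB1.
have [A2 [B2 [A2A1 B2B1 cA2 cB2 sparse]]] := sparse_subrect r kA1 kB1.
have reg2 := reg A2 B2 (subset_trans A2A1 A1A) (subset_trans B2B1 B1B) cA2 cB2.
have k2 : 0 < (N %/ L) ^ 2 by rewrite expn_gt0 divn_gt0 ?LN.
have N2 : 0 < N ^ 2 by rewrite expn_gt0 (leq_trans L0).
rewrite -(leq_pmul2l k2) -(leq_pmul2l N2); move: sparse; rewrite mulnn => sparse.
have := leq_mul (leqnn ((N %/ L) ^ 2 * (#|A1| * #|B1|))) dense.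
have := leq_mul (leqnn (#|A1| * #|B1| * K)) reg2.
have := leq_mul (leqnn (K * 2 * N ^ 2)) sparse.
move: (N ^ 2) ((N %/ L) ^ 2) (#|A1| * #|B1|) (nedges r A B) (nedges r A1 B1) (nedges r A2 B2).
by clear; lia.
Qed.

Lemma few_low_degree L k r A B : 0 < k <= #|B| -> bidense L k r A B ->
  #|[set x in A | 2 * L * deg_in r B x < #|B|]| < k.
Proof.
move=> /andP[k0 kB] dense; set low := [set x in A | _]; rewrite ltnNge; apply/negP => k_low.
have lowA : low \subset A by apply/subsetP => x /setIdP[].
have low_sparse : 2 * L * nedges r low B <= #|low| * #|B|.
  rewrite /nedges big_distrr -sum_nat_const; apply: leq_sum => x /setIdP[_]; exact: ltnW.
have := dense low B lowA (subxx _) k_low kB.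
have : 0 < #|low| * #|B| by rewrite muln_gt0 !(leq_trans k0).
by move: low_sparse; rewrite -mulnA; lia.
Qed.

Definition superdense L k r A B := [/\ bidense L k r A B,
  {in A, forall x, #|B| <= L * deg_in r B x} &
  {in B, forall y, #|A| <= L * deg_in (transpose r) A y}].

End SuperDense.

Lemma bidense_tr (X Y : finType) (r : X -> Y -> bool) L k A B :
  bidense L k r A B -> bidense L k (transpose r) B A.
Proof. by move=> dense B' A' B'B A'A kB' kA'; rewrite -nedgesC mulnC; apply: dense. Qed.

Lemma trim_min_degree (X Y : finType) (r : X -> Y -> bool) L k (A : {set X})
    (B B' : {set Y}) x : 0 < L ->
  x \in A -> x \notin [set x in A | 2 * L * deg_in r B x < #|B|] -> 4 * L * k <= #|B| ->
  #|B :\: B'| = k -> #|B| <= 4 * L * deg_in r B' x.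
Proof.
move=> L0 xA; rewrite inE xA /= -leqNgt => high kB cD.
have := leq_mul (leqnn (4 * L)) (deg_in_setD r B B' x); rewrite cD.
by move: high kB; rewrite mulnDr -![_ * L * _]mulnA; lia.
Qed.

Lemma bidense_superdense (X Y : finType) (r : X -> Y -> bool) L k N (A : {set X}) (B : {set Y}) :
  0 < L -> 0 < k ->
  4 * L * k <= N -> #|A| = N -> #|B| = N -> bidense L k r A B ->
  exists (A' : {set X}) (B' : {set Y}),
    [/\ A' \subset A, B' \subset B, #|A'| = N - k, #|B'| = N - k &
    superdense (4 * L) k r A' B'].
Proof.
move=> L0 k0 kN cA cB dense; have kleN : k <= N by apply: leq_trans kN; rewrite leq_pmull ?muln_gt0.
set lowA := [set x in A | 2 * L * deg_in r B x < #|B|].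
set lowB := [set y in B | 2 * L * deg_in (transpose r) A y < #|A|].
have lowAk : #|lowA| < k by apply: few_low_degree dense; rewrite k0 cB.
have lowBk : #|lowB| < k by apply: few_low_degree (bidense_tr dense); rewrite k0 cA.
have [||DA [lowDA DAA] cDA] := @exists_subset_between _ lowA A k.
- by apply/subsetP => x /setIdP[].
- by rewrite (ltnW lowAk) cA.
have [||DB [lowDB DBB] cDB] := @exists_subset_between _ lowB B k.
- by apply/subsetP => x /setIdP[].
- by rewrite (ltnW lowBk) cB.
exists (A :\: DA), (B :\: DB); split; rewrite ?subsetDl ?cardsDS ?cA ?cB ?cDA ?cDB //; split.
- move=> A1 B1 A1A B1B kA1 kB1.
  apply: leq_trans (dense A1 B1 _ _ kA1 kB1) _; last by rewrite leq_mul2r leq_pmull ?orbT.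
    exact: subset_trans A1A (subsetDl _ _).
  exact: subset_trans B1B (subsetDl _ _).
- move=> x /setDP[xA xD]; apply: (@leq_trans #|B|); first exact/subset_leq_card/subsetDl.
  apply: trim_min_degree (contra (subsetP lowDA x) xD) _ _; rewrite ?cB //.
  by rewrite setDDr setDv set0U (setIidPr DBB) cDB.
move=> y /setDP[yB yD]; apply: (@leq_trans #|A|); first exact/subset_leq_card/subsetDl.
apply: trim_min_degree (contra (subsetP lowDB y) yD) _ _; rewrite ?cA //.
by rewrite setDDr setDv set0U (setIidPr DAA) cDA.
Qed.

Lemma superdense_sub (X Y : finType) (r : X -> Y -> bool) L k (A A' : {set X}) (B B' : {set Y}) :
  A' \subset A -> B' \subset B -> 2 * L * #|A :\: A'| <= #|A| -> 2 * L * #|B :\: B'| <= #|B| ->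
  superdense L k r A B -> superdense (2 * L) k r A' B'.
Proof.
move=> A'A B'B fewA fewB [dense degA degB].
have keep (Z W : finType) (q : Z -> W -> bool) (S S' : {set W}) z : S' \subset S ->
    2 * L * #|S :\: S'| <= #|S| -> #|S| <= L * deg_in q S z -> #|S'| <= 2 * L * deg_in q S' z.
  move=> S'S few degS; apply: leq_trans (subset_leq_card S'S) _.
  have := leq_mul (leqnn L) (deg_in_setD q S S' z); move: few degS; rewrite mulnDr -!mulnA; lia.
split.
- move=> A1 B1 A1A B1B kA1 kB1.
  have := dense A1 B1 (subset_trans A1A A'A) (subset_trans B1B B'B) kA1 kB1.
  by move/leq_trans; apply; rewrite leq_mul2r leq_pmull ?orbT.
- by move=> x xA; apply: keep fewB (degA x (subsetP A'A x xA)).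
by move=> y yB; apply: keep fewA (degB y (subsetP B'B y yB)).
Qed.

Section Reindexing.
Variables (X Y X' Y' : finType) (r : X -> Y -> bool) (f : X' -> X) (g : Y' -> Y).
Hypotheses (f_inj : injective f) (g_inj : injective g).
Let pullback x y := r (f x) (g y).

Lemma deg_in_imset (B : {set Y'}) x : deg_in r (g @: B) (f x) = deg_in pullback B x.
Proof. by rewrite !deg_inE big_imset //= => y z _ _; apply: g_inj. Qed.

Lemma nedges_imset (A : {set X'}) (B : {set Y'}) : nedges r (f @: A) (g @: B) = nedges pullback A B.
Proof.
rewrite /nedges big_imset /=; last by move=> x z _ _; apply: f_inj.
by apply: eq_bigr => x _; apply: deg_in_imset.
Qed.

End Reindexing.

Lemma superdense_imset (X Y X' Y' : finType) (r : X -> Y -> bool) (f : X' -> X) (g : Y' -> Y)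
    L k (A : {set X'}) (B : {set Y'}) : injective f -> injective g ->
  superdense L k r (f @: A) (g @: B) -> superdense L k (fun x y => r (f x) (g y)) A B.
Proof.
move=> f_inj g_inj [dense degA degB]; split.
- move=> A1 B1 A1A B1B kA1 kB1; rewrite -nedges_imset // -(card_imset _ f_inj) -(card_imset _ g_inj).
  by apply: dense; rewrite ?imsetS ?card_imset.
- by move=> x xA; have := degA (f x) (imset_f f xA); rewrite deg_in_imset // card_imset.
move=> y yB; have := degB (g y) (imset_f g yB).
by rewrite (deg_in_imset (transpose r) g f_inj) card_imset.
Qed.

(** * Alternating cycles in dense relations *)

(* [E] keeps a proportion [1/M] of the neighbours of every vertex and of the pairs of [comp] in every
   rectangle containing a proportion [1/c] of all pairs. *)
Definition retains (V : finType) (M c : nat) (comp E : rel V) :=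
  [/\ forall x, deg_in comp setT x <= M * deg_in E setT x,
      forall x, deg_in (transpose comp) setT x <= M * deg_in (transpose E) setT x &
      forall A B, #|V| ^ 2 <= c * nedges comp A B -> nedges comp A B <= M * nedges E A B].

Lemma many_popular (X Y : finType) (comp r : X -> Y -> bool) (n L1 L2 K M : nat) (A : {set X}) :
  0 < n -> #|Y| <= n -> (forall x, n <= L1 * deg_in comp setT x) ->
  (forall A B, n ^ 2 <= K * nedges comp A B -> n ^ 2 <= M * nedges r A B) ->
  2 * L1 * L2 <= K -> n <= L2 * #|A| ->
  n <= 2 * L1 * #|[set y | n <= M * deg_in (transpose r) A y]|.
Proof.
move=> n0 Yn deg_comp keep LK nA; set pop := [set y | _]; rewrite leqNgt; apply/negP => few_pop.
have deg_unpop x : n <= 2 * L1 * deg_in comp (~: pop) x.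
  have := leq_mul (leqnn L1) (deg_in_setD comp setT (~: pop) x).
  rewrite setDE setTI setCK mulnDr; have := deg_comp x; move: few_pop; rewrite -!mulnA; lia.
have many_unpop : n ^ 2 <= K * nedges comp A (~: pop).
  apply: leq_trans (leq_mul LK (leqnn _)).
  have : n * #|A| <= 2 * L1 * nedges comp A (~: pop).
    by rewrite mulnC -sum_nat_const /nedges big_distrr; apply: leq_sum => x _; apply: deg_unpop.
  move/(leq_mul (leqnn L2)); have := leq_mul nA (leqnn n); rewrite mulnn.
  by move: #|A| (nedges _ _ _); clear; lia.
have := keep _ _ many_unpop; rewrite nedgesC leqNgt => /negP; apply.
have [->|/set0Pn[y y_unpop]] := eqVneq (~: pop) set0.
  by rewrite /nedges big_set0 muln0 expn_gt0 n0.
apply: (@leq_trans (\sum_(y in ~: pop) n)); last first.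
  by rewrite sum_nat_const -mulnn leq_mul2r (leq_trans (max_card _)) ?orbT.
have low z : z \in ~: pop -> M * deg_in (transpose r) A z < n by rewrite !inE -ltnNge.
rewrite /nedges big_distrr (bigD1 y) //= [X in _ < X](bigD1 y) //= -addSn.
by rewrite leq_add ?low // leq_sum // => z /andP[/low/ltnW].
Qed.

Section DenseCycles.
Variables (V : finType) (comp E : rel V) (L k M : nat).
Implicit Types (A B : {set V}) (t : {perm V}).
Hypotheses (V_gt0 : 0 < #|V|) (k_small : 4 * L * k <= #|V|).
Hypothesis comp_dense : superdense L k comp setT setT.

Definition rectangle_ratio := 2 * L ^ 2 * M + 16 * L ^ 3.

Hypothesis E_retains : retains M rectangle_ratio comp E.

Let c := rectangle_ratio.

Lemma retained_nedges A B :
  #|V| ^ 2 <= c * nedges comp A B -> #|V| ^ 2 <= c * M * nedges E A B.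
Proof.
case: E_retains => _ _ keep large; apply: leq_trans (large) _.
by rewrite -mulnA leq_mul2l (keep _ _ large) orbT.
Qed.

Lemma many_out_popular A : #|V| <= L * M * #|A| ->
  #|V| <= 2 * L * #|[set y | #|V| <= c * M * deg_in (transpose E) A y]|.
Proof.
case: comp_dense => _ degs _ largeA.
apply: (many_popular _ _ _ retained_nedges _ largeA); rewrite // ?max_card //.
  by move=> x; rewrite -[X in X <= _]cardsT degs ?inE.
by rewrite /c /rectangle_ratio; lia.
Qed.

Lemma many_in_popular B : #|V| <= L * M * #|B| ->
  #|V| <= 2 * L * #|[set x | #|V| <= c * M * deg_in E B x]|.
Proof.
case: comp_dense => _ _ degs largeB.
apply: (@many_popular _ _ (transpose comp) (transpose E) #|V| L (L * M) c);
  rewrite // ?max_card //.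
- by move=> x; rewrite -[X in X <= _]cardsT degs ?inE.
- by move=> A' B'; rewrite -(nedgesC comp) -(nedgesC E); apply: retained_nedges.
by rewrite /c /rectangle_ratio; lia.
Qed.

Lemma popular_rectangle A B : #|V| <= 2 * L * #|A| -> #|V| <= 2 * L * #|B| ->
  #|V| ^ 2 <= c * M * nedges E A B.
Proof.
case: comp_dense => dense _ _ largeA largeB; apply: retained_nedges.
have L0 : 0 < L by move: largeA; case: (L) => //; rewrite leqn0; lia.
have large (S : {set V}) : #|V| <= 2 * L * #|S| -> k <= #|S|.
  move=> largeS; have L4 : 0 < 4 * L by rewrite muln_gt0.
  by rewrite -(leq_pmul2l L4) (leq_trans k_small) // (leq_trans largeS) // !leq_mul2r !orbT.
have := dense A B (subsetT _) (subsetT _) (large _ largeA) (large _ largeB).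
have := leq_mul largeA largeB; rewrite mulnn => areaAB.
move/(leq_mul (leqnn (4 * L ^ 2))) => denseAB.
apply: (@leq_trans (4 * L ^ 3 * nedges comp A B)).
  apply: leq_trans areaAB _; rewrite (_ : 2 * L * #|A| * _ = 4 * L ^ 2 * (#|A| * #|B|)); last lia.
  by apply: leq_trans denseAB _; rewrite mulnA (expnSr L 2) mulnA.
by rewrite leq_mul2r /c /rectangle_ratio; apply/orP; right; lia.
Qed.

Lemma card_imset_perm t (S : {set V}) : #|t @: S| = #|S|.
Proof. by rewrite card_imset //; apply: perm_inj. Qed.

Definition first_steps t w := [set x | E w (t x)].
Definition last_steps t w := t @: [set x | E x (t w)].

Lemma alternating_cycles_ge t w (W2 W3 : {set V}) :
  \sum_(x in W2) \sum_(y in W3)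
    E x (t y) * (deg_in (transpose E) (first_steps t w) (t x) * deg_in E (last_steps t w) y) <=
  #|alternating_cycles E 4 t w|.
Proof.
pose quad := (V * V * V * V)%type.
pose tup (q : quad) := [tuple q.1.1.1; q.1.1.2; q.1.2; q.2].
have tup_inj : injective tup.
  move=> [[[x1 x2] x3] x4] [[[y1 y2] y3] y4] /(congr1 val) /= [-> -> -> ->]; by [].
pose Q := [set q : quad | path.cycle (alternating E t) (w :: tup q)].
have -> : #|alternating_cycles E 4 t w| = #|Q|.
  rewrite -(card_imset _ tup_inj); apply: eq_card => v; apply/idP/imsetP => [|[q + ->]].
    move: v; do 4![case/tupleP=> ?]; move=> v; rewrite tuple0 inE => cyc.
    by eexists (_, _, _, _); last exact: val_inj; rewrite inE.
  by rewrite !inE.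
have -> : #|Q| = \sum_x2 \sum_x3 E x2 (t x3) *
    ((\sum_x1 E w (t x1) * E x1 (t x2)) * (\sum_x4 E x3 (t x4) * E x4 (t w))).
  rewrite /Q -sum1dep_card big_mkcond /=.
  transitivity (\sum_x1 \sum_x2 \sum_x3 \sum_x4
      E x2 (t x3) * ((E w (t x1) * E x1 (t x2)) * (E x3 (t x4) * E x4 (t w)))).
    rewrite !pair_bigA /=; apply: eq_bigr => -[[[x1 x2] x3] x4] _ /=; rewrite /alternating andbT.
    by do 5![case: (E _ _) => //=].
  rewrite exchange_big /=; apply: eq_bigr => x2 _; rewrite exchange_big /=; apply: eq_bigr => x3 _.
  rewrite big_distrl big_distrr /=; apply: eq_bigr => x1 _.
  by rewrite !big_distrr.
have first_sum (x2 : V) : \sum_x1 E w (t x1) * E x1 (t x2) =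
    deg_in (transpose E) (first_steps t w) (t x2).
  rewrite deg_inE [RHS]big_mkcond; apply: eq_bigr => x1 _.
  by rewrite inE; case: (E w _); rewrite ?mul1n.
have last_sum (x3 : V) : \sum_x4 E x3 (t x4) * E x4 (t w) =
    deg_in E (last_steps t w) x3.
  rewrite deg_inE big_imset /=; last by move=> ? ? _ _; apply: perm_inj.
  rewrite [RHS]big_mkcond; apply: eq_bigr => x4 _.
  by rewrite inE; case: (E x4 (t w)); rewrite ?muln1 ?muln0.
under [leqRHS]eq_bigr => x2 _ do under eq_bigr => x3 _ do rewrite first_sum last_sum.
rewrite [X in _ <= X](bigID (mem W2)) /= (leq_trans _ (leq_addr _ _)) //.
by apply: leq_sum => x2 _; rewrite [X in _ <= X](bigID (mem W3)) leq_addr.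
Qed.

(* The cycles through [w] are built from both ends: [W2] and [W3] consist of the vertices reached
   from [w] in two steps in many ways, forwards and backwards. *)
Lemma many_alternating_cycles t w :
  #|V| ^ 4 <= (c * M) ^ 3 * #|alternating_cycles E 4 t w|.
Proof.
case: comp_dense E_retains => _ degF degB [keepF keepB _].
pose A := first_steps t w; pose B := last_steps t w.
have largeA : #|V| <= L * M * #|A|.
  have -> : #|A| = deg_in E setT w.
    rewrite -(card_imset_perm t); apply: eq_card => y; rewrite !inE.
    by apply/imsetP/idP => [[x + ->]|Ey]; [rewrite inE | exists ((t^-1)%g y); rewrite ?inE permKV].
  apply: leq_trans (_ : L * deg_in comp setT w <= _); first by rewrite -cardsT degF ?inE.
  by rewrite -mulnA leq_mul2l keepF orbT.
have largeB : #|V| <= L * M * #|B|.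
  have -> : #|B| = deg_in (transpose E) setT (t w).
    by rewrite card_imset_perm; apply: eq_card => y; rewrite !inE.
  apply: leq_trans (_ : L * deg_in (transpose comp) setT (t w) <= _); first by rewrite -cardsT degB ?inE.
  by rewrite -mulnA leq_mul2l keepB orbT.
pose W3 := [set x | #|V| <= c * M * deg_in E B x].
pose W2 := t @^-1: [set y | #|V| <= c * M * deg_in (transpose E) A y].
have largeW2 : #|V| <= 2 * L * #|W2|.
  rewrite -(card_imset_perm t) (_ : t @: W2 = [set y | #|V| <= c * M * deg_in (transpose E) A y]).
    exact: many_out_popular.
  apply/setP => y; apply/imsetP/idP => [[x + ->]|yP]; first by rewrite !inE.
  by exists ((t^-1)%g y); rewrite ?inE permKV //; rewrite inE in yP.
have largeW3 : #|V| <= 2 * L * #|t @: W3| by rewrite card_imset_perm many_in_popular.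
have dense23 := popular_rectangle largeW2 largeW3.
apply: leq_trans (leq_mul (leqnn _) (alternating_cycles_ge t w W2 W3)).
rewrite (expnD #|V| 2 2) (expnS _ 2) -mulnA; apply: leq_trans (leq_mul dense23 (leqnn _)) _.
rewrite -mulnA leq_mul2l; apply/orP; right.
rewrite nedgesE big_distrl big_distrr; apply: leq_sum => x2; rewrite !inE => x2W.
rewrite big_imset /=; last by move=> ? ? _ _; apply: perm_inj.
rewrite big_distrl big_distrr; apply: leq_sum => x3; rewrite inE => x3W.
by rewrite /= [leqRHS]mulnCA leq_mul2l -!mulnn mulnACA leq_mul ?orbT.
Qed.

End DenseCycles.

(** * Dominating sets and dense families of tuples in graphs of linear minimum degree *)

Section DenseGraph.
Variables (V : finType) (G : rel V) (L : nat).
Hypotheses (G_sym : symmetric G) (V_gt0 : 0 < #|V|) (L_gt0 : 0 < L).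
Hypothesis min_degree : forall v, #|V| <= L * #|[set w | G v w]|.
Implicit Types (F Y : {set V}) (D K t : nat).

Lemma heavy_nbrs_vertex (w : V -> nat) F : 2 * L * #|F| <= #|V| ->
  exists2 c, c \notin F & \sum_v w v <= 2 * L * \sum_(v | G c v) w v.
Proof.
move=> F_small; have F_lt : #|F| < #|V| by nia.
have compl_gt0 : 0 < #|~: F| by rewrite cardsCs setCK subn_gt0.
have [S [SF S1] heavy] := subset_ge_average (fun c => \sum_(v | G c v) w v) compl_gt0.
have /cards1P[c S_c] : #|S| == 1 by rewrite S1.
exists c; first by have := subsetP SF c; rewrite S_c !inE eqxx => /(_ isT).
rewrite S_c big_set1 mul1n in heavy; rewrite -(leq_pmul2l V_gt0).
have total : #|V| * \sum_v w v <= 2 * L * \sum_(c in ~: F) \sum_(v | G c v) w v.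
  rewrite (exchange_big_dep predT) //= !big_distrr /=; apply: leq_sum => v _.
  rewrite sum_nat_const mulnA leq_mul2r; apply/orP; right.
  have -> : #|[pred c in ~: F | G c v]| = #|[set c | G v c] :\: F|.
    by apply: eq_card => u; rewrite !inE G_sym.
  have lost : #|[set c | G v c]| <= #|[set c | G v c] :\: F| + #|F|.
    by rewrite -(cardsID F) addnC leq_add2l subset_leq_card // subsetIr.
  move: lost (min_degree v) F_small; set a := #|[set c | G v c]|; set b := #|_ :\: _|.
  move: #|F| #|V| => f n lost; have := leq_mul (leqnn L) lost.
  by clearbody a b; clear; lia.
apply: leq_trans total _; rewrite mulnCA leq_mul2l (leq_trans heavy) ?orbT //.
by rewrite leq_mul2r max_card orbT.
Qed.

Definition common_nbrs (s : seq V) : {set V} := [set v | all (fun c => G c v) s].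

Lemma rich_tuple D F : 2 * L * (#|F| + D) <= #|V| ->
  exists s : D.-tuple V, [/\ uniq s, all [predC F] s & #|V| <= (2 * L) ^ D * #|common_nbrs s|].
Proof.
elim: D => [|D IH] F_small.
  exists [tuple]; split; rewrite // expn0 mul1n -cardsT; apply/subset_leq_card/subsetP => v.
  by rewrite !inE.
have [s [us sF rich]] := IH ltac:(nia).
have [|c] := @heavy_nbrs_vertex (fun v => v \in common_nbrs s : nat) (F :|: [set c in s]).
  apply: leq_trans F_small; rewrite leq_mul2l (leq_trans (leq_card_setU _ _)) ?orbT // leq_add2l cardsE.
  by rewrite (leq_trans (card_size _)) ?size_tuple.
rewrite !inE negb_or => /andP[cF cs] heavy.
exists [tuple of c :: s]; split; rewrite /= ?cs ?cF //.
apply: leq_trans rich _; rewrite expnSr -mulnA leq_mul2l; apply/orP; right.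
have -> : #|common_nbrs s| = \sum_v (v \in common_nbrs s).
  by rewrite -sum1_card big_mkcond; apply: eq_bigr => v _; case: (v \in _).
apply: leq_trans heavy _; rewrite leq_mul2l; apply/orP; right.
rewrite /common_nbrs -sum1dep_card /= big_mkcondr.
by apply: leq_sum => v _; rewrite inE; case: (all _ _).
Qed.

Lemma disjoint_rich_tuples D t : 2 * L * (D * t.+1) <= #|V| ->
  exists a : nat -> D.-tuple V,
    (forall i, i < t -> #|V| <= (2 * L) ^ D * #|common_nbrs (a i)|) /\
    (forall i j l l', i < t -> j < t -> tnth (a i) l = tnth (a j) l' -> i = j /\ l = l').
Proof.
case/card_gt0P: V_gt0 => v0 _.
elim: t => [|t IH] V_large; first by exists (fun=> [tuple of nseq D v0]).
have [a [rich disj]] := IH ltac:(nia).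
pose F := [set tnth (a p.1) p.2 | p : 'I_t * 'I_D].
have F_small : #|F| <= D * t.
  by apply: leq_trans (leq_imset_card _ _) _; rewrite card_prod !card_ord mulnC.
have [|s [us sF rich_s]] := @rich_tuple D F; first by nia.
have notF l i l' : i < t -> tnth s l = tnth (a i) l' -> False.
  move=> it; move/allP: sF => /(_ _ (mem_tnth l s)) /= /negP sl_notF sl_eq; apply: sl_notF.
  by rewrite sl_eq; apply/imsetP; exists (Ordinal it, l').
exists (fun i => if i == t then s else a i); split=> [i|i j l l'].
  by rewrite ltnS leq_eqVlt; case: eqP => [|_ /= it]; last exact: rich.
rewrite !ltnS [i <= t]leq_eqVlt [j <= t]leq_eqVlt.
case: (eqVneq i t) => [->|_]; case: (eqVneq j t) => [->|_] //= it jt eq_l.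
- by split=> //; apply: (tuple_uniqP _ us).
- by case: (notF _ _ _ jt eq_l).
- by case: (notF _ _ _ it (esym eq_l)).
exact: disj eq_l.
Qed.

(* The number of vertices with few neighbours in a random [Y] is controlled by this exponential
   moment, which some choice of the next vertex multiplies by at most [1 - 1/(4L)]. *)
Definition potential t Y := \sum_v 2 ^ (t - deg_in G Y v).

Lemma deg_in_setU1 Y c v : c \notin Y -> deg_in G (c |: Y) v = G c v + deg_in G Y v.
Proof. by move=> cY; rewrite !deg_inE big_setU1 //= G_sym. Qed.

Lemma potential_setU1 t Y c : #|Y| < t -> c \notin Y ->
  2 * potential t (c |: Y) + \sum_(v | G c v) 2 ^ (t - deg_in G Y v) = 2 * potential t Y.
Proof.
move=> Yt cY; rewrite /potential (bigID (G c)) /= [in RHS](bigID (G c)) /= !mulnDr addnAC.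
congr (_ + _); last first.
  by congr (_ * _); apply: eq_bigr => v /negbTE Gcv; rewrite deg_in_setU1 // Gcv.
rewrite !big_distrr -big_split /=; apply: eq_bigr => v Gcv; rewrite deg_in_setU1 // Gcv.
have := deg_in_le G Y v; move: (deg_in G Y v) => q qY.
have -> : t - q = (t - (true + q)).+1 by rewrite /=; lia.
by rewrite expnS; lia.
Qed.

Lemma potential_decrease t F Y : #|Y| < t -> 2 * L * (#|F| + #|Y|) <= #|V| ->
  exists c, [/\ c \notin F, c \notin Y & 4 * L * potential t (c |: Y) <= (4 * L - 1) * potential t Y].
Proof.
move=> Yt FY_small.
have [|c] := @heavy_nbrs_vertex (fun v => 2 ^ (t - deg_in G Y v)) (F :|: Y).
  by apply: leq_trans FY_small; rewrite leq_mul2l leq_card_setU orbT.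
rewrite inE negb_or => /andP[cF cY]; rewrite -/(potential t Y) => heavy; exists c; split=> //.
have := congr1 (muln (2 * L)) (potential_setU1 Yt cY); move: heavy.
move: (potential _ _) (potential _ _) (\sum_(v | _) _) => P P' hit; rewrite mulnDr mulnBl mul1n.
by move: (2 * L * hit) => x; clear; lia.
Qed.

Lemma exists_small_potential t F i : i <= t -> 2 * L * (#|F| + t) <= #|V| ->
  exists Y : {set V}, [/\ [disjoint Y & F], #|Y| = i &
    (4 * L) ^ i * potential t Y <= (4 * L - 1) ^ i * (#|V| * 2 ^ t)].
Proof.
move=> + F_small; elim: i => [_|i IH it].
  exists set0; split; rewrite ?cards0 //; first by rewrite -setI_eq0 set0I.
  rewrite !expn0 !mul1n -sum_nat_const; apply: leq_sum => v _.
  by rewrite leq_exp2l // leq_subr.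
have [Y [YF cY pot_Y]] := IH (ltnW it).
have [||c [cF cY' pot_c]] := @potential_decrease t F Y; rewrite ?cY //.
  by apply: leq_trans F_small; rewrite leq_mul2l leq_add2l (ltnW it) orbT.
exists (c |: Y); split; rewrite ?cardsU1 ?cY' ?cY //.
  by rewrite disjoints_subset subUset sub1set inE cF -disjoints_subset.
rewrite !expnSr -mulnA; apply: leq_trans (leq_mul (leqnn _) pot_c) _.
by rewrite mulnCA [_ * (4 * L - 1) * _]mulnAC mulnC leq_mul2r pot_Y orbT.
Qed.

Lemma small_potential_deg_in t Y K v : 4 * (4 * L - 1) ^ K <= (4 * L) ^ K -> #|V| ^ K < 2 ^ t ->
  #|Y| = t -> (4 * L) ^ t * potential t Y <= (4 * L - 1) ^ t * (#|V| * 2 ^ t) ->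
  t <= K * deg_in G Y v.
Proof.
move=> K_large V_small cY small_pot; rewrite leqNgt; apply/negP; set q := deg_in G Y v => q_small.
have qt : q <= t by rewrite -cY deg_in_le.
have pot_v : (4 * L) ^ t <= (4 * L - 1) ^ t * (#|V| * 2 ^ q).
  have pow_gt0 : 0 < 2 ^ (t - q) by rewrite expn_gt0.
  rewrite -(leq_pmul2r pow_gt0) -!mulnA -expnD subnKC //; apply: leq_trans small_pot.
  by rewrite leq_mul2l /potential (bigD1 v) //= leq_addr orbT.
have exp_mono a b j : a <= b -> a ^ j <= b ^ j by case: j => // j ab; rewrite leq_exp2r.
have pow_gt0 : 0 < (4 * L - 1) ^ (t * K) by rewrite expn_gt0; apply/orP; left; lia.
have pow4_le : 4 ^ t <= #|V| ^ K * 2 ^ (q * K).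
  rewrite -(leq_pmul2r pow_gt0) [t * K]mulnC; apply: (@leq_trans ((4 * L) ^ (K * t))).
    by rewrite !expnM -expnMn exp_mono.
  have := exp_mono _ _ K pot_v; rewrite !expnMn -!expnM [t * K]mulnC.
  by rewrite [(4 * L - 1) ^ _ * _]mulnC.
have pow_q : 2 ^ (q * K) <= 2 ^ t by rewrite leq_exp2l // mulnC ltnW.
have : 4 ^ t < 2 ^ t * 2 ^ t.
  apply: leq_ltn_trans (leq_trans pow4_le (leq_mul (leqnn _) pow_q)) _.
  by rewrite ltn_pmul2r ?expn_gt0.
by rewrite -expnMn ltnn.
Qed.

Lemma dominating_set F t K : 2 * L * (#|F| + t) <= #|V| ->
  4 * (4 * L - 1) ^ K <= (4 * L) ^ K -> #|V| ^ K < 2 ^ t ->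
  exists Y : {set V}, [/\ [disjoint Y & F], #|Y| = t & forall v, t <= K * deg_in G Y v].
Proof.
move=> F_small K_large V_small.
have [Y [YF cY small_pot]] := exists_small_potential (leqnn t) F_small.
by exists Y; split=> // v; apply: small_potential_deg_in small_pot.
Qed.

Definition tuple_ratio D := 2 * (2 * L) ^ D.

Definition tuple_family_ratio D c :=
  4 * c.+1 * regular_pair_ratio (256 * tuple_ratio D) (tuple_ratio D).

Definition joint_adj D (I : Type) (a : I -> 'I_D -> V) : I -> V -> bool :=
  fun i w => [forall l, G (a i l) w].

Lemma tuple_ratio_gt0 D : 0 < tuple_ratio D.
Proof. by rewrite /tuple_ratio muln_gt0 expn_gt0 muln_gt0 L_gt0. Qed.

Lemma dense_tuple_rectangle D c : 0 < D -> 4 * L * D <= c -> tuple_ratio D * D <= c ->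
  let t := #|V| %/ c in 0 < t ->
  exists (a : 'I_t -> 'I_D -> V) (B : {set V}),
    [/\ injective (fun p : 'I_t * 'I_D => a p.1 p.2), #|B| = t, (forall i l, a i l \notin B) &
        t ^ 2 <= tuple_ratio D * nedges (joint_adj a) setT B].
Proof.
move=> D0 c_deg c_tuple t t0; have V_ge : c * t <= #|V| by rewrite mulnC leq_divM.
have [a0 [rich disj]] := @disjoint_rich_tuples D t ltac:(nia).
pose a (i : 'I_t) l := tnth (a0 i) l.
have a_inj : injective (fun p : 'I_t * 'I_D => a p.1 p.2).
  by move=> [i l] [j l'] /= /disj[] // /val_inj -> ->.
pose A := [set a p.1 p.2 | p : 'I_t * 'I_D].
have cA : #|A| = t * D by rewrite card_imset // card_prod !card_ord.
have rich_row i : #|V| <= tuple_ratio D * deg_in (joint_adj a) (~: A) i.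
  have := deg_in_setD (joint_adj a) setT (~: A) i; rewrite setDE setTI setCK cA.
  have -> : deg_in (joint_adj a) setT i = #|common_nbrs (a0 i)|.
    by apply: eq_card => w; rewrite !inE; apply/forallP/all_tnthP.
  have rich_i : 2 * #|V| <= tuple_ratio D * #|common_nbrs (a0 i)|.
    by rewrite /tuple_ratio -mulnA leq_mul2l rich.
  move/(leq_mul (leqnn (tuple_ratio D))); have := leq_mul (leqnn t) c_tuple.
  move: V_ge rich_i; move: (deg_in _ _ _) #|common_nbrs _| (tuple_ratio D) #|V|; clear; lia.
have B_room : t <= #|~: A|.
  move: (cardsC A) V_ge (leq_mul (leqnn t) c_deg) (leq_pmulr (t * D) L_gt0) (leq_pmulr t D0).
  by rewrite cA; move: #|~: A| #|V|; clear; lia.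
have [B [BA cB] avg] := subset_ge_average (deg_in (transpose (joint_adj a)) setT) B_room.
exists a, B; split=> // [i l|].
  by apply/negP => /(subsetP BA); rewrite inE; apply/negP/negPn/imsetP; exists (i, l).
have total : t * #|V| <= tuple_ratio D * nedges (joint_adj a) setT (~: A).
  rewrite /nedges big_distrr /= -[X in X * _](card_ord t) -cardsT -sum_nat_const.
  by apply: leq_sum => i _; apply: rich_row.
have {}avg : t * nedges (joint_adj a) setT (~: A) <= #|V| * nedges (joint_adj a) setT B.
  by rewrite !(nedgesC (joint_adj a)); apply: leq_trans avg _; rewrite leq_mul2r max_card orbT.
rewrite -(leq_pmul2l V_gt0) -mulnn; move: (leq_mul (leqnn t) total) (leq_mul (leqnn (tuple_ratio D)) avg).
by move: (nedges _ _ _) (nedges _ _ _) (tuple_ratio D); clear; lia.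
Qed.

Lemma superdense_tuple_family D c : 0 < D -> tuple_family_ratio D c <= #|V| ->
  4 * L * D <= c -> tuple_ratio D * D <= c ->
  exists N k (a : 'I_N -> 'I_D -> V) (B : {set V}),
    [/\ injective (fun p : 'I_N * 'I_D => a p.1 p.2), #|B| = N & forall i l, a i l \notin B] /\
    [/\ #|V| <= tuple_family_ratio D c * N, c * N <= #|V|, 128 * tuple_ratio D * k <= N &
        superdense (8 * tuple_ratio D) k (joint_adj a) setT B].
Proof.
move=> D0 V_large c_deg c_tuple; have P0 := tuple_ratio_gt0 D.
move: V_large; rewrite /tuple_family_ratio.
set P := tuple_ratio D in P0 *; set ratio := regular_pair_ratio _ _ => V_large.
have c0 : 0 < c by nia.
have ratio_gt0 : 0 < ratio by rewrite expn_gt0; apply/orP; left; clear -P0; lia.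
pose t := #|V| %/ c.
have V_ge : c * t <= #|V| by rewrite mulnC leq_divM.
have V_lt : #|V| < c * t.+1 by rewrite mulnC ltn_ceil.
have ratio_t : ratio <= t by rewrite leq_divRL //; apply: leq_trans V_large; nia.
have t0 : 0 < t := leq_trans ratio_gt0 ratio_t.
have [a [B [a_inj cB aB dense]]] := dense_tuple_rectangle D0 c_deg c_tuple t0.
have cT : #|[set: 'I_t]| = t by rewrite cardsT card_ord.
have L1 : 1 < 256 * P by lia.
have [N [A1 [B1 [tN LN _ B1B [cA1 cB1 reg dense1]]]]] := lower_regular_pair L1 ratio_t cT cB dense.
rewrite -/ratio -/t in tN; set k := N %/ (256 * P).
have k0 : 0 < k by rewrite divn_gt0 // (ltnW L1).
have kN : 256 * P * k <= N by rewrite mulnC leq_divM.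
have bid := lower_regular_bidense (introT andP (conj (ltnW L1) LN)) reg dense1.
have [||A2 [B2 [A21 B21 cA2 cB2 sup]]] := bidense_superdense _ k0 _ cA1 cB1 bid.
- by rewrite muln_gt0.
- by apply: leq_trans kN; rewrite !mulnA leq_mul2r leq_mul2r !orbT.
have cN : #|A2| = N - k by [].
have kP : k <= P * k by rewrite leq_pmull.
exists #|A2|, k, (fun i => a (enum_val i)), B2; split; split.
- by move=> [i l] [j l'] /= /(a_inj (enum_val i, l) (enum_val j, l'))[/enum_val_inj-> ->].
- by rewrite cB2 cA2.
- by move=> i l; apply: contra (aB (enum_val i) l) => /(subsetP B21)/(subsetP B1B).
- have half : N <= 2 * #|A2| by rewrite cN; lia.
  have := leq_mul (leqnn (c * 2)) (leq_trans tN (leq_mul (leqnn ratio) half)).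
  by move: V_lt; rewrite mulnS; nia.
- by apply: leq_trans V_ge; rewrite leq_mul2l -[X in _ <= X]cT subset_leq_card ?subsetT ?orbT.
- by rewrite cN; lia.
rewrite mulnA in sup; apply: (@superdense_imset _ _ _ _ (joint_adj a) enum_val id) => //.
  exact: enum_val_inj.
rewrite imset_id (_ : enum_val @: _ = A2) //; apply/setP => i; apply/imsetP/idP => [[j _ ->]|iA].
  exact: enum_valP.
by exists (enum_rank_in iA i); rewrite ?enum_rankK_in.
Qed.

End DenseGraph.

(** * Rooted forests *)

Lemma card_bigcup_le (I V : finType) (P : pred I) (F : I -> {set V}) :
  #|\bigcup_(i | P i) F i| <= \sum_(i | P i) #|F i|.
Proof.
elim/big_rec2: _ => [|i x y _ h]; first by rewrite cards0.
by apply: leq_trans (leq_card_setU _ _) _; rewrite leq_add2l.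
Qed.

Lemma card_bigcup_le_const (I V : finType) (A : {set I}) (F : I -> {set V}) c :
  (forall i, i \in A -> #|F i| <= c) -> #|\bigcup_(i in A) F i| <= #|A| * c.
Proof.
move=> Fc; apply: leq_trans (card_bigcup_le _ _) _; rewrite -sum_nat_const.
exact: leq_sum.
Qed.

Section ForestEdges.
Variables (U : finType) (par : U -> U) (dep : U -> nat).

Definition is_child v := dep v == (dep (par v)).+1.

Definition forest_edge : rel U := fun u v =>
  (is_child v && (par v == u)) || (is_child u && (par u == v)).

Lemma forest_edge_sym : symmetric forest_edge.
Proof. by move=> u v; rewrite /forest_edge orbC. Qed.

Lemma forest_edgeP u v : forest_edge u v ->
  (dep v = (dep u).+1 /\ par v = u) \/ (dep u = (dep v).+1 /\ par u = v).
Proof. by case/orP=> /andP[/eqP dep_eq /eqP par_eq]; [left|right]; rewrite -par_eq. Qed.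

Lemma forest_edge_irr u : forest_edge u u = false.
Proof. by apply/negP => /forest_edgeP[] []; lia. Qed.

Lemma forest_edge_triangle q u v :
  forest_edge q u -> forest_edge u v -> forest_edge q v -> False.
Proof. by move=> /forest_edgeP[] [? ?] /forest_edgeP[] [? ?] /forest_edgeP[] [? ?]; lia. Qed.

Lemma forest_edge_square q v w1 w2 : q != v ->
  forest_edge q w1 -> forest_edge w1 v -> forest_edge q w2 -> forest_edge w2 v -> w1 = w2.
Proof.
move=> /eqP qv /forest_edgeP qw1 /forest_edgeP w1v /forest_edgeP qw2 /forest_edgeP w2v.
case: qw1 w1v qw2 w2v => [] [? ?] [] [? ?] [] [? ?] [] [? ?]; first [lia | congruence].
Qed.

Definition within2 u v :=
  [|| u == v, forest_edge u v | [exists w, forest_edge u w && forest_edge w v]].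

Lemma within2_refl u : within2 u u.
Proof. by rewrite /within2 eqxx. Qed.

Lemma within2_edge u v : forest_edge u v -> within2 u v.
Proof. by rewrite /within2 => ->; rewrite orbT. Qed.

Lemma within2_path u w v : forest_edge u w -> forest_edge w v -> within2 u v.
Proof. by move=> uw wv; apply/or3P/Or33/existsP; exists w; rewrite uw. Qed.

Lemma within2_sym u v : within2 u v = within2 v u.
Proof.
rewrite /within2 eq_sym (forest_edge_sym u); congr [|| _, _ | _].
by apply: eq_existsb => w; rewrite andbC (forest_edge_sym v) (forest_edge_sym u).
Qed.

Definition scattered (cuts S : {set U}) :=
  (forall q v, q \in S -> within2 q v -> v \notin cuts) /\
  (forall q q' v, q \in S -> q' \in S -> within2 q v -> within2 q' v -> q = q').

Lemma scatteredW (cuts S S' : {set U}) : S' \subset S -> scattered cuts S -> scattered cuts S'.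
Proof.
move=> /subsetP S'S [avoid sep]; split=> [q v /S'S|q q' v /S'S qS /S'S]; first exact: avoid.
exact: sep.
Qed.

Lemma scattered_eq (cuts S : {set U}) q q' v : scattered cuts S ->
  q \in S -> q' \in S -> within2 q v -> within2 q' v -> q = q'.
Proof. by case=> _; apply. Qed.

Lemma scattered_notin_cuts (cuts S : {set U}) q v : scattered cuts S ->
  q \in S -> within2 q v -> v \notin cuts.
Proof. by case=> + _; apply. Qed.

Definition forest_nbrs (S : {set U}) := [set v | [exists q in S, forest_edge q v]].

Lemma forest_nbrsP (S : {set U}) v :
  reflect (exists2 q, q \in S & forest_edge q v) (v \in forest_nbrs S).
Proof. by rewrite inE; apply: exists_inP. Qed.

Lemma scattered_nbr_notin (cuts S S' : {set U}) v : scattered cuts S -> S' \subset S ->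
  v \in forest_nbrs S' -> v \notin S.
Proof.
move=> scat /subsetP S'S /forest_nbrsP[q /S'S qS qv]; apply/negP => vS.
have qv_eq := scattered_eq scat qS vS (within2_edge qv) (within2_refl v).
by rewrite qv_eq forest_edge_irr in qv.
Qed.

Variable d : nat.
Hypothesis deg_le : forall u, #|[set v | forest_edge u v]| <= d.

Lemma card_forest_nbrs (S : {set U}) : #|forest_nbrs S| <= d * #|S|.
Proof.
have -> : forest_nbrs S = \bigcup_(q in S) [set v | forest_edge q v].
  by apply/setP => v; apply/forest_nbrsP/bigcupP => -[q qS]; rewrite ?inE => qv; exists q; rewrite ?inE.
by rewrite mulnC; apply: card_bigcup_le_const => q _.
Qed.

Lemma card_children u : #|[set v | is_child v && (par v == u)]| <= d.
Proof.
apply: leq_trans (deg_le u); apply/subset_leq_card/subsetP => v; rewrite !inE => child.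
by apply/orP; left.
Qed.

Lemma card_within2 u : #|[set v | within2 u v]| <= (d + 1) ^ 2.
Proof.
have cover : [set v | within2 u v] \subset
    [set u] :|: \bigcup_(w in [set v | forest_edge u v]) ([set w] :|: [set v | forest_edge w v]).
  apply/subsetP => v; rewrite in_setU !inE /within2 eq_sym => /or3P[->//|uv|/existsP[w /andP[uw wv]]].
    by apply/orP; right; apply/bigcupP; exists v; rewrite !inE ?eqxx.
  by apply/orP; right; apply/bigcupP; exists w; rewrite !inE ?wv ?orbT.
apply: leq_trans (subset_leq_card cover) _; apply: leq_trans (leq_card_setU _ _) _.
have : #|\bigcup_(w in [set v | forest_edge u v]) ([set w] :|: [set v | forest_edge w v])|
    <= d * (d + 1).
  apply: leq_trans (card_bigcup_le_const (c := d + 1) _) _; last by rewrite leq_mul2r deg_le orbT.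
  by move=> w _; rewrite addnC (leq_trans (leq_card_setU _ _)) // cards1 leq_add2l.
by rewrite cards1 -mulnn; move: #|_|; clear; lia.
Qed.

(* Any vertex within distance 4 of no vertex of a maximal scattered set [S] is close to a cut. *)
Lemma many_scattered (cuts X : {set U}) : exists2 S : {set U}, S \subset X /\ scattered cuts S &
  #|X| <= (d + 1) ^ 2 * #|cuts| + (d + 1) ^ 4 * #|S|.
Proof.
pose ball u := [set v | within2 u v].
pose ok (S : {set U}) := [&& S \subset X, [forall q in S, [disjoint ball q & cuts]] &
  [forall q in S, forall q' in S, (q != q') ==> [disjoint ball q & ball q']]].
have ok0 : ok set0.
  by rewrite /ok sub0set /=; apply/andP; split; apply/forall_inP => q; rewrite inE.
case: (arg_maxnP (fun S : {set U} => #|S|) ok0) => S okS maxS.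
case/and3P: (okS) => SX /forall_inP avoid /forall_inP sep.
exists S; first split=> //.
  split=> [q v qS qv|q q' v qS q'S qv q'v].
    by apply/negP => vC; move: (disjointFl (avoid q qS) vC); rewrite inE qv.
  apply/eqP/negPn/negP => neq; move/(_ q qS)/forall_inP/(_ q' q'S): sep; rewrite neq /= => disj.
  by have := disjointFr disj (x := v); rewrite !inE qv q'v => /(_ isT).
have cover : X \subset (\bigcup_(v in cuts) ball v) :|: \bigcup_(q in S) \bigcup_(v in ball q) ball v.
  apply/subsetP => u uX; rewrite inE.
  case: (boolP [disjoint ball u & cuts]) => [u_avoid|]; last first.
    rewrite -setI_eq0 => /set0Pn[v]; rewrite !inE => /andP[uv vC].
    by apply/orP; left; apply/bigcupP; exists v; rewrite // inE within2_sym.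
  apply/orP; right; apply/negPn/negP => u_far.
  have u_sep q : q \in S -> [disjoint ball u & ball q].
    move=> qS; rewrite -setI_eq0; apply/negPn/negP => /set0Pn[v]; rewrite !inE => /andP[uv qv].
    case/negP: u_far; apply/bigcupP; exists q => //; apply/bigcupP; exists v; rewrite inE //.
    by rewrite within2_sym.
  have uS : u \notin S.
    by apply/negP => /u_sep; rewrite -setI_eq0 setIid => /eqP/setP/(_ u); rewrite !inE within2_refl.
  have /maxS : ok (u |: S).
    rewrite /ok subUset sub1set uX SX /=; apply/andP; split.
      by apply/forall_inP => q /setU1P[->|/avoid].
    apply/forall_inP => q /setU1P[->|qS]; apply/forall_inP => q' /setU1P[->|q'S].
    - by rewrite eqxx.
    - by rewrite u_sep ?implybT.
    - by rewrite disjoint_sym u_sep ?implybT.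
    by move/(_ q qS)/forall_inP: sep; apply.
  by rewrite cardsU1 uS; lia.
apply: leq_trans (subset_leq_card cover) _; apply: leq_trans (leq_card_setU _ _) _.
apply: leq_add; rewrite mulnC; apply: card_bigcup_le_const => q _; first exact: card_within2.
rewrite (expnD _ 2 2); apply: leq_trans (card_bigcup_le_const (c := (d + 1) ^ 2) _) _.
  by move=> v _; apply: card_within2.
by rewrite leq_mul2r card_within2 orbT.
Qed.

End ForestEdges.

Section RootedTree.
Variables (U : finType) (T : {set {set U}}) (root : U).
Hypothesis tree : is_tree T.

Lemma adj_sym (V : finType) (E : {set {set V}}) : symmetric (adj E).
Proof. by move=> x y; rewrite /adj setUC. Qed.

Lemma adj_irr (V : finType) (E : {set {set V}}) x : is_graph E -> adj E x x = false.
Proof. by move=> /subsetP gE; apply/negP => /gE; rewrite inE setUid cards1. Qed.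

Definition reachable k u := [exists p : k.-tuple U, path (adj T) root p && (last root p == u)].

Lemma ex_reachable u : exists k, reachable k u.
Proof.
case: tree => _ _ /(_ root u)/connectP[p pp ->] _.
by exists (size p); apply/existsP; exists (in_tuple p); rewrite pp eqxx.
Qed.

Definition depth u := ex_minn (ex_reachable u).

Lemma depth_min u k : reachable k u -> depth u <= k.
Proof. by rewrite /depth; case: ex_minnP => m _; apply. Qed.

Lemma depth_root : depth root = 0.
Proof. by apply/eqP; rewrite -leqn0; apply: depth_min; apply/existsP; exists [tuple]; rewrite /= eqxx. Qed.

Lemma ex_parent u : u != root -> exists v, adj T v u && (depth u == (depth v).+1).
Proof.
move=> u_neq; have : reachable (depth u) u by rewrite /depth; case: ex_minnP.
have depth_adj v : adj T v u -> depth u <= (depth v).+1.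
  move=> vu; apply: depth_min; have : reachable (depth v) v by rewrite /depth; case: ex_minnP.
  case/existsP=> p /andP[pp /eqP lp]; apply/existsP.
  by exists [tuple of rcons p u]; rewrite /= rcons_path pp lp vu last_rcons eqxx.
case/existsP=> -[p /eqP sz] /= /andP[pp /eqP lp].
case/lastP: p sz pp lp => [|p v] sz; first by move=> _ /= root_u; rewrite root_u eqxx in u_neq.
rewrite rcons_path last_rcons => /andP[pp av] v_u; rewrite {v}v_u in av sz *.
exists (last root p); rewrite av eqn_leq depth_adj //= -sz size_rcons ltnS.
by apply: depth_min; apply/existsP; exists (in_tuple p); rewrite pp eqxx.
Qed.

Definition parent u := odflt u [pick v | adj T v u && (depth u == (depth v).+1)].

Lemma parentP u : u != root -> adj T (parent u) u /\ is_child parent depth u.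
Proof.
move=> u_neq; rewrite /is_child /parent; case: pickP => [v /andP[]|/=] //.
by have [v vP] := ex_parent u_neq; move/(_ v); rewrite vP.
Qed.

Lemma depth_eq0 u : (depth u == 0) = (u == root).
Proof.
apply/eqP/eqP => [depth0|->]; last exact: depth_root.
by apply: contraPeq depth0 => /parentP[_ /eqP->].
Qed.

Lemma is_child_parent u : is_child parent depth u = (u != root).
Proof.
apply/idP/idP => [|/parentP[]//]; apply: contraTneq => ->.
by rewrite /is_child depth_root.
Qed.

Lemma forest_edge_adj u v : forest_edge parent depth u v -> adj T u v.
Proof.
rewrite /forest_edge !is_child_parent => /orP[] /andP[/parentP[par_adj _] /eqP <-] //.
by rewrite adj_sym.
Qed.

Lemma connect_forest_edge u v : connect (forest_edge parent depth) u v.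
Proof.
have to_root w : connect (forest_edge parent depth) w root.
  have [n] := ubnP (depth w); elim: n w => // n IH w; rewrite ltnS => wn.
  have [->|w_neq] := eqVneq w root; first exact: connect0.
  have [_ child] := parentP w_neq; apply: (@connect_trans _ _ (parent w)).
    by apply: connect1; rewrite /forest_edge child eqxx orbT.
  by apply: IH; rewrite (eqP child) in wn.
apply: connect_trans (to_root u) _; rewrite (sym_connect_sym (forest_edge_sym _ _)).
exact: to_root.
Qed.

(* A further edge would close a cycle with the path between its ends in the spanning tree. *)
Lemma adj_forest_edge u v : adj T u v -> forest_edge parent depth u v.
Proof.
case: tree => gT _ _ no_cycle uv; apply: contraT => not_edge.
have /connectP[p0 p0_path] := connect_forest_edge u v.
case/shortenP: p0_path => p p_path p_uniq _ last_p.
have := no_cycle (u :: p); case=> //.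
  case: p p_path p_uniq last_p => [_ _ vu|w [|//] /= uw _ vw].
    by rewrite vu adj_irr in uv.
  by case/negP: not_edge; move: uw; rewrite andbT vw.
rewrite /ucycle p_uniq andbT /= rcons_path -last_p adj_sym uv andbT.
exact: sub_path forest_edge_adj _ _ p_path.
Qed.

End RootedTree.

Lemma rooted_tree (U : finType) (T : {set {set U}}) : is_tree T ->
  exists (par : U -> U) (dep : U -> nat),
  [/\ forall u, 0 < dep u -> is_child par dep u, forall u v, forest_edge par dep u v = adj T u v &
      #|[set u | dep u == 0]| = 1].
Proof.
move=> tree; have [root _] : exists root : U, root \in U by case: tree => _ /card_gt0P[r ?] _ _; exists r.
exists (parent root tree), (depth root tree); split.
- by move=> u; rewrite lt0n depth_eq0 is_child_parent.
- by move=> u v; apply/idP/idP; [apply: forest_edge_adj | apply: adj_forest_edge].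
by rewrite -(cards1 root); apply: eq_card => u; rewrite !inE depth_eq0.
Qed.

Lemma card_tree_edges (U : finType) (T : {set {set U}}) : is_tree T -> #|T| < #|U|.
Proof.
move=> tree; have [par [dep [_ edgeE roots1]]] := rooted_tree tree.
have cover : T \subset [set [set par v; v] | v in ~: [set u | dep u == 0]].
  case: (tree) => /subsetP gT _ _ _; apply/subsetP => e eT.
  move/gT: (eT); rewrite inE => /cards2P[u [v [_ e_uv]]].
  have : forest_edge par dep u v by rewrite edgeE /adj -e_uv.
  case/forest_edgeP=> -[dep_eq par_eq]; apply/imsetP; [exists v | exists u].
  - by rewrite !inE dep_eq.
  - by rewrite e_uv par_eq.
  - by rewrite !inE dep_eq.
  by rewrite e_uv par_eq setUC.
apply: leq_ltn_trans (subset_leq_card cover) _; apply: leq_ltn_trans (leq_imset_card _ _) _.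
by rewrite cardsCs setCK roots1 subn1 ltn_predL; case: tree.
Qed.

(** * Cutting a tree into small pieces *)

Definition early (U : finType) (pos : U -> nat) i := [set u | pos u < i].
Definition late (U : finType) (pos : U -> nat) i := [set u | i <= pos u].

(* [pos] numbers the pieces; every piece hangs from its cut vertex on an earlier piece. *)
Record pieces (U : finType) (par : U -> U) (dep : U -> nat) (cuts : {set U}) (pos : U -> nat)
    (b : nat) : Prop := Pieces {
  pos_par : forall v, is_child par dep v -> v \notin cuts -> pos (par v) = pos v;
  pos_cut : forall v, is_child par dep v -> v \in cuts -> pos (par v) < pos v;
  card_piece : forall i, #|[set u | pos u == i]| <= b }.

Section Cutting.
Variables (U : finType) (par : U -> U) (dep : U -> nat) (d h : nat).
Hypotheses (d_gt0 : 0 < d) (h_gt0 : 0 < h).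
Hypothesis dep_child : forall u, 0 < dep u -> is_child par dep u.
Hypothesis few_children : forall u, #|[set v | is_child par dep v && (par v == u)]| <= d.

Lemma dep_iter i u : i <= dep u -> dep (iter i par u) = dep u - i.
Proof.
elim: i => [|i IH] iu; first by rewrite subn0.
have dep_i := IH (ltnW iu); have /dep_child/eqP : 0 < dep (iter i par u) by rewrite dep_i subn_gt0.
by rewrite -iterS dep_i; lia.
Qed.

Lemma card_descendants j x : #|[set u | (j <= dep u) && (iter j par u == x)]| <= d ^ j.
Proof.
elim: j x => [|j IH] x.
  by rewrite expn0 -(cards1 x); apply/subset_leq_card/subsetP => u; rewrite !inE.
pose children := [set v | is_child par dep v && (par v == x)].
have cover : [set u | (j < dep u) && (iter j.+1 par u == x)] \subset
    \bigcup_(v in children) [set u | (j <= dep u) && (iter j par u == v)].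
  apply/subsetP => u; rewrite inE => /andP[ju iter_x]; apply/bigcupP.
  exists (iter j par u); rewrite inE ?eqxx ?(ltnW ju) //.
  by rewrite iter_x andbT dep_child // dep_iter ?subn_gt0 // ltnW.
apply: leq_trans (subset_leq_card cover) _.
apply: leq_trans (card_bigcup_le_const (c := d ^ j) _) _; first by [].
by rewrite expnS leq_mul2r few_children orbT.
Qed.

Section Residue.
Variable r : nat.

Definition piece_depth u := minn (dep u) ((dep u + r) %% h).
Definition cuts : {set U} := [set u | piece_depth u == 0].
Definition piece_root u := iter (piece_depth u) par u.

Lemma piece_depth_le u : piece_depth u <= dep u.
Proof. exact: geq_minl. Qed.

Lemma piece_depth_lt u : piece_depth u < h.
Proof. by apply: leq_ltn_trans (geq_minr _ _) _; rewrite ltn_pmod. Qed.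

Lemma piece_depth_par u : u \notin cuts -> piece_depth u = (piece_depth (par u)).+1.
Proof.
rewrite inE -lt0n => depth_gt0.
have /dep_child/eqP dep_u := leq_trans depth_gt0 (piece_depth_le u).
move: depth_gt0; rewrite /piece_depth dep_u addSn modnS.
by case: ifP => _; rewrite ?minn0 // minnSS.
Qed.

Lemma piece_root_par u : u \notin cuts -> piece_root u = piece_root (par u).
Proof. by move=> uC; rewrite /piece_root (piece_depth_par uC) iterSr. Qed.

Lemma piece_root_id u : u \in cuts -> piece_root u = u.
Proof. by rewrite inE /piece_root => /eqP->. Qed.

Lemma piece_root_cut u : piece_root u \in cuts.
Proof.
have [n] := ubnP (piece_depth u); elim: n u => // n IH u.
have [uC _|uC] := boolP (u \in cuts); first by rewrite piece_root_id.
by rewrite (piece_depth_par uC) (piece_root_par uC) ltnS; apply: IH.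
Qed.

Lemma dep_piece_root u : dep (piece_root u) = dep u - piece_depth u.
Proof. exact: dep_iter (piece_depth_le u). Qed.

Definition cut_order : seq U := sort (fun u v => dep u <= dep v) (enum cuts).

Definition piece_pos u := index (piece_root u) cut_order.

Lemma mem_cut_order u : (u \in cut_order) = (u \in cuts).
Proof. by rewrite mem_sort mem_enum. Qed.

Lemma piece_pos_cut v : is_child par dep v -> v \in cuts -> piece_pos (par v) < piece_pos v.
Proof.
move=> /eqP dep_v vC; rewrite /piece_pos [piece_root v]piece_root_id // ltnNge; apply/negP.
have sorted_order : sorted (fun u v => dep u <= dep v) cut_order.
  by apply: sort_sorted => u w; apply: leq_total.
have dep_trans : transitive (fun u w => dep u <= dep w) by move=> u v1 w; apply: leq_trans.
move/(sorted_leq_index dep_trans (fun u => leqnn _) sorted_order _ _ _ _).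
by rewrite !mem_cut_order => /(_ vC (piece_root_cut _)); rewrite dep_piece_root dep_v; lia.
Qed.

Lemma card_piece_pos i : #|[set u | piece_pos u == i]| <= h * d ^ h.
Proof.
have [i_small|i_large] := ltnP i (size cut_order); last first.
  rewrite (_ : [set u | _] = set0) ?cards0 //; apply/setP => u; rewrite !inE.
  by apply: contraTF i_large => /eqP <-; rewrite -ltnNge index_mem mem_cut_order piece_root_cut.
have /card_gt0P[u0 _] : 0 < #|cuts|.
  by move: (leq_ltn_trans (leq0n i) i_small); rewrite size_sort -cardE.
have cover : [set u | piece_pos u == i] \subset
    \bigcup_(j in [set: 'I_h]) [set u | (j <= dep u) && (iter j par u == nth u0 cut_order i)].
  apply/subsetP => u; rewrite inE => /eqP <-; apply/bigcupP.
  exists (Ordinal (piece_depth_lt u)); rewrite // inE piece_depth_le /=.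
  by rewrite nth_index // mem_cut_order piece_root_cut.
apply: leq_trans (subset_leq_card cover) _.
apply: leq_trans (card_bigcup_le_const (c := d ^ h) _) _; last by rewrite cardsT card_ord.
move=> j _; apply: leq_trans (card_descendants _ _) _.
by case: (d) d_gt0 => // -[|d'] _; rewrite ?exp1n // leq_exp2l // ltnW.
Qed.

Lemma residue_pieces : pieces par dep cuts piece_pos (h * d ^ h).
Proof.
split; [|exact: piece_pos_cut|exact: card_piece_pos].
by move=> v _ vC; rewrite /piece_pos -piece_root_par.
Qed.

End Residue.

Lemma exists_few_cuts : exists r, #|cuts r| * h <= #|U| + #|[set u | dep u == 0]| * h.
Proof.
pose residue r := [set u | (dep u + r) %% h == 0].
have h_ord : 0 < #|[set: 'I_h]| by rewrite cardsT card_ord.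
have [S [_ /eqP/cards1P[r S_r]] avg] := subset_le_average (fun r : 'I_h => #|residue r|) h_ord.
exists r; rewrite S_r big_set1 cardsT card_ord mul1n in avg.
have total : \sum_(r in [set: 'I_h]) #|residue r| <= #|U|.
  under eq_bigr => q _ do rewrite -sum1dep_card big_mkcond.
  rewrite exchange_big /= -sum1_card; apply: leq_sum => u _.
  rewrite -big_mkcondr /= sum1_card; apply/card_le1_eqP => q q' /andP[_ /eqP q0] /andP[_ /eqP q0'].
  apply: val_inj; apply/eqP => /=.
  by rewrite -(modn_small (ltn_ord q)) -(modn_small (ltn_ord q')) -(eqn_modDl (dep u)) q0 q0'.
have cover : cuts r \subset [set u | dep u == 0] :|: residue r.
  by apply/subsetP => u; rewrite !inE /piece_depth -!leqn0 geq_min.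
rewrite addnC [_ * h]mulnC; apply: leq_trans (leq_mul (leqnn h) (subset_leq_card cover)) _.
apply: leq_trans (leq_mul (leqnn h) (leq_card_setU _ _)) _.
by rewrite mulnDr [h * _]mulnC leq_add2l (leq_trans avg).
Qed.

End Cutting.

Lemma card_early_late (U : finType) (pos : U -> nat) i : #|early pos i| + #|late pos i| = #|U|.
Proof.
by rewrite -(cardsC (early pos i)); congr (_ + #|pred_of_set _|); apply/setP => u; rewrite !inE -leqNgt.
Qed.

Lemma early_threshold (U : finType) (pos : U -> nat) b x :
  (forall i, #|[set u | pos u == i]| <= b) -> x <= #|U| ->
  exists i, x <= #|early pos i| <= x + b.
Proof.
move=> small_fibres xU.
have ex : exists i, x <= #|early pos i|.
  exists (\max_u pos u).+1; apply: leq_trans xU _; rewrite -cardsT; apply/subset_leq_card/subsetP => u _.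
  by rewrite inE ltnS leq_bigmax.
exists (ex_minn ex); case: ex_minnP => -[|i] x_le minimal; rewrite x_le /=.
  by rewrite /early (eq_card0 (A := mem [set u | pos u < 0])) // => u; rewrite !inE ltn0.
have lt_x : #|early pos i| < x by rewrite ltnNge; apply/negP => /minimal; rewrite ltnn.
have : #|early pos i.+1| <= #|early pos i| + #|[set u | pos u == i]|.
  apply: leq_trans (leq_card_setU _ _); apply/subset_leq_card/subsetP => u.
  by rewrite !inE ltnS leq_eqVlt orbC.
by have := small_fibres i; lia.
Qed.

Lemma popular_value (U : finType) (S : {set U}) (f : U -> nat) d :
  (forall u, u \in S -> 0 < f u <= d) -> 0 < #|S| ->
  exists2 D, 0 < D <= d & #|S| <= d * #|[set u in S | f u == D]|.
Proof.
move=> f_range S_gt0; case/card_gt0P: (S_gt0) => u0 /f_range/andP[fu0 u0d].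
have d_gt0 : 0 < #|[set: 'I_d]| by rewrite cardsT card_ord (leq_trans fu0).
pose level (D : 'I_d) := [set u in S | f u == D.+1].
have [B [_ /eqP/cards1P[D B_D]] avg] := subset_ge_average (fun D => #|level D|) d_gt0.
exists D.+1; first exact: ltn_ord.
rewrite B_D big_set1 cardsT card_ord mul1n in avg; apply: leq_trans avg.
apply: leq_trans (card_bigcup_le _ level); apply/subset_leq_card/subsetP => u uS.
have /andP[fu_gt0 fu_le] := f_range u uS; have fu_lt : (f u).-1 < d by rewrite prednK.
by apply/bigcupP; exists (Ordinal fu_lt) => //; rewrite inE uS /= prednK.
Qed.

Lemma tree_selection (U : finType) (T : {set {set U}}) (d h x y : nat) :
  is_tree T -> (forall u, degree T u <= d) -> 0 < d -> 0 < h ->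
  x + y + 2 * (h * d ^ h) < #|U| ->
  exists (par : U -> U) (dep pos : U -> nat) (cuts : {set U}) (i j : nat) (Se Sl : {set U}),
  [/\ forest_edge par dep =2 adj T, pieces par dep cuts pos (h * d ^ h),
      #|cuts| * h <= #|U| + h & i <= j] /\
  [/\ x <= #|early pos i| <= x + h * d ^ h, y <= #|late pos j| <= y + h * d ^ h,
    [/\ Se \subset early pos i, scattered par dep cuts Se &
      #|early pos i| <= (d + 1) ^ 2 * #|cuts| + (d + 1) ^ 4 * #|Se|] &
    [/\ Sl \subset late pos j, scattered par dep cuts Sl &
      #|late pos j| <= (d + 1) ^ 2 * #|cuts| + (d + 1) ^ 4 * #|Sl|]].
Proof.
move=> tree deg d_gt0 h_gt0 U_large; set b := h * d ^ h in U_large *.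
have [par [dep [dep_child edgeE roots1]]] := rooted_tree tree.
have deg_le u : #|[set v | forest_edge par dep u v]| <= d.
  by apply: leq_trans (deg u); apply: eq_leq; apply: eq_card => v; rewrite !inE edgeE.
have [r few_cuts] := exists_few_cuts dep h_gt0; rewrite roots1 mul1n in few_cuts.
have P := residue_pieces d_gt0 h_gt0 dep_child (card_children deg_le) r.
set C := cuts _ _ _ in few_cuts P; set pos := piece_pos _ _ _ _ in P.
have [i /andP[i_lo i_hi]] := early_threshold (card_piece P) (ltac:(lia) : x <= #|U|).
have [j /andP[j_lo j_hi]] := early_threshold (card_piece P) (ltac:(lia) : #|U| - y - b <= #|U|).
have [Se [SeX scatE] cardE] := many_scattered deg_le C (early pos i).
have [Sl [SlX scatL] cardL] := many_scattered deg_le C (late pos j).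
have late_j := card_early_late pos j.
exists par, dep, pos, C, i, j, Se, Sl; do 2!split=> //.
- rewrite leqNgt; apply/negP => ji; have : #|early pos j| <= #|early pos i|.
    by apply/subset_leq_card/subsetP => u; rewrite !inE => /ltn_trans; apply.
  by lia.
- by rewrite i_lo.
by lia.
Qed.

(** * Embedding a forest piece by piece *)

Lemma disjoint_subfamily (U V : finType) (K : {set U}) (X : U -> {set V}) k m :
  #|K| <= k -> (forall u, u \in K -> k * m <= #|X u|) ->
  exists X' : U -> {set V}, [/\ forall u, u \in K -> X' u \subset X u,
    forall u, u \in K -> #|X' u| = m &
    forall u v, u \in K -> v \in K -> u != v -> [disjoint X' u & X' v]].
Proof.
have [n] := ubnP #|K|; elim: n K => // n IH K Kn Kk X_large.
have [->|/set0Pn[u uK]] := eqVneq K set0; first by exists X; split=> [u|u|u v]; rewrite inE.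
have cK : #|K| = #|K :\ u|.+1 by rewrite (cardsD1 u) uK.
have [||v /setD1P[_ vK]|X1 [sub1 card1 disj1]] := IH (K :\ u); [lia|lia|exact: X_large|].
pose used := \bigcup_(v in K :\ u) X1 v.
have card_used : #|used| <= #|K :\ u| * m by apply: card_bigcup_le_const => v vK; rewrite card1.
have [|Xu sub_u card_u] := @exists_subset_card _ (X u :\: used) m.
  have := X_large u uK; have := leq_mul Kk (leqnn m); rewrite cK mulSn [#|X u :\: _|]cardsD.
  by have := subset_leq_card (subsetIr (X u) used); lia.
have disj_u v : v \in K -> v != u -> [disjoint Xu & X1 v].
  move=> vK vu; apply: disjointWl sub_u _; rewrite -setI_eq0 setIDAC setD_eq0.
  by apply: subset_trans (subsetIr _ _) (bigcup_sup v _); rewrite !inE vu.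
exists (fun v => if v == u then Xu else X1 v); split=> [v|v|v w].
- case: eqP => [-> _|/eqP vu vK]; first exact: subset_trans sub_u (subsetDl _ _).
  by apply: sub1; rewrite !inE vu.
- by case: eqP => // /eqP vu vK; apply: card1; rewrite !inE vu.
case: (eqVneq v u) => [->|vu]; case: (eqVneq w u) => [->|wu] vK wK vw.
- by case/negP: vw.
- exact: disj_u.
- by rewrite disjoint_sym; apply: disj_u.
by apply: disj1; rewrite // !inE ?vu ?wu.
Qed.

Definition joined (V : finType) (G : rel V) (A : {set V}) beta :=
  forall X Z : {set V}, X \subset ~: A -> Z \subset ~: A -> [disjoint X & Z] ->
    beta <= #|X| -> beta <= #|Z| -> exists x y, [/\ x \in X, y \in Z & G x y].

Definition embeds (U V : finType) (par : U -> U) (dep : U -> nat) (G : rel V) (D : {set U})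
    (phi : U -> V) :=
  {in D &, injective phi} /\
  {in D &, forall u v, forest_edge par dep u v -> G (phi u) (phi v)}.

Section Embedding.
Variables (U V : finType) (par : U -> U) (dep : U -> nat) (d b beta : nat).
Variables (G : rel V) (A : {set V}).
Local Notation is_child := (is_child par dep).
Local Notation forest_edge := (forest_edge par dep).
Local Notation embeds := (embeds par dep G).
Hypothesis few_children : forall u, #|[set v | is_child v && (par v == u)]| <= d.
Hypothesis G_sym : symmetric G.
Hypothesis beta_gt0 : 0 < beta.
Hypothesis G_joined : joined G A beta.
Implicit Types (K F D : {set U}) (X Y : U -> {set V}).

Lemma few_unjoined (X Z : {set V}) : X \subset ~: A -> Z \subset ~: A -> [disjoint X & Z] ->
  beta <= #|Z| -> #|X| < #|[set x in X | [exists y in Z, G x y]]| + beta.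
Proof.
move=> XA ZA XZ Z_large; set X1 := [set x in X | _].
have -> : #|X| = #|X1| + #|X :\: X1|.
  by rewrite -(cardsID X1) (setIidPr _) //; apply/subsetP => x /setIdP[].
rewrite ltn_add2l ltnNge; apply/negP => large.
have [||x [y [/setDP[xX /negP xX1] yZ xy]]] := G_joined _ ZA _ large Z_large.
- exact: subset_trans (subsetDl _ _) XA.
- exact: disjointWl (subsetDl _ _) XZ.
by apply: xX1; rewrite inE xX; apply/existsP; exists y; rewrite yZ.
Qed.

(* The deepest vertex of [F] is removed, and the target of its parent is reduced to the vertices
   having a neighbour in the removed target. *)
Lemma forest_transversal (phi0 : U -> V) K F Y :
  F \subset [set v in K | is_child v && (par v \in K)] ->
  (forall u, u \in K -> Y u \subset ~: A) ->
  (forall u v, u \in K -> v \in K -> u != v -> [disjoint Y u & Y v]) ->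
  (forall u, u \in K -> #|[set v in F | par v == u]|.+1 * beta <= #|Y u|) ->
  exists2 phi : U -> V, forall u, u \in K -> phi u \in Y u &
    forall v, v \in F -> G (phi (par v)) (phi v).
Proof.
have [n] := ubnP #|F|; elim: n F Y => // n IH F Y Fn FK YA Yd Y_large.
have [F0|/set0Pn[v1 v1F]] := eqVneq F set0.
  exists (fun u => odflt (phi0 u) [pick x in Y u]) => [u uK|v]; last by rewrite F0 inE.
  have /card_gt0P[x xY] : 0 < #|Y u| by apply: leq_trans (Y_large u uK); rewrite muln_gt0.
  by case: pickP => [//|/(_ x)]; rewrite xY.
case: (arg_maxnP dep v1F) => v vF deepest; have {v1 v1F}vF : v \in F := vF.
have := subsetP FK v vF; rewrite inE => /and3P[vK child_v pK]; set p := par v in pK.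
have pv : p != v by apply/eqP => p_v; move: child_v; rewrite /is_child -/p p_v => /eqP; lia.
pose Y' u := if u == p then [set x in Y p | [exists y in Y v, G x y]] else Y u.
have Y'Y u : Y' u \subset Y u.
  by rewrite /Y'; case: eqP => [->|//]; apply/subsetP => x /setIdP[].
have v_large : beta <= #|Y v| by apply: leq_trans (Y_large v vK); rewrite leq_pmull.
have lost := few_unjoined (YA p pK) (YA v vK) (Yd p v pK vK pv) v_large.
have [||u uK|u w uK wK uw|u uK|phi phiY phiF] := IH (F :\ v) Y'.
- by move: Fn; rewrite (cardsD1 v F) vF; lia.
- exact: subset_trans (subsetDl _ _) FK.
- exact: subset_trans (Y'Y u) (YA u uK).
- exact: disjointWl (Y'Y u) (disjointWr (Y'Y w) (Yd u w uK wK uw)).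
- have [->|up] := eqVneq u p; last first.
    rewrite /Y' (negbTE up); apply: leq_trans (Y_large u uK); rewrite leq_mul2r ltnS.
    by apply/orP; right; apply/subset_leq_card/subsetP => w; rewrite !inE => /andP[/andP[_ ->]].
  have := Y_large p pK; have -> : #|[set w in F | par w == p]| = #|[set w in F :\ v | par w == p]|.+1.
    rewrite (cardsD1 v) inE vF eqxx /= add1n; congr _.+1; apply: eq_card => w.
    by rewrite !inE andbA.
  by rewrite /Y' eqxx mulSn; move: lost; lia.
have := phiY p pK; rewrite {1}/Y' eqxx inE => /andP[_ /existsP[y /andP[yv py]]].
exists (fun u => if u == v then y else phi u) => [u uK|w wF].
  by case: eqP => [->//|_]; apply: subsetP (Y'Y u) _ (phiY u uK).
have -> : par w == v = false.
  apply/eqP => pw; have := deepest w wF; have := subsetP FK w wF.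
  by rewrite inE => /and3P[_ /eqP -> _]; rewrite pw; lia.
by case: eqP => [->//|/eqP wv]; apply: phiF; rewrite !inE wv.
Qed.

Lemma embeds_extend_piece phi D K X : embeds D phi -> [disjoint K & D] -> #|K| <= b ->
  (forall v, v \in K -> X v \subset ~: A /\ [disjoint X v & phi @: D]) ->
  (forall v w x, v \in K -> w \in D -> forest_edge v w -> x \in X v -> G x (phi w)) ->
  (forall v, v \in K -> b * (d.+1 * beta) <= #|X v|) ->
  exists2 phi', {in D, phi' =1 phi} & embeds (D :|: K) phi' /\ forall v, v \in K -> phi' v \in X v.
Proof.
move=> [phi_inj phi_edge] KD Kb X_free X_nbr X_large.
have [X' [subX' cardX' disjX']] := disjoint_subfamily Kb X_large.
have [|u uK|//|u uK|psi psiX' psi_edge] :=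
  @forest_transversal phi K [set v in K | is_child v && (par v \in K)] X'; first by [].
- by apply: subset_trans (subX' u uK) _; case: (X_free u uK).
- rewrite cardX' // leq_mul2r ltnS; apply/orP; right; apply: leq_trans (few_children u).
  by apply/subset_leq_card/subsetP => v; rewrite !inE => /andP[/and3P[_ -> _] ->].
have psiX u : u \in K -> psi u \in X u by move=> uK; apply: subsetP (subX' u uK) _ (psiX' u uK).
pose phi' u := if u \in K then psi u else phi u.
have phiK u : u \in K -> phi' u = psi u by rewrite /phi' => ->.
have phiD u : u \in D -> phi' u = phi u by move=> uD; rewrite /phi' (disjointFl KD uD).
have new u w : u \in K -> w \in D -> psi u != phi w.
  move=> uK wD; apply: contraTneq (psiX u uK) => ->.
  by case: (X_free u uK) => _ /disjointFl -> //; apply: imset_f.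
exists phi' => //; split; last by move=> v vK; rewrite phiK ?psiX.
split=> u v; rewrite !in_setU => /orP[uD|uK] /orP[vD|vK].
- by rewrite !phiD //; apply: phi_inj.
- by rewrite phiD // phiK // => eq_uv; have := new _ _ vK uD; rewrite eq_uv eqxx.
- by rewrite phiK // phiD // => eq_uv; have := new _ _ uK vD; rewrite eq_uv eqxx.
- rewrite !phiK // => eq_uv; apply/eqP/negPn/negP => uv.
  by have := disjointFr (disjX' u v uK vK uv) (psiX' u uK); rewrite eq_uv psiX'.
- by rewrite !phiD //; apply: phi_edge.
- rewrite phiD // phiK // G_sym forest_edge_sym => vu; exact: X_nbr vK uD vu (psiX v vK).
- rewrite phiK // phiD // => uv; exact: X_nbr uK vD uv (psiX u uK).
rewrite !phiK //; case/orP=> /andP[child /eqP par_eq].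
  by rewrite -par_eq psi_edge // inE vK child par_eq.
by rewrite G_sym -par_eq psi_edge // inE uK child par_eq.
Qed.

Section Extension.
Variables (cuts : {set U}) (pos : U -> nat).
Hypothesis pos_pieces : pieces par dep cuts pos b.
Variables (New Old : {set U}) (phi0 : U -> V) (target : U -> {set V}).
Variables (C : eqType) (pool : U -> C) (attached : pred U).

Definition earlier_nbr v w :=
  forest_edge v w && ((w \in Old) || (w \in New) && (pos w < pos v)).
Definition room v := #|[set u in New | pool u == pool v]| + b * (d.+1 * beta).

Hypothesis New_Old : [disjoint New & Old].
Hypothesis phi0_embeds : embeds Old phi0.
Hypothesis earlier_nbr_uniq : forall v w1 w2, v \in New ->
  earlier_nbr v w1 -> earlier_nbr v w2 -> w1 = w2.
Hypothesis earlier_nbr_attached : forall v w, v \in New -> earlier_nbr v w -> attached v.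
Hypothesis target_A : forall v, v \in New -> target v \subset ~: A.
Hypothesis target_free : forall u v, u \in Old -> v \in New -> phi0 u \notin target v.
Hypothesis target_pool : forall u v, u \in New -> v \in New -> pool u != pool v ->
  [disjoint target u & target v].
Hypothesis target_room : forall v, v \in New -> ~~ attached v -> room v <= #|target v|.
Hypothesis attached_room : forall v x, v \in New -> attached v ->
  room v <= #|[set y in target v | G x y]|.

Definition extends_before i phi := [/\ {in Old, phi =1 phi0},
  embeds (Old :|: [set u in New | pos u < i]) phi &
  forall v, v \in New -> pos v < i -> phi v \in target v].

Lemma extend_step i phi : extends_before i phi -> exists phi', extends_before i.+1 phi'.
Proof.
case=> phi_old; set D := Old :|: _ => phi_embeds phi_target.
pose K := [set u in New | pos u == i].
pose used := phi @: [set u in New | pos u < i].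
pose anchor v := if [pick w | earlier_nbr v w] is Some w then phi w else phi v.
pose avail v := if attached v then [set y in target v | G (anchor v) y] else target v.
have KNew v : v \in K -> v \in New by case/setIdP.
have availT v : avail v \subset target v.
  by rewrite /avail; case: ifP => // _; apply/subsetP => y /setIdP[].
have [||v /setIdP[vN _]|v w x vK wD vw|v /setIdP[vN _]|phi' phi'D [phi'_embeds phi'K]] :=
  @embeds_extend_piece phi D K (fun v => avail v :\: used) phi_embeds.
- rewrite disjoint_sym disjoints_subset; apply/subsetP => u; rewrite !inE negb_and.
  by case/orP=> [uO|/andP[_ /ltn_eqF->]]; rewrite ?orbT // (disjointFl New_Old uO).
- by apply: leq_trans (card_piece pos_pieces i); apply/subset_leq_card/subsetP => u; rewrite !inE => /andP[].
- split; first by apply: subset_trans (subsetDl _ _) (subset_trans (availT v) (target_A vN)).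
  rewrite imsetU -setI_eq0 setIUr -/used (_ : _ :&: used = set0) ?setU0; last first.
    by rewrite setIDAC setDIl setDv setI0.
  rewrite setI_eq0 disjoint_sym disjoints_subset; apply/subsetP => _ /imsetP[u uO ->]; rewrite !inE negb_and negbK.
  by rewrite phi_old // orbC (contra (subsetP (availT v) _)) ?target_free.
- have early_w : earlier_nbr v w.
    rewrite /earlier_nbr vw /=; move: wD vK; rewrite !inE => /orP[->//|/andP[-> wi]] /andP[_ /eqP->].
    by rewrite wi orbT.
  have att_v := earlier_nbr_attached (KNew v vK) early_w.
  rewrite /avail att_v => /setDP[/setIdP[_ +] _]; rewrite /anchor; case: pickP => [w' early_w'|/(_ w)].
    by rewrite (earlier_nbr_uniq (KNew v vK) early_w' early_w) G_sym.
  by rewrite early_w.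
- have room_v : room v <= #|avail v|.
    by rewrite /avail; case: (boolP (attached v)) => att; [apply: attached_room | apply: target_room].
  suff : #|avail v :&: used| <= #|[set u in New | pool u == pool v]|.
    by rewrite cardsD; move: room_v; rewrite /room; lia.
  apply: leq_trans (leq_imset_card phi _); apply/subset_leq_card/subsetP => y.
  rewrite inE => /andP[/(subsetP (availT v)) yT /imsetP[u /setIdP[uN ui] y_u]].
  apply/imsetP; exists u => //; rewrite inE uN; apply: contraT => pool_neq.
  by have := disjointFl (target_pool uN vN pool_neq) yT; rewrite y_u phi_target.
have DK : D :|: K = Old :|: [set u in New | pos u < i.+1].
  by apply/setP => u; rewrite !inE ltnS [pos u <= i]leq_eqVlt -orbA -andb_orr [(pos u == i) || _]orbC.
exists phi'; rewrite /extends_before -DK; split=> // [u uO|v vN].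
  by rewrite phi'D ?phi_old // inE uO.
rewrite ltnS leq_eqVlt => /orP[vi|vi].
  by have /phi'K/setDP[/(subsetP (availT v))] : v \in K by rewrite inE vN.
by rewrite phi'D ?phi_target // !inE vN vi orbT.
Qed.

Lemma embeds_extend : exists phi, [/\ {in Old, phi =1 phi0}, embeds (Old :|: New) phi &
  forall v, v \in New -> phi v \in target v].
Proof.
have extend i : exists phi, extends_before i phi.
  elim: i => [|i [phi /extend_step //]]; exists phi0; split=> //.
  by rewrite (_ : [set u in New | _] = set0) ?setU0 //; apply/setP => u; rewrite !inE ltn0 andbF.
have [phi [phi_old phi_embeds phi_target]] := extend (\max_u pos u).+1.
have last_pos u : pos u < (\max_u pos u).+1 by rewrite ltnS leq_bigmax.
have New_all : [set u in New | pos u < (\max_u pos u).+1] = New.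
  by apply/setP => u; rewrite inE last_pos andbT.
by exists phi; rewrite New_all in phi_embeds; split=> // v vN; apply: phi_target.
Qed.

End Extension.
End Embedding.

(** * Embedding a tree without its hubs *)

Lemma exists_bij_imset (U V : finType) (f0 : U -> V) (Q : {set U}) (L : {set V}) :
  #|Q| = #|L| -> exists2 f : U -> V, {in Q &, injective f} & f @: Q = L.
Proof.
move=> cQL; pose f u := nth (f0 u) (enum L) (index u (enum Q)).
have index_lt u : u \in Q -> index u (enum Q) < size (enum L).
  by move=> uQ; rewrite -cardE -cQL cardE index_mem mem_enum.
have f_inj : {in Q &, injective f}.
  move=> u v uQ vQ; rewrite /f (set_nth_default (f0 u) (f0 v)) ?index_lt //.
  move/eqP; rewrite nth_uniq ?index_lt ?enum_uniq // => /eqP index_eq.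
  by rewrite -(nth_index u (_ : u \in enum Q)) ?mem_enum // index_eq nth_index ?mem_enum.
exists f => //; apply/eqP; rewrite eqEcard (card_in_imset f_inj) cQL leqnn andbT.
by apply/subsetP => _ /imsetP[u uQ ->]; rewrite -mem_enum mem_nth // index_lt.
Qed.

(* The neighbours of the hubs are placed on [Tuples], and the hubs will be placed in [Base].  The
   reserves receive the vertices having an embedded neighbour at the time when their piece is
   embedded, in the early, middle and late part of the tree; the remaining vertices go to [Bulk]
   in the first two parts and to [LateBulk] in the last one. *)
Variant region :=
  Tuples | Base | EarlyReserve | MidReserve | LateReserve | LateBulk | Bulk.

Definition regions := [:: Tuples; Base; EarlyReserve; MidReserve; LateReserve; LateBulk; Bulk].

Definition region_index (k : region) : nat :=
  match k with
  | Tuples => 0 | Base => 1 | EarlyReserve => 2 | MidReserve => 3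
  | LateReserve => 4 | LateBulk => 5 | Bulk => 6
  end.

Lemma region_indexK : cancel region_index (nth Bulk regions).
Proof. by case. Qed.

Definition region_eq k l := region_index k == region_index l.

Lemma region_eqP : Equality.axiom region_eq.
Proof. by move=> k l; apply: (iffP eqP) => [/(can_inj region_indexK)|->]. Qed.

HB.instance Definition _ := hasDecEq.Build region region_eqP.

Section Regions.
Variables (V : finType) (reg : V -> region).

Definition Reg k : {set V} := [set x | reg x == k].

Lemma in_Reg x k : (x \in Reg k) = (reg x == k).
Proof. by rewrite inE. Qed.

Lemma card_Regs (ks : seq region) : uniq ks ->
  #|[set x | reg x \in ks]| = \sum_(k <- ks) #|Reg k|.
Proof.
elim: ks => [_|k ks IH /= /andP[k_ks uks]].
  by rewrite big_nil; apply: eq_card0 => x; rewrite !inE.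
rewrite big_cons -IH // -cardsUI (_ : Reg k :&: _ = set0) ?cards0 ?addn0.
  by apply: eq_card => x; rewrite !inE.
by apply/setP => x; rewrite !inE; apply: contraNF k_ks => /andP[/eqP->].
Qed.

End Regions.

(* Absorbers are early vertices placed in [Base] that can be moved to a spare vertex at the end;
   fillers are late vertices covering whatever the first two parts leave in their regions. *)
Record tree_layout (U : finType) (par : U -> U) (dep pos : U -> nat) (cuts : {set U}) (i j : nat)
    (hubs absorbers fillers : {set U}) : Prop := TreeLayout {
  early_le_late : i <= j;
  hubs_early : hubs \subset early pos i;
  absorbers_early : absorbers \subset early pos i;
  fillers_late : fillers \subset late pos j;
  hubs_absorbers : [disjoint hubs & absorbers];
  early_scattered : scattered par dep cuts (hubs :|: absorbers);
  late_scattered : scattered par dep cuts fillers }.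

Record embedding_room (U V : finType) (par : U -> U) (dep pos : U -> nat) (cuts : {set U})
    (i j d slack : nat) (hubs absorbers fillers : {set U}) (G : rel V) (reg : V -> region) : Prop :=
  EmbeddingRoom {
  cover_count : #|hubs| + #|late pos j| = #|Reg reg Base| + #|fillers|;
  base_room : #|absorbers| + slack <= #|Reg reg Base|;
  early_reserve_room : forall x,
    #|cuts| + d * #|forest_nbrs par dep hubs| + d * #|absorbers| + slack <=
    deg_in G (Reg reg EarlyReserve) x;
  bulk_room : #|early pos i| + slack <= #|Reg reg Bulk|;
  mid_reserve_room : forall x, #|cuts| + slack <= deg_in G (Reg reg MidReserve) x;
  filler_room : #|Reg reg MidReserve| + slack <= #|fillers|;
  late_reserve_room : forall x,
    #|cuts| + d * #|fillers| + slack <= deg_in G (Reg reg LateReserve) x;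
  late_bulk_room : #|late pos j| + slack <= #|Reg reg LateBulk| }.

Section HublessEmbedding.
Variables (U V : finType) (par : U -> U) (dep pos : U -> nat) (cuts : {set U}).
Variables (d b beta : nat) (G : rel V) (reg : V -> region).
Variables (i j : nat) (hubs absorbers fillers : {set U}) (place spare : U -> V).
Local Notation forest_edge := (forest_edge par dep).
Local Notation is_child := (is_child par dep).
Local Notation forest_nbrs := (forest_nbrs par dep).
Local Notation within2 := (within2 par dep).
Local Notation Reg := (Reg reg).
Local Notation hub_nbrs := (forest_nbrs hubs).
Local Notation absorber_nbrs := (forest_nbrs absorbers).
Local Notation slack := (b * (d.+1 * beta)).

Hypothesis deg_le : forall u, #|[set v | forest_edge u v]| <= d.
Hypothesis pos_pieces : pieces par dep cuts pos b.
Hypothesis G_sym : symmetric G.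
Hypothesis beta_gt0 : 0 < beta.
Hypothesis G_joined : joined G (Reg Tuples) beta.
Hypothesis layout : tree_layout par dep pos cuts i j hubs absorbers fillers.
Hypothesis rooms : embedding_room par dep pos cuts i j d slack hubs absorbers fillers G reg.
Hypothesis place_inj : {in hub_nbrs &, injective place}.
Hypothesis place_im : place @: hub_nbrs = Reg Tuples.
Hypothesis spare_inj : {in absorbers &, injective spare}.
Hypothesis spare_im : spare @: absorbers = Reg LateReserve :|: Reg LateBulk.
Hypothesis card_UV : #|U| = #|V|.

Let few_children := card_children deg_le.
Let early_scat := early_scattered layout.
Let late_scat := late_scattered layout.

Lemma pos_edge u v : forest_edge u v -> u \notin cuts -> v \notin cuts -> pos u = pos v.
Proof. by case/orP=> /andP[child /eqP <-] uC vC; rewrite (pos_par pos_pieces). Qed.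

Lemma earlier_parent v w : forest_edge v w -> pos w < pos v -> v \in cuts /\ w = par v.
Proof.
case/orP=> /andP[child /eqP par_eq] pos_lt.
  have : pos (par w) <= pos w.
    by case: (boolP (w \in cuts)) => wC; [rewrite ltnW // (pos_cut pos_pieces) | rewrite (pos_par pos_pieces)].
  by rewrite par_eq; lia.
split=> //; apply: contraT => vC.
by have := pos_par pos_pieces child vC; rewrite par_eq; lia.
Qed.

Lemma scattered_pos (S : {set U}) q v :
  scattered par dep cuts S -> q \in S -> forest_edge q v -> pos v = pos q.
Proof.
move=> scat qS qv; rewrite (pos_edge qv) //.
  exact: scattered_notin_cuts scat qS (within2_refl _ _ _).
exact: scattered_notin_cuts scat qS (within2_edge qv).
Qed.

Lemma hubs_spot q : q \in hubs -> q \in hubs :|: absorbers.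
Proof. by move=> qI; rewrite inE qI. Qed.

Lemma absorbers_spot q : q \in absorbers -> q \in hubs :|: absorbers.
Proof. by move=> qA; rewrite inE qA orbT. Qed.

Lemma hub_not_absorber q : q \in hubs -> q \in absorbers -> False.
Proof. by move=> qI; rewrite (disjointFr (hubs_absorbers layout) qI). Qed.

Lemma hub_nbr_early w : w \in hub_nbrs -> pos w < i.
Proof.
case/forest_nbrsP=> q qI qw; rewrite (scattered_pos early_scat (hubs_spot qI) qw).
by have := subsetP (hubs_early layout) q qI; rewrite inE.
Qed.

Lemma hub_nbr_not_hub w : w \in hub_nbrs -> w \notin hubs.
Proof.
by move/(scattered_nbr_notin early_scat (subsetUl _ _)); rewrite inE negb_or => /andP[].
Qed.

Lemma hub_nbr_not_absorber w : w \in hub_nbrs -> w \notin absorbers.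
Proof.
by move/(scattered_nbr_notin early_scat (subsetUl _ _)); rewrite inE negb_or => /andP[].
Qed.

Lemma absorber_nbr_not_absorber w : w \in absorber_nbrs -> w \notin absorbers.
Proof.
by move/(scattered_nbr_notin early_scat (subsetUr _ _)); rewrite inE negb_or => /andP[].
Qed.

Definition early_rest := early pos i :\: (hubs :|: hub_nbrs).
Definition absorber_of v := odflt v [pick q in absorbers | forest_edge q v].
Definition early_attached v := (v \in cuts) || [exists w in hub_nbrs, forest_edge v w].

Definition early_region v :=
  if v \in absorbers then Base
  else if (v \in absorber_nbrs) || early_attached v then EarlyReserve else Bulk.

(* An absorber can be moved to its spare vertex because its neighbours are placed next to it. *)
Definition early_target v :=
  if v \in absorber_nbrs then [set y in Reg (early_region v) | G (spare (absorber_of v)) y]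
  else Reg (early_region v).

Lemma early_targetP v x : x \in early_target v -> reg x = early_region v.
Proof. by rewrite /early_target; case: ifP => _; rewrite !inE; [case/andP=> /eqP | move/eqP]. Qed.

Lemma absorber_early_rest q : q \in absorbers -> q \in early_rest.
Proof.
move=> qA; rewrite !in_setD in_setU (subsetP (absorbers_early layout) q qA) andbT negb_or.
by apply/andP; split; apply/negP => q_hub; [apply: hub_not_absorber qA | have := hub_nbr_not_absorber q_hub; rewrite qA].
Qed.

Lemma early_rest_pos v : v \in early_rest -> pos v < i.
Proof. by case/setDP; rewrite inE. Qed.

Lemma early_rest_not_hub v : v \in early_rest -> v \notin hubs.
Proof. by case/setDP=> _; rewrite inE negb_or => /andP[]. Qed.

Lemma early_rest_not_hub_nbr v : v \in early_rest -> v \notin hub_nbrs.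
Proof. by case/setDP=> _; rewrite in_setU negb_or => /andP[]. Qed.

Lemma absorber_not_attached q : q \in absorbers -> ~~ early_attached q.
Proof.
move=> qA; rewrite negb_or (scattered_notin_cuts early_scat (absorbers_spot qA)) ?within2_refl //=.
apply/exists_inPn => w /forest_nbrsP[q' q'I q'w]; apply/negP; rewrite forest_edge_sym => wq.
have q'q := scattered_eq early_scat (hubs_spot q'I) (absorbers_spot qA) (within2_path q'w wq) (within2_refl _ _ _).
by apply: hub_not_absorber qA; rewrite -q'q.
Qed.

Lemma absorber_nbr_not_attached v : v \in absorber_nbrs -> ~~ early_attached v.
Proof.
case/forest_nbrsP=> q qA qv.
rewrite negb_or (scattered_notin_cuts early_scat (absorbers_spot qA) (within2_edge qv)) /=.
apply/exists_inPn => w /forest_nbrsP[q' q'I q'w]; apply/negP => vw.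
have qq' := scattered_eq early_scat (absorbers_spot qA) (hubs_spot q'I) (within2_path qv vw) (within2_edge q'w).
by apply: hub_not_absorber qA; rewrite qq'.
Qed.

Lemma absorber_ofE q v : q \in absorbers -> forest_edge q v -> absorber_of v = q.
Proof.
move=> qA qv; rewrite /absorber_of; case: pickP => [q' /andP[q'A q'v]|/(_ q)]; last by rewrite qA qv.
exact: scattered_eq early_scat (absorbers_spot q'A) (absorbers_spot qA) (within2_edge q'v) (within2_edge qv).
Qed.

Lemma card_early_reserve_users :
  #|[set v | early_region v == EarlyReserve]| <= #|cuts| + d * #|hub_nbrs| + d * #|absorbers|.
Proof.
have cover : [set v | early_region v == EarlyReserve] \subset
    cuts :|: forest_nbrs hub_nbrs :|: absorber_nbrs.
  apply/subsetP => v; rewrite in_set /early_region; case: ifP => // _; case: ifP => // + _.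
  rewrite !in_setU /early_attached => /or3P[->|->|/exists_inP[w wN vw]]; rewrite ?orbT //.
  suff -> : v \in forest_nbrs hub_nbrs by rewrite orbT.
  by apply/forest_nbrsP; exists w; rewrite // forest_edge_sym.
apply: leq_trans (subset_leq_card cover) _; apply: leq_trans (leq_card_setU _ _) _.
apply: leq_add; last exact: card_forest_nbrs.
by apply: leq_trans (leq_card_setU _ _) _; rewrite leq_add2l card_forest_nbrs.
Qed.

Lemma early_neighbour v w : v \in early_rest -> earlier_nbr par dep pos early_rest hub_nbrs v w ->
  (exists2 q, q \in hubs & forest_edge q w) \/ (v \in cuts /\ w = par v).
Proof.
by move=> _ /andP[vw /orP[/forest_nbrsP|/andP[_ wv]]]; [left | right; apply: earlier_parent].
Qed.

Lemma early_neighbour_uniq v w1 w2 : v \in early_rest ->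
  earlier_nbr par dep pos early_rest hub_nbrs v w1 ->
  earlier_nbr par dep pos early_rest hub_nbrs v w2 -> w1 = w2.
Proof.
move=> vP e1 e2; have [/andP[vw1 _] /andP[vw2 _]] := (e1, e2).
rewrite forest_edge_sym in vw1; rewrite forest_edge_sym in vw2.
have not_cut q w : q \in hubs -> forest_edge q w -> forest_edge w v -> v \notin cuts.
  by move=> qI qw wv; apply: scattered_notin_cuts early_scat (hubs_spot qI) (within2_path qw wv).
case: (early_neighbour vP e1) => [[q1 q1I q1w]|[vC ->]];
  case: (early_neighbour vP e2) => [[q2 q2I q2w]|[vC2 ->]] //.
- have q12 := scattered_eq early_scat (hubs_spot q1I) (hubs_spot q2I) (within2_path q1w vw1) (within2_path q2w vw2).
  rewrite -q12 in q2w; apply: forest_edge_square q1w vw1 q2w vw2.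
  by apply: contraNneq (early_rest_not_hub vP) => <-.
- by have := not_cut _ _ q1I q1w vw1; rewrite vC2.
by have := not_cut _ _ q2I q2w vw2; rewrite vC.
Qed.

Lemma place_embeds : embeds par dep G hub_nbrs place.
Proof.
split=> // u v /forest_nbrsP[q qI qu] /forest_nbrsP[q' q'I q'v] uv.
have qq' := scattered_eq early_scat (hubs_spot qI) (hubs_spot q'I) (within2_path qu uv) (within2_edge q'v).
by case: (forest_edge_triangle qu uv); rewrite qq'.
Qed.

Lemma reg_place u : u \in hub_nbrs -> reg (place u) = Tuples.
Proof. by move=> uN; apply/eqP; rewrite -in_Reg -place_im imset_f. Qed.

Lemma early_room v : v \in early_rest -> ~~ early_attached v ->
  room d b beta early_rest early_region v <= #|early_target v|.
Proof.
move=> vP v_free; rewrite /room /early_target.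
case: (boolP (v \in absorber_nbrs)) => [v_nbr|v_not_nbr].
  have regv : early_region v = EarlyReserve.
    by rewrite /early_region (negbTE (absorber_nbr_not_absorber v_nbr)) v_nbr.
  rewrite regv; apply: leq_trans (early_reserve_room rooms _); rewrite leq_add2r.
  apply: leq_trans card_early_reserve_users; apply/subset_leq_card/subsetP => u.
  by rewrite !inE => /andP[].
rewrite /early_region (negbTE v_not_nbr) (negbTE v_free) /=.
case: (boolP (v \in absorbers)) => vA.
  apply: leq_trans (base_room rooms); rewrite leq_add2r; apply/subset_leq_card/subsetP => u.
  by rewrite inE => /andP[_]; case: (u \in absorbers) => //; case: (_ || _).
apply: leq_trans (bulk_room rooms); rewrite leq_add2r; apply/subset_leq_card/subsetP => u.
by case/setIdP=> /setDP[].
Qed.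

Lemma early_attached_room v x : v \in early_rest -> early_attached v ->
  room d b beta early_rest early_region v <= #|[set y in early_target v | G x y]|.
Proof.
move=> vP v_att.
have v_not_nbr : v \in absorber_nbrs = false.
  by apply/negP => /absorber_nbr_not_attached; rewrite v_att.
have vA : v \in absorbers = false by apply/negP => /absorber_not_attached; rewrite v_att.
have regv : early_region v = EarlyReserve by rewrite /early_region vA v_att orbT.
rewrite /room /early_target v_not_nbr regv; apply: leq_trans (early_reserve_room rooms x).
rewrite leq_add2r; apply: leq_trans card_early_reserve_users; apply/subset_leq_card/subsetP => u.
by rewrite !inE => /andP[].
Qed.

Definition early_embedding phi := [/\ {in hub_nbrs, phi =1 place},
  embeds par dep G (hub_nbrs :|: early_rest) phi &
  forall v, v \in early_rest -> phi v \in early_target v].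

Lemma exists_early_embedding : exists phi, early_embedding phi.
Proof.
apply: (embeds_extend few_children G_sym beta_gt0 G_joined pos_pieces _ place_embeds
  early_neighbour_uniq _ _ _ _ early_room early_attached_room).
- rewrite disjoints_subset; apply/subsetP => v /early_rest_not_hub_nbr.
  by rewrite in_setC.
- move=> v w vP /andP[vw /orP[wN|/andP[_ wv]]]; rewrite /early_attached.
    by apply/orP; right; apply/exists_inP; exists w.
  by have [->] := earlier_parent vw wv.
- move=> v _; apply/subsetP => x /early_targetP regx; rewrite in_setC in_Reg regx /early_region.
  by case: ifP => // _; case: ifP.
- move=> u v uN _; apply/negP => /early_targetP; rewrite reg_place // /early_region.
  by case: ifP => // _; case: ifP.
move=> u v _ _ reg_neq; rewrite -setI_eq0; apply/eqP/setP => x; rewrite in_set0 in_setI.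
by apply: contraNF reg_neq => /andP[/early_targetP <- /early_targetP <-].
Qed.

Definition middle := [set u | i <= pos u < j].
Definition covered_first := [set x | reg x \in [:: EarlyReserve; MidReserve; Bulk]].

Lemma early_rest_or_nbr_pos u : u \in hub_nbrs :|: early_rest -> pos u < i.
Proof. by rewrite in_setU => /orP[/hub_nbr_early|/early_rest_pos]. Qed.

Lemma card_tree_parts :
  #|hubs| + #|hub_nbrs| + #|early_rest| + #|middle| + #|late pos j| = #|U|.
Proof.
have early_parts : #|early pos i| = #|hubs| + #|hub_nbrs| + #|early_rest|.
  rewrite -(cardsID (hubs :|: hub_nbrs) (early pos i)) (setIidPr _); last first.
    by rewrite subUset (hubs_early layout); apply/subsetP => w /hub_nbr_early; rewrite inE.
  rewrite cardsU (_ : hubs :&: hub_nbrs = set0) ?cards0 ?subn0 //.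
  by apply/setP => u; rewrite in_setI in_set0; apply/negP => /andP[uI /hub_nbr_not_hub]; rewrite uI.
rewrite -early_parts -(card_early_late pos j); congr (_ + _).
rewrite -(cardsID (early pos i) (early pos j)); have ij := early_le_late layout.
congr (_ + _); apply: eq_card => u; rewrite !inE; lia.
Qed.

Lemma card_absorbers : #|absorbers| = #|Reg LateReserve| + #|Reg LateBulk|.
Proof.
rewrite -(card_in_imset spare_inj) spare_im cardsU (_ : _ :&: _ = set0) ?cards0 ?subn0 //.
by apply/setP => x; rewrite !inE; case: (reg x).
Qed.

Lemma card_covered_first :
  #|covered_first| = #|early_rest :\: absorbers| + #|middle| + #|fillers|.
Proof.
have all_regions : #|V| = \sum_(k <- regions) #|Reg k|.
  rewrite -card_Regs // -cardsT; apply: eq_card => x; rewrite !inE.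
  by case: (reg x).
have tuples : #|hub_nbrs| = #|Reg Tuples| by rewrite -place_im card_in_imset.
have rest : #|early_rest| = #|early_rest :\: absorbers| + #|absorbers|.
  rewrite -(cardsID absorbers early_rest) (setIidPr _) 1?addnC //.
  by apply/subsetP => q; apply: absorber_early_rest.
have := card_tree_parts; have := cover_count rooms; move: all_regions.
by rewrite card_UV card_Regs // rest card_absorbers tuples !big_cons !big_nil; lia.
Qed.

Definition middle_embedding phi := [/\ {in hub_nbrs, phi =1 place},
  embeds par dep G (hub_nbrs :|: early_rest :|: middle) phi,
  forall v, v \in early_rest -> phi v \in early_target v &
  forall v, v \in middle -> phi v \in covered_first].

Lemma early_image_reg phi u : early_embedding phi -> u \in hub_nbrs :|: early_rest ->
  reg (phi u) \in [:: Tuples; Base; EarlyReserve; Bulk].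
Proof.
move=> [phi_place _ phi_early]; rewrite in_setU => /orP[uN|/phi_early/early_targetP->].
  by rewrite phi_place // reg_place.
by rewrite /early_region; case: ifP => // _; case: ifP.
Qed.

Lemma middle_bulk_room phi : early_embedding phi ->
  #|middle| + slack <=
  #|(Reg Bulk :|: Reg EarlyReserve) :\: phi @: (hub_nbrs :|: early_rest)|.
Proof.
move=> [phi_place _ phi_early]; set D := hub_nbrs :|: early_rest.
have used : #|(Reg Bulk :|: Reg EarlyReserve) :&: phi @: D| <= #|early_rest :\: absorbers|.
  apply: leq_trans (leq_imset_card phi _); apply/subset_leq_card/subsetP => x.
  case/setIP=> + /imsetP[u uD x_u]; rewrite x_u in_setU !in_Reg => reg_u.
  apply/imsetP; exists u => //; move: uD; rewrite in_setU => /orP[uN|uP].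
    by rewrite phi_place // reg_place in reg_u.
  rewrite in_setD uP andbT; apply/negP => uA.
  by rewrite (early_targetP (phi_early u uP)) /early_region uA in reg_u.
have split_regs : #|covered_first| = #|Reg Bulk :|: Reg EarlyReserve| + #|Reg MidReserve|.
  rewrite card_Regs // !big_cons big_nil cardsU (_ : _ :&: _ = set0) ?cards0 ?subn0; first lia.
  by apply/setP => x; rewrite !inE; case: (reg x).
by have := card_covered_first; have := filler_room rooms; move: used; rewrite split_regs [#|_ :\: phi @: D|]cardsD; lia.
Qed.

Lemma exists_middle_embedding : exists phi, middle_embedding phi.
Proof.
have [phi phiP] := exists_early_embedding; have [phi_place phi_embeds phi_early] := phiP.
set D := hub_nbrs :|: early_rest in phi_embeds.
pose target v := if v \in cuts then Reg MidReserve else (Reg Bulk :|: Reg EarlyReserve) :\: phi @: D.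
have earlier v w : v \in middle -> earlier_nbr par dep pos middle D v w -> v \in cuts /\ w = par v.
  move=> vM /andP[vw]; case/orP=> [/early_rest_or_nbr_pos wi|/andP[_]]; apply: earlier_parent => //.
  by move: vM; rewrite inE => /andP[iv _]; apply: leq_trans iv.
have [||||||||psi [psi_phi psi_embeds psi_target]] := @embeds_extend U V par dep d b beta G (Reg Tuples)
  few_children G_sym beta_gt0 G_joined cuts pos pos_pieces middle D phi target _
  (fun v => v \in cuts) (fun v => v \in cuts) _ phi_embeds.
- rewrite disjoints_subset; apply/subsetP => v; rewrite inE => /andP[iv _]; rewrite in_setC.
  by apply/negP => /early_rest_or_nbr_pos; rewrite ltnNge iv.
- by move=> v w1 w2 vM /(earlier _ _ vM)[_ ->] /(earlier _ _ vM)[_ ->].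
- by move=> v w vM /(earlier _ _ vM)[].
- move=> v _; rewrite /target; apply/subsetP => x; rewrite in_setC in_Reg.
  by case: ifP => _; rewrite !inE; [move/eqP-> | case/andP=> _ /orP[] /eqP->].
- move=> u v uD _; rewrite /target; case: ifP => _; last by rewrite in_setD imset_f.
  by rewrite in_Reg; apply/eqP => reg_u; have := early_image_reg phiP uD; rewrite reg_u.
- move=> u v _ _; rewrite /target => neq; rewrite -setI_eq0; apply/eqP/setP => x; rewrite in_setI in_set0.
  by move: neq; case: (u \in cuts); case: (v \in cuts) => // _; rewrite !inE; case: (reg x); rewrite ?andbF.
- move=> v vM /negbTE vC; rewrite /target vC; apply: leq_trans (middle_bulk_room phiP).
  by rewrite leq_add2r; apply/subset_leq_card/subsetP => u /setIdP[].
- move=> v x vM vC; rewrite /target vC; apply: leq_trans (mid_reserve_room rooms x).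
  by rewrite leq_add2r; apply/subset_leq_card/subsetP => u; rewrite inE vC => /andP[_ /eqP].
exists psi; split=> // [u uN|v vP|v /psi_target].
- by rewrite psi_phi ?phi_place // in_setU uN.
- by rewrite psi_phi ?phi_early // in_setU vP orbT.
by rewrite /target; case: ifP => _; rewrite !inE; [move/eqP-> | case/andP=> _ /orP[] /eqP->].
Qed.

Local Notation before_late := (hub_nbrs :|: early_rest :|: middle).
Local Notation covering := (early_rest :\: absorbers :|: middle).

Lemma before_late_pos u : u \in before_late -> pos u < j.
Proof.
rewrite in_setU => /orP[/early_rest_or_nbr_pos ui|]; last by rewrite inE => /andP[].
exact: leq_trans ui (early_le_late layout).
Qed.

Lemma filler_pos q : q \in fillers -> j <= pos q.
Proof. by move/(subsetP (fillers_late layout)); rewrite inE. Qed.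

Lemma before_late_not_filler u : u \in before_late -> u \notin fillers.
Proof. by move/before_late_pos; rewrite ltnNge; apply: contra => /filler_pos. Qed.

Lemma filler_far u q : u \in before_late -> q \in fillers -> ~~ forest_edge u q.
Proof.
move=> uD qF; apply/negP; rewrite forest_edge_sym => qu.
have [] := earlier_parent qu (leq_trans (before_late_pos uD) (filler_pos qF)).
by rewrite (negbTE (scattered_notin_cuts late_scat qF (within2_refl _ _ _))).
Qed.

Definition early_middle_regions := [:: Tuples; Base; EarlyReserve; MidReserve; Bulk].

Lemma middle_image_reg phi u : middle_embedding phi -> u \in before_late ->
  reg (phi u) \in early_middle_regions.
Proof.
move=> [phi_place _ phi_early phi_mid]; rewrite !in_setU => /orP[/orP[uN|/phi_early/early_targetP->]|].
- by rewrite phi_place // reg_place.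
- by rewrite /early_region; case: ifP => // _; case: ifP.
by move/phi_mid; rewrite inE; case: (reg _).
Qed.

Lemma covered_first_preimage phi u : middle_embedding phi -> u \in before_late ->
  (phi u \in covered_first) = (u \in covering).
Proof.
move=> [phi_place _ phi_early phi_mid]; rewrite !in_setU in_setD.
case: (boolP (u \in middle)) => [/phi_mid->|uM]; first by rewrite !orbT.
rewrite !orbF => /orP[uN|uP].
  rewrite inE phi_place // reg_place //; apply/esym/negP => /andP[_ /early_rest_not_hub_nbr].
  by rewrite uN.
rewrite uP andbT inE (early_targetP (phi_early u uP)) /early_region.
by case: (u \in absorbers) => //; case: (_ || _).
Qed.

Lemma exists_filled_embedding : exists phi, [/\ {in hub_nbrs, phi =1 place},
  embeds par dep G (before_late :|: fillers) phi,
  forall v, v \in early_rest -> phi v \in early_target v,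
  covered_first \subset phi @: (covering :|: fillers) &
  forall u, u \in before_late :|: fillers -> reg (phi u) \in early_middle_regions].
Proof.
have [phi phiP] := exists_middle_embedding; have [phi_place [phi_inj phi_edge] phi_early _] := phiP.
have covering_before u : u \in covering -> u \in before_late.
  by rewrite !in_setU in_setD => /orP[/andP[_ ->]|->]; rewrite ?orbT.
pose L := covered_first :\: phi @: covering.
have card_L : #|fillers| = #|L|.
  rewrite cardsDS; last first.
    apply/subsetP => _ /imsetP[u uC ->]; rewrite (covered_first_preimage phiP) //.
    exact: covering_before.
  rewrite card_in_imset; last by move=> u v /covering_before uD /covering_before vD; apply: phi_inj.
  rewrite card_covered_first cardsU (_ : _ :&: middle = set0) ?cards0; first lia.
  apply/setP => u; rewrite in_setI in_setD in_set0; apply/negP => /andP[/andP[_ /early_rest_pos ui]].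
  by rewrite inE leqNgt ui.
have [fill fill_inj fill_L] := exists_bij_imset phi card_L.
have fill_in u : u \in fillers -> fill u \in L by move=> uF; rewrite -fill_L imset_f.
pose psi u := if u \in fillers then fill u else phi u.
have psiF u : u \in fillers -> psi u = fill u by rewrite /psi => ->.
have psiD u : u \in before_late -> psi u = phi u.
  by move/before_late_not_filler/negbTE => uF; rewrite /psi uF.
have new u w : u \in fillers -> w \in before_late -> fill u != phi w.
  move=> /fill_in/setDP[fill_cov fill_new] wD; apply: contraNneq fill_new => fill_w.
  by apply/imsetP; exists w; rewrite // -(covered_first_preimage phiP) // -fill_w.
exists psi; split.
- by move=> u uN; rewrite psiD ?phi_place // !in_setU uN.
- split=> u v; rewrite ![_ \in _ :|: fillers]in_setU => /orP[uD|uF] /orP[vD|vF].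
  + by rewrite !psiD //; apply: phi_inj.
  + by rewrite psiD // psiF // => eq_uv; have := new _ _ vF uD; rewrite eq_uv eqxx.
  + by rewrite psiF // psiD // => eq_uv; have := new _ _ uF vD; rewrite eq_uv eqxx.
  + by rewrite !psiF //; apply: fill_inj.
  + by rewrite !psiD //; apply: phi_edge.
  + by rewrite (negbTE (filler_far uD vF)).
  + by rewrite forest_edge_sym (negbTE (filler_far vD uF)).
  move=> uv; have uv_eq := scattered_eq late_scat uF vF (within2_edge uv) (within2_refl _ _ _).
  by rewrite uv_eq forest_edge_irr in uv.
- by move=> v vP; rewrite psiD ?phi_early // !in_setU vP orbT.
- apply/subsetP => x x_cov; case: (boolP (x \in phi @: covering)) => [/imsetP[u uC ->]|x_new].
    by rewrite -psiD ?covering_before // imset_f // in_setU uC.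
  have : x \in L by rewrite in_setD x_new.
  by rewrite -fill_L => /imsetP[u uF ->]; rewrite -psiF // imset_f // in_setU uF orbT.
move=> u; rewrite in_setU => /orP[uD|uF]; first by rewrite psiD // middle_image_reg.
by rewrite psiF //; case/setDP: (fill_in u uF); rewrite inE; case: (reg _).
Qed.

Definition late_attached v := (v \in cuts) || (v \in forest_nbrs fillers).
Definition late_rest := late pos j :\: fillers.
Definition late_target v := Reg (if late_attached v then LateReserve else LateBulk).

Lemma hubs_compl : before_late :|: fillers :|: late_rest = ~: hubs.
Proof.
have hub_pos u : u \in hubs -> pos u < i by move/(subsetP (hubs_early layout)); rewrite inE.
have ij := early_le_late layout.
apply/setP => u; rewrite !in_setU !in_setD in_setC !in_setU.
case: (boolP (u \in hubs)) => uI.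
  have ui := hub_pos u uI; have uj := leq_trans ui ij.
  have uN : u \notin hub_nbrs := contraL (@hub_nbr_not_hub u) uI.
  have uF : u \notin fillers by apply/negP => /filler_pos; rewrite leqNgt uj.
  have uM : u \notin middle by rewrite inE leqNgt ui.
  by rewrite (negbTE uN) (negbTE uF) (negbTE uM) [u \in late _ _]inE leqNgt uj.
case: (u \in hub_nbrs) => //=; rewrite !inE [j <= _]leqNgt [i <= _]leqNgt.
by case: (u \in fillers); rewrite ?orbT //= !orbF; case: (pos u < i); case: (pos u < j).
Qed.

Lemma late_neighbour v w : v \in late_rest ->
  earlier_nbr par dep pos late_rest (before_late :|: fillers) v w ->
  (v \in cuts /\ w = par v) \/ (w \in fillers /\ forest_edge w v).
Proof.
case/setDP; rewrite inE => vj _ /andP[vw]; rewrite in_setU => /orP[/orP[wD|wF]|/andP[_ wv]].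
- by left; apply: earlier_parent => //; apply: leq_trans (before_late_pos wD) vj.
- by right; rewrite forest_edge_sym.
by left; apply: earlier_parent.
Qed.

Lemma late_neighbour_uniq v w1 w2 : v \in late_rest ->
  earlier_nbr par dep pos late_rest (before_late :|: fillers) v w1 ->
  earlier_nbr par dep pos late_rest (before_late :|: fillers) v w2 -> w1 = w2.
Proof.
have not_cut w : w \in fillers -> forest_edge w v -> v \notin cuts.
  by move=> wF wv; apply: scattered_notin_cuts late_scat wF (within2_edge wv).
move=> vL /(late_neighbour vL) nbr1 /(late_neighbour vL) nbr2.
case: nbr1 => [[vC ->]|[w1F w1v]]; case: nbr2 => [[vC2 ->]|[w2F w2v]] //.
- by have := not_cut _ w2F w2v; rewrite vC.
- by have := not_cut _ w1F w1v; rewrite vC2.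
exact: scattered_eq late_scat w1F w2F (within2_edge w1v) (within2_edge w2v).
Qed.

Definition hubless_embedding phi := [/\ {in hub_nbrs, phi =1 place},
  embeds par dep G (~: hubs) phi,
  forall v, v \in early_rest -> phi v \in early_target v &
  covered_first \subset phi @: (~: hubs :\: absorbers)].

Lemma exists_hubless_embedding : exists phi, hubless_embedding phi.
Proof.
have [phi [phi_place phi_embeds phi_early phi_cover phi_reg]] := exists_filled_embedding.
have [||||||||psi [psi_phi psi_embeds _]] := @embeds_extend U V par dep d b beta G (Reg Tuples)
  few_children G_sym beta_gt0 G_joined cuts pos pos_pieces late_rest (before_late :|: fillers) phi
  late_target _ late_attached late_attached _ phi_embeds.
- rewrite disjoints_subset; apply/subsetP => v /setDP[]; rewrite inE => vj vF.
  by rewrite in_setC in_setU (negbTE vF) orbF; apply/negP => /before_late_pos; rewrite ltnNge vj.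
- exact: late_neighbour_uniq.
- move=> v w vL /(late_neighbour vL)[[vC _]|[wF wv]]; rewrite /late_attached ?vC //.
  by apply/orP; right; apply/forest_nbrsP; exists w.
- by move=> v _; apply/subsetP => x; rewrite !inE => /eqP->; case: (late_attached v).
- move=> u v /phi_reg; rewrite in_Reg => + _; case: (late_attached v);
    by case: (reg (phi u)).
- move=> u v _ _ neq; rewrite -setI_eq0; apply/eqP/setP => x; rewrite !inE.
  by move: neq; case: (late_attached u); case: (late_attached v) => // _; case: (reg x).
- move=> v _ /negbTE v_free; rewrite /late_target v_free; apply: leq_trans (late_bulk_room rooms).
  by rewrite leq_add2r; apply/subset_leq_card/subsetP => u /setIdP[/setDP[]].
- move=> v x _ v_att; rewrite /late_target v_att; apply: leq_trans (late_reserve_room rooms x).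
  rewrite leq_add2r; apply: (@leq_trans #|cuts :|: forest_nbrs fillers|).
    by apply/subset_leq_card/subsetP => u; rewrite in_setU => /setIdP[_ /eqP]; rewrite v_att.
  by rewrite (leq_trans (leq_card_setU _ _)) // leq_add2l card_forest_nbrs.
rewrite hubs_compl in psi_embeds.
have psi_before u : u \in before_late -> psi u = phi u by move=> uD; rewrite psi_phi // in_setU uD.
exists psi; split=> //.
- by move=> u uN; rewrite psi_before ?phi_place // !in_setU uN.
- by move=> v vP; rewrite psi_before ?phi_early // !in_setU vP orbT.
apply/subsetP => x /(subsetP phi_cover)/imsetP[u uC ->].
have u_done : u \in before_late :|: fillers.
  by move: uC; rewrite !in_setU in_setD => /orP[/orP[/andP[_ ->]|->]|->]; rewrite ?orbT.
rewrite -psi_phi // imset_f // in_setD -hubs_compl in_setU u_done andbT.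
apply/negP => uA; have ui := early_rest_pos (absorber_early_rest uA).
move: uC; rewrite !in_setU in_setD uA /= inE leqNgt ui /= => /filler_pos.
by rewrite leqNgt (leq_trans ui) // (early_le_late layout).
Qed.

Section Swap.
Variable phi : U -> V.
Hypothesis phiP : hubless_embedding phi.

Definition moved u := (u \in absorbers) && (spare u \notin phi @: (~: hubs)).
Definition swapped u := if moved u then spare u else phi u.

Lemma absorber_not_hub q : q \in absorbers -> q \in ~: hubs.
Proof. by rewrite in_setC => qA; apply/negP => qI; apply: hub_not_absorber qI qA. Qed.

Lemma swapped_hub_nbr u : u \in hub_nbrs -> swapped u = place u.
Proof.
move=> uN; case: phiP => phi_place _ _ _; rewrite /swapped /moved.
by rewrite (negbTE (hub_nbr_not_absorber uN)) phi_place.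
Qed.

Lemma moved_edge u w : moved u -> w \notin hubs -> forest_edge u w -> G (spare u) (swapped w).
Proof.
case/andP=> uA _ wI uw; case: phiP => _ _ phi_early _.
have w_nbr : w \in absorber_nbrs by apply/forest_nbrsP; exists u.
have wA := absorber_nbr_not_absorber w_nbr.
have wN : w \notin hub_nbrs.
  apply/negP => /forest_nbrsP[q qI qw].
  have qu := scattered_eq early_scat (hubs_spot qI) (absorbers_spot uA) (within2_edge qw) (within2_edge uw).
  by rewrite qu in qI; apply: hub_not_absorber qI uA.
have wP : w \in early_rest.
  rewrite in_setD in_setU negb_or wI wN inE (scattered_pos early_scat (absorbers_spot uA) uw).
  by have := subsetP (absorbers_early layout) u uA; rewrite inE.
rewrite /swapped /moved (negbTE wA); have := phi_early w wP.
by rewrite /early_target w_nbr (absorber_ofE uA uw) => /setIdP[].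
Qed.

Lemma swapped_embeds : embeds par dep G (~: hubs) swapped.
Proof.
have [_ [phi_inj phi_edge] _ _] := phiP.
split=> u v uI vI; rewrite {1}/swapped /swapped.
  case: (boolP (moved u)) => mu; case: (boolP (moved v)) => mv.
  - by case/andP: mu => uA _; case/andP: mv => vA _; apply: spare_inj.
  - by move=> spare_v; case/andP: mu => _; rewrite spare_v imset_f.
  - by move=> spare_u; case/andP: mv => _; rewrite -spare_u imset_f.
  exact: phi_inj.
move=> uv; have [uI' vI'] : u \notin hubs /\ v \notin hubs by rewrite -!in_setC.
case: (boolP (moved u)) => mu; first exact: moved_edge.
case: (boolP (moved v)) => mv; last exact: phi_edge.
have := moved_edge mv uI'; rewrite forest_edge_sym G_sym /swapped (negbTE mu); exact.
Qed.

Lemma swapped_uncovered x : x \notin swapped @: (~: hubs) -> reg x = Base.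
Proof.
have [phi_place [phi_inj _] phi_early phi_cover] := phiP.
have kept u : u \in ~: hubs -> ~~ moved u -> phi u \in swapped @: (~: hubs).
  by move=> uI /negbTE mu; apply/imsetP; exists u; rewrite // /swapped mu.
move=> x_out; apply/eqP/negPn/negP => x_reg; case/negP: x_out.
case: (boolP (x \in covered_first)) => [/(subsetP phi_cover)/imsetP[u /setDP[uI uA] ->]|x_cov].
  by apply: kept; rewrite // /moved (negbTE uA).
case: (boolP (x \in Reg Tuples)) => [|x_tup].
  rewrite -place_im => /imsetP[u uN ->]; rewrite -swapped_hub_nbr // imset_f //.
  by rewrite in_setC hub_nbr_not_hub.
have : x \in Reg LateReserve :|: Reg LateBulk.
  by move: x_cov x_tup x_reg; rewrite !inE; case: (reg x).
rewrite -spare_im => /imsetP[q qA x_q].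
case: (boolP (x \in phi @: (~: hubs))) => [/imsetP[u uI x_u]|x_free].
  rewrite x_u; apply: kept => //; apply/negP => /andP[uA _]; case/negP: x_reg.
  by rewrite x_u (early_targetP (phi_early u (absorber_early_rest uA))) /early_region uA.
apply/imsetP; exists q; first exact: absorber_not_hub.
by rewrite /swapped /moved qA -x_q x_free.
Qed.

End Swap.

Theorem hubless_tree_embedding : exists phi : U -> V, [/\ {in hub_nbrs, phi =1 place},
  embeds par dep G (~: hubs) phi & forall x, x \notin phi @: (~: hubs) -> reg x = Base].
Proof.
have [phi phiP] := exists_hubless_embedding; exists (swapped phi); split.
- by move=> u uN; apply: swapped_hub_nbr.
- exact: swapped_embeds.
by move=> x; apply: swapped_uncovered.
Qed.

End HublessEmbedding.

Local Open Scope ring_scope.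

(** * Product measures on finite functions *)

Section Expectation.
Variables (R : realFieldType) (J : finType).

Definition is_pmf (S : finType) (mu : J -> S -> R) :=
  (forall j v, 0 <= mu j v) /\ (forall j, \sum_v mu j v = 1).

Definition expect (S : finType) (mu : J -> S -> R) (F : {ffun J -> S} -> R) : R :=
  \sum_(f : {ffun J -> S}) (\prod_j mu j (f j)) * F f.

Definition prob (S : finType) (mu : J -> S -> R) (A : pred {ffun J -> S}) : R :=
  expect mu (fun f => (A f)%:R).

Definition merge (S : finType) (P : {pred J}) (f g : {ffun J -> S}) : {ffun J -> S} :=
  [ffun j => if j \in P then g j else f j].

Definition update (S : finType) (f : {ffun J -> S}) (j : J) (v : S) : {ffun J -> S} :=
  [ffun i => if i == j then v else f i].

Section OneMeasure.
Variables (S : finType) (mu : J -> S -> R).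
Implicit Types (F G X : {ffun J -> S} -> R) (A B : pred {ffun J -> S}).

Lemma eq_expect F G : F =1 G -> expect mu F = expect mu G.
Proof. by move=> FG; apply: eq_bigr => f _; rewrite FG. Qed.

Lemma eq_prob A B : A =1 B -> prob mu A = prob mu B.
Proof. by move=> AB; apply: eq_expect => f; rewrite AB. Qed.

Lemma expect_prod (g : J -> S -> R) :
  expect mu (fun f => \prod_j g j (f j)) = \prod_j \sum_v mu j v * g j v.
Proof. by rewrite bigA_distr_bigA; apply: eq_bigr => f _; rewrite -big_split. Qed.

Lemma expectD F G : expect mu (fun f => F f + G f) = expect mu F + expect mu G.
Proof. by rewrite /expect -big_split; apply: eq_bigr => f _; rewrite mulrDr. Qed.

Lemma expectZ c F : expect mu (fun f => c * F f) = c * expect mu F.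
Proof. by rewrite /expect mulr_sumr; apply: eq_bigr => f _; rewrite mulrCA. Qed.

Lemma expect_sum (I : finType) (P : pred I) (F : I -> {ffun J -> S} -> R) :
  expect mu (fun f => \sum_(i | P i) F i f) = \sum_(i | P i) expect mu (F i).
Proof. by rewrite /expect exchange_big; apply: eq_bigr => f _; rewrite mulr_sumr. Qed.

Hypothesis mu_pmf : is_pmf mu.

Lemma pmf_prod_ge0 (f : {ffun J -> S}) : 0 <= \prod_j mu j (f j).
Proof. by apply: prodr_ge0 => j _; case: mu_pmf => + _; apply. Qed.

Lemma expect_cst c : expect mu (fun => c) = c.
Proof.
rewrite /expect -mulr_suml -(bigA_distr_bigA (fun j v => mu j v)) big1 ?mul1r // => j _.
exact: mu_pmf.2.
Qed.

Lemma ler_expect F G : (forall f, F f <= G f) -> expect mu F <= expect mu G.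
Proof. by move=> FG; apply: ler_sum => f _; rewrite ler_wpM2l ?pmf_prod_ge0. Qed.

Lemma expect_ge0 F : (forall f, 0 <= F f) -> 0 <= expect mu F.
Proof. by move=> FG; rewrite -(expect_cst 0); apply: ler_expect. Qed.

Lemma prob_le A B : (forall f, A f -> B f) -> prob mu A <= prob mu B.
Proof.
by move=> AB; apply: ler_expect => f; rewrite ler_nat; case: (A f) (AB f) => // ->.
Qed.

Lemma prob_le1 A : prob mu A <= 1.
Proof. by rewrite -[leRHS](expect_cst 1); apply: ler_expect => f; rewrite lern1 leq_b1. Qed.

Lemma prob_ge0 A : 0 <= prob mu A.
Proof. exact: expect_ge0. Qed.

Lemma probC A : prob mu (predC A) = 1 - prob mu A.
Proof.
rewrite -[X in X - _](expect_cst 1) -[X in _ - X]mul1r -mulNr /prob -expectZ -expectD.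
by apply: eq_expect => f /=; case: (A f); rewrite /= ?mulr1 ?mulr0 ?subrr ?addr0.
Qed.

Lemma prob_predU_le A B : prob mu (predU A B) <= prob mu A + prob mu B.
Proof.
rewrite /prob -expectD; apply: ler_expect => f /=; rewrite -natrD ler_nat.
by case: (A f); case: (B f).
Qed.

Lemma prob_exists_le (I : finType) (P : pred I) (A : I -> pred {ffun J -> S}) :
  prob mu (fun f => [exists (i | P i), A i f]) <= \sum_(i | P i) prob mu (A i).
Proof.
rewrite /prob -expect_sum; apply: ler_expect => f; case: existsP => [[i /andP[Pi Af]]|_].
  by rewrite (bigD1 i) //= Af lerDl sumr_ge0.
by rewrite sumr_ge0.
Qed.

Lemma mergeK (P : {pred J}) (f g : {ffun J -> S}) : merge P (merge P f g) (merge P g f) = f.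
Proof. by apply/ffunP => j; rewrite !ffunE; case: (j \in P). Qed.

(* [(f, g) |-> (merge P f g, merge P g f)] is a weight-preserving involution. *)
Lemma expect_merge (P : {pred J}) F :
  expect mu F = expect mu (fun f => expect mu (fun g => F (merge P f g))).
Proof.
pose swap (fg : {ffun J -> S} * {ffun J -> S}) := (merge P fg.1 fg.2, merge P fg.2 fg.1).
have swapK : involutive swap by case=> f g; rewrite /swap /= !mergeK.
rewrite -[LHS]mulr1 -[X in _ * X](expect_cst 1) {1}/expect mulr_suml.
under eq_bigr => f _ do rewrite {1}/expect mulr_sumr.
rewrite pair_bigA /= (reindex_inj (inv_inj swapK)) /=.
rewrite /expect; under [RHS]eq_bigr => f _ do rewrite mulr_sumr.
rewrite pair_bigA /=; apply: eq_bigr => -[f g] _ /=.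
rewrite mulr1 mulrAC [RHS]mulrA; congr (_ * _).
rewrite -!big_split; apply: eq_bigr => j _ /=.
by rewrite !ffunE; case: (j \in P); rewrite // mulrC.
Qed.

Lemma expect_coord (j : J) (h : S -> R) : expect mu (fun f => h (f j)) = \sum_v mu j v * h v.
Proof.
pose g i v := if i == j then h v else 1.
rewrite (eq_expect (G := fun f => \prod_i g i (f i))) => [|f]; last first.
  rewrite (bigD1 j) //= big1 => [|i /negbTE ij]; first by rewrite /g eqxx mulr1.
  by rewrite /g ij.
rewrite expect_prod (bigD1 j) //= [X in _ * X]big1 => [|i /negbTE ij].
  by rewrite mulr1; apply: eq_bigr => v _; rewrite /g eqxx.
by rewrite /g ij; under eq_bigr do rewrite mulr1; apply: mu_pmf.2.
Qed.

Lemma expect_resample (j : J) F :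
  expect mu F = expect mu (fun f => \sum_v mu j v * F (update f j v)).
Proof.
rewrite (expect_merge (pred1 j)); apply: eq_expect => f.
rewrite -expect_coord; apply: eq_expect => g; congr F; apply/ffunP => i; rewrite !ffunE inE.
by case: eqP => // ->.
Qed.

Definition depends_off (P : {pred J}) F :=
  forall f g : {ffun J -> S}, {in predC P, f =1 g} -> F f = F g.

Lemma expect_indep (P : {pred J}) F G : depends_off P F -> depends_off (predC P) G ->
  expect mu (fun f => F f * G f) = expect mu F * expect mu G.
Proof.
move=> dF dG; rewrite (expect_merge P).
transitivity (expect mu (fun f => expect mu G * F f)); last by rewrite expectZ mulrC.
apply: eq_expect => f; rewrite [RHS]mulrC -expectZ; apply: eq_expect => g; congr (_ * _).
  by apply: dF => j jP; rewrite ffunE ifN.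
by apply: dG => j; rewrite !inE negbK => jP; rewrite ffunE ifT.
Qed.

Lemma chebyshev X : 0 < expect mu X ->
  prob mu (fun f => X f == 0) <= expect mu (fun f => X f ^+ 2) / expect mu X ^+ 2 - 1.
Proof.
set E := expect mu X => E_gt0; have E2_gt0 : 0 < E ^+ 2 by rewrite exprn_gt0.
have variance : expect mu (fun f => (X f - E) ^+ 2) = expect mu (fun f => X f ^+ 2) - E ^+ 2.
  rewrite (eq_expect (G := fun f => X f ^+ 2 + (- (E *+ 2) * X f + E ^+ 2))) => [|f].
    by rewrite !expectD expectZ expect_cst -/E mulNr mulrnAl -expr2 mulr2n opprD -!addrA addNr addr0.
  by rewrite sqrrB -addrA mulNr mulrnAl mulrC.
rewrite -(ler_pM2l E2_gt0) mulrBr mulr1 mulrCA mulfV ?gt_eqF // mulr1 -variance -expectZ.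
apply: ler_expect => f; case: eqP => [->|_]; first by rewrite mulr1 sub0r sqrrN.
by rewrite mulr0 sqr_ge0.
Qed.

End OneMeasure.

Lemma pmf_card_gt0 (S : finType) (mu : J -> S -> R) (j : J) : is_pmf mu -> (0 < #|S|)%N.
Proof.
case=> _ /(_ j); case: (posnP #|S|) => // /card0_eq S0.
by rewrite big_pred0 => [/eqP|v]; [rewrite eq_sym oner_eq0 | have := S0 v; rewrite !inE].
Qed.

Lemma sum_unread_coord (S : finType) (la : S -> R) (j : J) (h : {ffun J -> S} -> R) :
  (forall f v, h (update f j v) = h f) -> \sum_v la v = 1 ->
  #|S|%:R * (\sum_f h f * la (f j)) = \sum_f h f.
Proof.
move=> h_update la_sum.
transitivity (\sum_(f : {ffun J -> S}) \sum_v h f * la v); last first.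
  by apply: eq_bigr => f _; rewrite -mulr_sumr la_sum mulr1.
transitivity (\sum_(f : {ffun J -> S}) \sum_(v : S) h f * la (f j)).
  by rewrite mulr_sumr; apply: eq_bigr => f _; rewrite sumr_const mulr_natl.
pose swap (fv : {ffun J -> S} * S) := (update fv.1 j fv.2, fv.1 j).
have swapK : involutive swap.
  case=> f v; rewrite /swap /= ffunE eqxx; congr (_, _).
  by apply/ffunP => i; rewrite !ffunE; case: eqP => // ->.
rewrite !pair_bigA /= (reindex_inj (inv_inj swapK)) /=.
by apply: eq_bigr => -[f v] _ /=; rewrite h_update ffunE eqxx.
Qed.

Lemma expect_unread_coord (S : finType) (mu nu : J -> S -> R) (j : J) (F : {ffun J -> S} -> R) :
  is_pmf mu -> is_pmf nu -> (forall i, i != j -> mu i =1 nu i) ->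
  (forall f v, F (update f j v) = F f) -> expect mu F = expect nu F.
Proof.
move=> mu_pmf nu_pmf mu_nu F_update.
pose h (f : {ffun J -> S}) := (\prod_(i | i != j) nu i (f i)) * F f.
have h_update f v : h (update f j v) = h f.
  by rewrite /h F_update; congr (_ * _); apply: eq_bigr => i /negbTE ij; rewrite ffunE ij.
have expectE la : (forall i, i != j -> la i =1 nu i) ->
    expect la F = \sum_f h f * la j (f j).
  move=> la_nu; apply: eq_bigr => f _; rewrite (bigD1 j) //= [la j _ * _]mulrC mulrAC.
  by congr (_ * _ * _); apply: eq_bigr => i ij; rewrite la_nu.
have card_neq0 : (#|S|%:R : R) != 0 by rewrite pnatr_eq0 -lt0n (pmf_card_gt0 j mu_pmf).
apply: (mulfI card_neq0); rewrite !expectE // !sum_unread_coord //; [exact: nu_pmf.2 | exact: mu_pmf.2].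
Qed.

Lemma expect_hybrid_step (S : finType) (mu nu : J -> S -> R) (j : J) (F G : {ffun J -> S} -> R) :
  is_pmf mu -> is_pmf nu -> (forall i, i != j -> mu i =1 nu i) ->
  (forall f, \sum_v mu j v * F (update f j v) <= \sum_v nu j v * G (update f j v)) ->
  expect mu F <= expect nu G.
Proof.
move=> mu_pmf nu_pmf mu_nu step.
rewrite (expect_resample mu_pmf j) (expect_resample nu_pmf j).
rewrite -(expect_unread_coord mu_pmf nu_pmf mu_nu); first exact: ler_expect.
move=> f v; apply: eq_bigr => u _; congr (_ * G _).
by apply/ffunP => i; rewrite !ffunE; case: eqP.
Qed.

Lemma expect_mixture (S B : finType) (mu : J -> S -> R) (la : J -> B -> R)
    (nu : B -> J -> S -> R) (F : {ffun J -> S} -> R) :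
  (forall j v, mu j v = \sum_b la j b * nu b j v) ->
  expect mu F = expect la (fun b => expect (fun j => nu (b j) j) F).
Proof.
move=> mix; rewrite /expect; under [RHS]eq_bigr => b _ do rewrite mulr_sumr.
rewrite exchange_big /=; apply: eq_bigr => f _; under eq_bigr => j _ do rewrite mix.
by rewrite bigA_distr_bigA mulr_suml; apply: eq_bigr => b _; rewrite mulrA big_split.
Qed.

Lemma expect_map (S T : finType) (mu : J -> S -> R) (pi : J -> S -> T) (F : {ffun J -> T} -> R) :
  expect mu (fun f => F [ffun j => pi j (f j)]) =
  expect (fun j w => \sum_(v | pi j v == w) mu j v) F.
Proof.
rewrite /expect; under [RHS]eq_bigr => g _ do
  rewrite (bigA_distr_big_dep (fun j v => pi j v == g j)) /= mulr_suml.
rewrite [LHS](partition_big (fun f : {ffun J -> S} => [ffun j => pi j (f j)]) predT) //=.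
apply: eq_bigr => g _; apply: congr_big => // f; last by move/eqP => <-.
apply/eqP/familyP => [<- j|pi_f]; first by rewrite ffunE unfold_in eqxx.
by apply/ffunP => j; rewrite ffunE; have := pi_f j; rewrite unfold_in => /eqP.
Qed.

End Expectation.

Lemma bernoulli_le_inv (R : realFieldType) (x : R) (n : nat) :
  0 <= x -> x <= 1 -> (1 - x) ^+ n <= (1 + n%:R * x)^-1.
Proof.
move=> x_ge0 x_le1; have den_gt0 m : 0 < 1 + m%:R * x by rewrite ltr_pwDl // mulr_ge0.
rewrite -[leRHS]mul1r ler_pdivlMr //.
elim: n => [|n IH]; first by rewrite expr0 mul0r addr0 mulr1.
apply: le_trans IH; rewrite exprSr -mulrA; apply: ler_wpM2l; first by rewrite exprn_ge0 // subr_ge0.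
have : 0 <= n%:R * (x * x) by rewrite !mulr_ge0.
by rewrite -natr1; nra.
Qed.

Lemma bernoulli_ge (R : realFieldType) (x : R) (n : nat) :
  0 <= x -> x <= 1 -> 1 - n%:R * x <= (1 - x) ^+ n.
Proof.
move=> x_ge0 x_le1; elim: n => [|n IH]; first by rewrite mul0r subr0 expr0.
apply: le_trans (_ : (1 - x) * (1 - n%:R * x) <= _); last by rewrite exprS ler_wpM2l // subr_ge0.
have : 0 <= n%:R * (x * x) by rewrite !mulr_ge0.
by rewrite -natr1; nra.
Qed.

Lemma expr_ratio_ge_quarter (R : realFieldType) (a : nat) : 4^-1 <= (a%:R / a.+1%:R : R) ^+ a.
Proof.
set x : R := a.+1%:R^-1; have x_gt0 : 0 < x by rewrite invr_gt0.
have x_le1 : x <= 1 by rewrite invf_le1 // ler1n.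
have -> : a%:R / a.+1%:R = 1 - x :> R by rewrite -[a%:R](addrK 1) natr1 mulrBl divff ?mul1r ?pnatr_eq0.
have half_le : 2^-1 <= (1 - x) ^+ uphalf a.
  apply: le_trans (bernoulli_ge _ (ltW x_gt0) x_le1).
  have : ((uphalf a).*2 <= a.+1)%N by lia.
  rewrite -(ler_nat R) -muln2 natrM => /(ler_wpM2r (ltW x_gt0)).
  by rewrite [X in _ <= X]mulfV ?pnatr_eq0 //; lra.
apply: le_trans (_ : (1 - x) ^+ (uphalf a).*2 <= _).
  by rewrite -mul2n exprM exprAC expr2; nra.
by apply: ler_wiXn2l; [rewrite subr_ge0 | rewrite lerBlDr lerDl ltW | lia].
Qed.

Section Chernoff.
Variables (R : realFieldType) (J Q : finType) (D : nat).
Variables (mu : J -> bool -> R) (lam : R) (slot : Q -> 'I_D -> J).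
Hypothesis mu_pmf : is_pmf mu.
Hypothesis slot_inj : injective (fun p : Q * 'I_D => slot p.1 p.2).
Hypothesis mu_true : forall q l, mu (slot q l) true = lam.

Definition survives (b : {ffun J -> bool}) (q : Q) := [forall l, b (slot q l)].

Lemma prob_survives (q : Q) : prob mu (fun b => survives b q) = lam ^+ D.
Proof.
pose g j (v : bool) : R := if j \in codom (slot q) then v%:R else 1.
rewrite /prob (eq_expect _ (G := fun b => \prod_j g j (b j))) => [|b]; last first.
  rewrite /survives; case: (boolP [forall l, _]) => [/forallP b_true|/forallPn[l b_false]].
    by rewrite big1 // => j _; rewrite /g; case: ifP => // /codomP[l ->]; rewrite b_true.
  by rewrite (bigD1 (slot q l)) //= /g codom_f (negbTE b_false) mul0r.
rewrite expect_prod; transitivity (\prod_(j in codom (slot q)) lam).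
  rewrite [RHS]big_mkcond /=; apply: eq_bigr => j _; rewrite /g.
  case: ifP => [/codomP[l ->]|_]; first by rewrite big_bool /= mulr1 mulr0 addr0 mu_true.
  by under eq_bigr do rewrite mulr1; apply: mu_pmf.2.
rewrite prodr_const card_codom ?card_ord // => l l' slot_eq.
by have := @slot_inj (q, l) (q, l') slot_eq => -[].
Qed.

Lemma expect_prod_survives (s : {set Q}) :
  expect mu (fun b => \prod_(q in s) (if survives b q then 2^-1 else 1)) =
  (1 - lam ^+ D / 2) ^+ #|s|.
Proof.
have [n] := ubnP #|s|; elim: n s => // n IH s.
have [->|/set0Pn[q qs]] := eqVneq s set0.
  rewrite cards0 expr0 => _; rewrite -[RHS](expect_cst mu_pmf 1).
  by apply: eq_expect => b; rewrite big_set0.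
rewrite (cardsD1 q) qs ltnS => s_lt.
pose F b : R := \prod_(q' in s :\ q) (if survives b q' then 2^-1 else 1).
pose G b : R := if survives b q then 2^-1 else 1.
rewrite (eq_expect _ (G := fun b => F b * G b)) => [|b]; last by rewrite (big_setD1 q) //= mulrC.
rewrite (expect_indep mu_pmf (P := [pred j | j \in codom (slot q)])).
- rewrite IH // addnC exprD expr1; congr (_ * _).
  rewrite (eq_expect _ (G := fun b => 1 + (- 2^-1) * (survives b q)%:R)) => [|b].
    by rewrite expectD expectZ expect_cst // [expect _ _]prob_survives; lra.
  by rewrite /G; case: (survives b q); rewrite ?mulr1 ?mulr0 ?addr0 //; lra.
- move=> b b' bb; apply: eq_bigr => q'; rewrite !inE => /andP[nq _].
  suff -> : survives b q' = survives b' q' by [].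
  apply: eq_forallb => l; apply: bb; rewrite !inE; apply/codomP => -[l' slot_eq].
  by have := @slot_inj (q', l) (q, l') slot_eq => -[qq' _]; rewrite qq' eqxx in nq.
move=> b b' bb; rewrite /G; suff -> : survives b q = survives b' q by [].
by apply: eq_forallb => l; apply: bb; rewrite !inE negbK codom_f.
Qed.

Lemma chernoff (Z : nat) (s : {set Q}) : (0 < Z)%N -> Z%:R^-1 <= lam ^+ D -> lam ^+ D <= 1 ->
  prob mu (fun b => #|[set q in s | survives b q]| <= #|s| %/ (8 * Z))%N <=
  2^-1 ^+ (#|s| %/ (8 * Z)).
Proof.
move=> Z_gt0 Z_lam lam_le1; set t := (_ %/ _)%N.
have half_ge0 : (0 : R) <= 2^-1 by rewrite invr_ge0.
have base_ge0 : 0 <= 1 - lam ^+ D / 2 by lra.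
have base_le : (1 - lam ^+ D / 2) ^+ #|s| <= 4^-1 ^+ t.
  have Z_pos : (0 : R) < Z%:R by rewrite ltr0n.
  have lam_gt0 : 0 < lam ^+ D by apply: lt_le_trans Z_lam; rewrite invr_gt0.
  apply: le_trans (_ : (1 - lam ^+ D / 2) ^+ (8 * Z * t) <= _).
    by apply: ler_wiXn2l; [lra | lra | rewrite mulnC leq_divM].
  rewrite exprM; apply: lerXn2r; rewrite ?nnegrE ?exprn_ge0 //; first lra.
  apply: le_trans (bernoulli_le_inv _ _ _) _; [lra | lra|].
  rewrite lef_pV2 ?posrE //; last by rewrite natrM; nra.
  have : Z%:R * Z%:R^-1 = 1 :> R by rewrite mulfV ?gt_eqF.
  by rewrite natrM; nra.
have markov : 2^-1 ^+ t * prob mu (fun b => #|[set q in s | survives b q]| <= t)%N <= 4^-1 ^+ t.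
  apply: le_trans base_le; rewrite -expect_prod_survives -expectZ; apply: ler_expect => // b.
  have -> : \prod_(q in s) (if survives b q then 2^-1 else 1) =
      (2^-1 : R) ^+ #|[set q in s | survives b q]|.
    by rewrite -big_mkcondr /= prodr_const; congr (_ ^+ _); apply: eq_card => q; rewrite !inE.
  case: leqP => le_t; rewrite ?mulr1 ?mulr0 ?exprn_ge0 //.
  by apply: ler_wiXn2l => //; lra.
have half_pow_gt0 : (0 : R) < 2^-1 ^+ t by rewrite exprn_gt0 ?invr_gt0.
rewrite -(ler_pM2l half_pow_gt0); apply: le_trans markov _.
by rewrite -exprMn; apply: lerXn2r; rewrite ?nnegrE; lra.
Qed.

End Chernoff.

(** * Rainbow sets of coordinates *)

(* The probability that [n] independent uniform elements of a set of size [k] are distinct. *)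
Definition distinct_prob (R : realFieldType) (k n : nat) : R := \prod_(l < n) (1 - l%:R / k%:R).

Section DistinctProb.
Variables (R : realFieldType) (k : nat).
Local Notation dp := (distinct_prob R k).

Lemma distinct_prob0 : dp 0 = 1.
Proof. by rewrite /distinct_prob big_ord0. Qed.

Lemma distinct_probS n : dp n.+1 = dp n * (1 - n%:R / k%:R).
Proof. by rewrite /distinct_prob big_ord_recr. Qed.

Lemma distinct_prob_factor_gt0 l : (l < k)%N -> 0 < 1 - l%:R / k%:R :> R.
Proof.
by move=> lk; rewrite subr_gt0 ltr_pdivrMr ?ltr0n ?mul1r ?ltr_nat // (leq_ltn_trans _ lk).
Qed.

Lemma distinct_prob_gt0 n : (n <= k)%N -> 0 < dp n.
Proof.
elim: n => [|n IH] nk; first by rewrite distinct_prob0.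
by rewrite distinct_probS mulr_gt0 ?distinct_prob_factor_gt0 // IH // ltnW.
Qed.

Lemma ler_distinct_prob n p : (n <= p)%N -> (p <= k)%N -> dp p <= dp n.
Proof.
move=> /subnK <-; elim: (p - n)%N => [|j IH] jk; first by rewrite add0n.
rewrite addSn in jk *; apply: le_trans (IH (ltnW jk)).
by rewrite distinct_probS ger_pMr ?distinct_prob_gt0 1?ltnW // lerBlDr lerDl divr_ge0.
Qed.

Lemma distinct_prob_le1 n : (n <= k)%N -> dp n <= 1.
Proof. by move=> nk; rewrite -distinct_prob0 ler_distinct_prob. Qed.

Lemma distinct_prob_ge_quadratic n : (n <= k)%N -> 1 - (n ^ 2)%:R / k%:R <= dp n.
Proof.
elim: n => [|n IH] nk; first by rewrite distinct_prob0 mul0r subr0.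
have k_gt0 : (0 : R) < k%:R by rewrite ltr0n (leq_ltn_trans _ nk).
have dp_gt0 := distinct_prob_gt0 (ltnW nk).
rewrite distinct_probS.
have := IH (ltnW nk); have := distinct_prob_le1 (ltnW nk); have := distinct_prob_factor_gt0 nk.
have : 0 <= n%:R / k%:R :> R by rewrite divr_ge0.
have -> : (n.+1 ^ 2)%:R / k%:R = (n ^ 2)%:R / k%:R + 2 * (n%:R / k%:R) + k%:R^-1 :> R.
  by rewrite !natrX -natr1; field; rewrite gt_eqF.
have : 0 < k%:R^-1 :> R by rewrite invr_gt0.
by nra.
Qed.

End DistinctProb.

Lemma distinct_prob_ge_quarter (R : realFieldType) (k n : nat) :
  (n <= k)%N -> 4^-1 ^+ n <= distinct_prob R k n.
Proof.
elim: n k => [|n IH] [|k] //; rewrite ?expr0 ?distinct_prob0 // ltnS => nk.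
have -> : distinct_prob R k.+1 n.+1 = distinct_prob R k n * (k%:R / k.+1%:R) ^+ n.
  rewrite /distinct_prob big_ord_recl /= mul0r subr0 mul1r.
  rewrite -[X in _ = _ * _ ^+ X](card_ord n) -prodr_const -big_split /=.
  apply: eq_bigr => l _; have k_neq0 : k%:R != 0 :> R.
    by rewrite pnatr_eq0 -lt0n (leq_ltn_trans (leq0n l)) // (leq_trans (ltn_ord l)).
  by rewrite /bump add1n -!natr1; field; rewrite k_neq0 natr1 pnatr_eq0.
rewrite exprSr; apply: ler_pM; rewrite ?exprn_ge0 ?invr_ge0 ?IH //.
apply: le_trans (expr_ratio_ge_quarter R k) _; apply: ler_wiXn2l; rewrite ?divr_ge0 //.
by rewrite ler_pdivrMr ?ltr0n // mul1r ler_nat.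
Qed.

Section RainbowOn.
Variables (R : realFieldType) (J S : finType) (K : {set S}) (mu : J -> S -> R) (T : {set J}).
Hypothesis K_gt0 : (0 < #|K|)%N.
Hypothesis mu_pmf : is_pmf mu.
Hypothesis mu_unif : forall e v, e \in T -> v \in K -> mu e v = #|K|%:R^-1.
Implicit Types (Y Z : {set J}) (f g : {ffun J -> S}).
Local Notation dp := (distinct_prob R #|K|).

Definition rainbow_on Z f := [forall e in Z, f e \in K] && dinjectiveb f (mem Z).

Lemma rainbow_onP Z f :
  reflect ({in Z, forall e, f e \in K} /\ {in Z &, injective f}) (rainbow_on Z f).
Proof.
apply: (iffP andP) => -[inK inj]; split.
- by move=> e eZ; have /implyP := forallP inK e; apply.
- exact/dinjectiveP.
- by apply/forall_inP.
exact/dinjectiveP.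
Qed.

Lemma rainbow_onS Y Z f : Y \subset Z -> rainbow_on Z f -> rainbow_on Y f.
Proof.
move=> YZ /rainbow_onP[inK inj]; apply/rainbow_onP.
by split=> [e /(subsetP YZ)/inK|e e' eY eY'] //; apply: inj; apply: (subsetP YZ).
Qed.

Lemma rainbow_on_set0 f : rainbow_on set0 f.
Proof. by apply/rainbow_onP; split=> [e|e e']; rewrite inE. Qed.

Lemma eq_rainbow_on Y f g : {in Y, f =1 g} -> rainbow_on Y f = rainbow_on Y g.
Proof.
suff step f' g' : {in Y, f' =1 g'} -> rainbow_on Y f' -> rainbow_on Y g'.
  by move=> fg; apply/idP/idP; apply: step => // e eY; rewrite fg.
move=> fg /rainbow_onP[inK inj]; apply/rainbow_onP.
by split=> [e eY|e e' eY eY']; rewrite -!fg //; [apply: inK | apply: inj].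
Qed.

Lemma rainbow_on_update Y e f v : e \notin Y ->
  rainbow_on (e |: Y) (update f e v) = rainbow_on Y f && (v \in K :\: f @: Y).
Proof.
move=> eY; have ne y : y \in Y -> (y == e) = false by move=> yY; apply: contraTF yY => /eqP->.
have updY : {in Y, update f e v =1 f} by move=> y yY; rewrite ffunE ne.
apply/idP/andP => [rb|[/rainbow_onP[inK inj] /setDP[vK v_new]]].
  rewrite -(eq_rainbow_on updY) (rainbow_onS (subsetUr _ _) rb); case/rainbow_onP: rb => inK inj.
  split=> //; have := inK e (setU11 _ _); rewrite inE ffunE eqxx => ->; rewrite andbT.
  apply/imsetP => -[y yY v_fy]; have := inj e y (setU11 _ _) (setU1r _ yY).
  by rewrite !ffunE eqxx ne // => /(_ v_fy) e_y; rewrite e_y yY in eY.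
apply/rainbow_onP; split=> [y|y y']; rewrite !in_setU1 !ffunE.
  by case: eqP => [_ _|_ /inK].
case: eqP => [-> _|_ /= yY]; case: eqP => [-> _|_ /= yY'] //; last exact: inj.
- by move=> v_fy; case/imsetP: v_new; exists y'.
- by move=> fy_v; case/imsetP: v_new; exists y.
Qed.

Lemma expect_rainbow_step Z Y e : e \in T -> e \notin Z -> e \notin Y ->
  expect mu (fun f => (rainbow_on Z f)%:R * (rainbow_on (e |: Y) f)%:R) =
  (1 - #|Y|%:R / #|K|%:R) * expect mu (fun f => (rainbow_on Z f)%:R * (rainbow_on Y f)%:R).
Proof.
move=> eT eZ eY; rewrite (expect_resample mu_pmf e) -expectZ; apply: eq_expect => f.
have updZ v : rainbow_on Z (update f e v) = rainbow_on Z f.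
  by apply: eq_rainbow_on => y yZ; rewrite ffunE (negbTE (contraTneq _ yZ)) // => ->.
under eq_bigr => v _ do rewrite updZ rainbow_on_update //.
case: (rainbow_onP Y f) => [[inK inj]|_] /=; last by rewrite big1 ?mulr0 // => v _; rewrite !mulr0.
transitivity ((rainbow_on Z f)%:R * \sum_(v in K :\: f @: Y) mu e v).
  rewrite [X in _ * X]big_mkcond mulr_sumr; apply: eq_bigr => v _; rewrite mulrCA; congr (_ * _).
  by case: (v \in _); rewrite ?mulr1 ?mulr0.
rewrite mulrC mulr1; congr (_ * _).
rewrite (eq_bigr (fun=> #|K|%:R^-1)) => [|v /setDP[vK _]]; last exact: mu_unif.
have fY_K : f @: Y \subset K by apply/subsetP => _ /imsetP[y yY ->]; apply: inK.
have Y_le : (#|Y| <= #|K|)%N by rewrite -(card_in_imset inj) subset_leq_card.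
rewrite sumr_const cardsDS // card_in_imset // -[LHS]mulr_natl natrB // mulrBl mulfV //.
by rewrite pnatr_eq0 -lt0n.
Qed.

Lemma expect_rainbow_pair Z Y : Y \subset T -> (#|Y| <= #|K|)%N ->
  expect mu (fun f => (rainbow_on Z f)%:R * (rainbow_on Y f)%:R) * dp #|Z :&: Y| =
  prob mu (rainbow_on Z) * dp #|Y|.
Proof.
have [n] := ubnP #|Y :\: Z|; elim: n Y => // n IH Y.
have [/eqP YZ _ _ _|/set0Pn[e]] := eqVneq (Y :\: Z) set0.
  rewrite setD_eq0 in YZ; rewrite (setIidPr YZ); congr (_ * _); apply: eq_expect => f.
  by case: (boolP (rainbow_on Z f)); rewrite ?mul0r // mul1r => /(rainbow_onS YZ)->.
rewrite inE => /andP[eZ eY] Yn YT Yk.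
have card_Y : #|Y| = #|Y :\ e|.+1 by rewrite (cardsD1 e) eY.
have ZIY : Z :&: Y = Z :&: (Y :\ e).
  by apply/setP => y; rewrite !inE; case: (eqVneq y e) => [->|]; rewrite ?(negbTE eZ).
rewrite card_Y distinct_probS mulrA -IH.
- by rewrite ZIY -{1}(setD1K eY) expect_rainbow_step ?(subsetP YT) ?setD11 // [RHS]mulrC mulrA.
- rewrite -ltnS; apply: leq_trans Yn; rewrite ltnS; apply: proper_card.
  apply/properP; split; first by apply/setSD/subD1set.
  by exists e; rewrite !inE ?eqxx ?eZ ?eY.
- exact: subset_trans (subD1set _ _) YT.
by rewrite card_Y in Yk; apply: ltnW.
Qed.

Lemma prob_rainbow_on Y : Y \subset T -> (#|Y| <= #|K|)%N -> prob mu (rainbow_on Y) = dp #|Y|.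
Proof.
move=> YT Yk; have := @expect_rainbow_pair set0 Y YT Yk.
rewrite set0I cards0 distinct_prob0 mulr1 (eq_prob _ (B := predT)) => [|f]; last exact: rainbow_on_set0.
rewrite [prob _ predT]expect_cst // mul1r => <-; apply: eq_expect => f.
by rewrite rainbow_on_set0 mul1r.
Qed.

End RainbowOn.

Section Asymptotics.
Variable R : realType.
Implicit Types (eps x : R).

Lemma inv_small eps : 0 < eps -> exists N : nat, forall n, (N <= n)%N -> n.+1%:R^-1 <= eps.
Proof.
move=> eps_gt0; exists (Num.truncn eps^-1) => n n_ge.
rewrite -[leRHS]invrK lef_pV2 ?posrE ?invr_gt0 ?ltr0n //.
by apply: le_trans (ltW (truncnS_gt _)) _; rewrite ler_nat.
Qed.

Lemma half_pow_small eps : 0 < eps ->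
  exists N : nat, forall n, (N <= n)%N -> (2^-1 : R) ^+ n <= eps.
Proof.
move=> eps_gt0; have half_lt1 : `|2^-1 : R| < 1 by rewrite ger0_norm; lra.
have /cvgrPdist_le/(_ _ eps_gt0)[N _ N_small] := cvg_expr half_lt1.
by exists N => n /N_small /=; rewrite sub0r normrN; apply/le_trans/ler_norm.
Qed.

Lemma natr_half_pow_le (t : nat) : t.+1%:R * (2^-1 : R) ^+ t <= 4 * (2^-1) ^+ (t %/ 2).
Proof.
have t_le : (t.+1 * 2 ^ (t %/ 2) <= 4 * 2 ^ t)%N.
  have := ltn_expl (t %/ 2) (ltnSn 1); have := @leq_pexp2l 2 (t %/ 2 + t %/ 2) t isT.
  by rewrite expnD; move: (2 ^ t)%N (2 ^ (t %/ 2))%N => a c; move: (divn_eq t 2); nia.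
rewrite !exprVn ler_pdivrMr ?exprn_gt0 // mulrAC ler_pdivlMr ?exprn_gt0 //.
by rewrite -!natrX -!natrM ler_nat.
Qed.

Lemma lin_half_pow_small (a : nat) eps : (0 < a)%N -> 0 < eps ->
  exists N : nat, forall n, (N <= n)%N -> n%:R * (2^-1 : R) ^+ (n %/ a) <= eps.
Proof.
move=> a_gt0 eps_gt0; have a4_gt0 : (0 : R) < 4 * a%:R by rewrite mulr_gt0 ?ltr0n.
have [N N_small] := half_pow_small (divr_gt0 eps_gt0 a4_gt0).
exists (2 * N * a)%N => n n_ge; set t := (n %/ a)%N.
have n_le : n%:R <= a%:R * t.+1%:R :> R by rewrite -natrM ler_nat mulnC ltnW // ltn_ceil.
have half_ge0 : (0 : R) <= 2^-1 ^+ t by rewrite exprn_ge0 ?invr_ge0.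
apply: le_trans (ler_wpM2r half_ge0 n_le) _; rewrite -mulrA.
apply: le_trans (ler_wpM2l (ler0n _ _) (natr_half_pow_le t)) _; rewrite mulrCA mulrA.
have Nt : (N <= t %/ 2)%N by rewrite leq_divRL // mulnC leq_divRL.
by have := N_small _ Nt; rewrite ler_pdivlMr // mulrC.
Qed.

Lemma exp_quad_small (a : nat) eps : (0 < a)%N -> 0 < eps ->
  exists N : nat, forall n, (N <= n)%N -> (4 : R) ^+ n * 2^-1 ^+ (n ^ 2 %/ a) <= eps.
Proof.
move=> a_gt0 eps_gt0; have [N N_small] := half_pow_small eps_gt0.
exists (N + 3 * a)%N => n n_ge.
have n3 : (3 * n <= n ^ 2 %/ a)%N by rewrite leq_divRL //; nia.
apply: le_trans (N_small n _); last lia.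
apply: le_trans (_ : (4 : R) ^+ n * 2^-1 ^+ (3 * n) <= _).
  by apply: ler_wpM2l; rewrite ?exprn_ge0 //; apply: ler_wiXn2l; lra || lia.
by rewrite exprM -exprMn; apply: lerXn2r; rewrite ?nnegrE; lra.
Qed.

Lemma exp_series_tail x eps : 0 < eps ->
  exists L : nat, forall n, \sum_(L.+1 <= j < n) x ^+ j / j`!%:R <= eps.
Proof.
move=> eps_gt0; have cvg_exp := @is_cvg_series_exp_coeff _ x.
have /cvg_cauchy/cauchy_seriesP/(_ _ eps_gt0) := cvg_exp.
case=> -[A B] /= [[M _ A_M] [N _ B_N]] tail_lt.
exists (maxn M N) => n; have [n_le|n_gt] := leqP n (maxn M N).+1.
  by rewrite big_geq // ltW.
have A_max : A (maxn M N).+1 by apply: A_M => /=; lia.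
have B_n : B n by apply: B_N => /=; lia.
have := tail_lt (_, _) (conj A_max B_n).
by move/ltW; apply/le_trans/ler_norm.
Qed.

End Asymptotics.

(** * Rainbow perfect matchings by the second moment method *)

Lemma inv_distinct_prob_small (R : realType) (n : nat) (eps : R) : 0 < eps ->
  exists N : nat, forall k, (N <= k)%N -> (n <= k)%N /\ (distinct_prob R k n)^-1 - 1 <= eps.
Proof.
move=> eps_gt0; pose a : R := (n ^ 2).+1%:R; have a_gt0 : 0 < a by rewrite ltr0n.
have [|N N_small] := @inv_small R (Num.min 2^-1 (eps / 2) / a).
  by rewrite divr_gt0 // lt_min; apply/andP; split; lra.
exists (N.+1 + n)%N => k k_ge; have nk : (n <= k)%N by lia.
split=> //; have k_gt0 : (0 : R) < k%:R by rewrite ltr0n; lia.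
pose x : R := (n ^ 2)%:R / k%:R; have x_ge0 : 0 <= x by rewrite divr_ge0.
have x_le : x <= Num.min 2^-1 (eps / 2).
  have := N_small k.-1 ltac:(lia); rewrite prednK; last lia.
  rewrite ler_pdivlMr // mulrC; apply: le_trans; rewrite ler_wpM2r ?invr_ge0 ?(ltW k_gt0) //.
  by rewrite ler_nat.
have [x_half x_eps] : x <= 2^-1 /\ x <= eps / 2.
  by split; apply: le_trans x_le _; rewrite ge_min lexx ?orbT.
have dp_ge := distinct_prob_ge_quadratic R nk; have dp_gt0 := distinct_prob_gt0 R nk.
rewrite lerBlDr -[leLHS]mul1r ler_pdivrMr //.
by move: x_half x_eps dp_ge dp_gt0 x_ge0; rewrite -/x; move: (distinct_prob _ _ _) => y; nra.
Qed.

Definition matching_slots (J V : finType) (D : nat) (slot : V * V -> 'I_D -> J)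
    (t : {perm V}) : {set J} :=
  [set slot (p.1, t p.1) p.2 | p : V * 'I_D].

Section SecondMoment.
Variables (R : realType) (J S V : finType) (K : {set S}) (mu : J -> S -> R) (T : {set J}).
Variables (D c : nat) (E : rel V) (slot : V * V -> 'I_D -> J).
Hypothesis mu_pmf : is_pmf mu.
Hypothesis mu_unif : forall e v, e \in T -> v \in K -> mu e v = #|K|%:R^-1.
Hypothesis slot_inj : injective (fun p : (V * V) * 'I_D => slot p.1 p.2).
Hypothesis slot_T : forall x y l, E x y -> slot (x, y) l \in T.
Hypothesis card_K : #|K| = (#|V| * D)%N.
Hypothesis D_gt0 : (0 < D)%N.
Hypothesis c_gt0 : (0 < c)%N.
Hypothesis V_large : (64 * c <= #|V|)%N.
Hypothesis many_cycles : forall t w, (#|V| ^ 4 <= c * #|alternating_cycles E 4 t w|)%N.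
Local Notation PM := (perfect_matchings E).
Local Notation slots := (matching_slots slot).
Local Notation dp := (distinct_prob R #|K|).

Let V_gt0 : (0 < #|V|)%N.
Proof. by move: V_large c_gt0; lia. Qed.

Let K_gt0 : (0 < #|K|)%N.
Proof. by rewrite card_K muln_gt0 V_gt0. Qed.

Lemma card_matching_slots t : #|slots t| = #|K|.
Proof.
rewrite card_imset ?cardsT ?card_prod ?card_ord ?card_K // => -[x l] [y l'] /= slot_eq.
by have := @slot_inj ((x, t x), l) ((y, t y), l') slot_eq => -[-> _ ->].
Qed.

Lemma card_matching_slotsI t u : #|slots t :&: slots u| = (n_agree t u * D)%N.
Proof.
pose agree := [set x | t x == u x].
have -> : slots t :&: slots u = [set slot (p.1, t p.1) p.2 | p in setX agree [set: 'I_D]].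
  apply/setP => e; rewrite inE; apply/andP/imsetP => [[/imsetP[[x l] _ ->]]|].
    case/imsetP=> -[y l'] _ /= slot_eq.
    have := @slot_inj ((x, t x), l) ((y, u y), l') slot_eq => -[xy tu _].
    by exists (x, l); rewrite // !inE /= tu -xy eqxx.
  case=> -[x l]; rewrite !inE /= andbT => /eqP tu ->.
  by split; apply/imsetP; exists (x, l); rewrite //= tu.
rewrite card_in_imset ?cardsX ?cardsT ?card_ord // => -[x l] [y l'] _ _ /= slot_eq.
by have := @slot_inj ((x, t x), l) ((y, t y), l') slot_eq => -[-> _ ->].
Qed.

Lemma n_agree_le (t u : {perm V}) : (n_agree t u <= #|V|)%N.
Proof. exact: max_card. Qed.

Lemma matching_slots_sub t : t \in PM -> slots t \subset T.
Proof.
rewrite inE => /forallP t_edges; apply/subsetP => _ /imsetP[[x l] _ ->] /=; exact: slot_T.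
Qed.

Definition rainbow_count (f : {ffun J -> S}) : R := \sum_(t in PM) (rainbow_on K (slots t) f)%:R.

Lemma expect_rainbow_count : expect mu rainbow_count = #|PM|%:R * dp #|K|.
Proof.
rewrite expect_sum (eq_bigr (fun=> dp #|K|)) => [|t tP]; first by rewrite sumr_const mulr_natl.
rewrite [expect _ _](prob_rainbow_on K_gt0 mu_pmf mu_unif) ?card_matching_slots //.
exact: matching_slots_sub.
Qed.

(* The ratio between the probability that two matchings agreeing in [j] places are both rainbow
   and the product of the individual probabilities. *)
Definition correlation (j : nat) : R := (dp (j * D))^-1.

Lemma slots_le j : (j <= #|V|)%N -> (j * D <= #|K|)%N.
Proof. by move=> jV; rewrite card_K leq_mul2r jV orbT. Qed.

Lemma expect_rainbow_count_sqr : expect mu (fun f => rainbow_count f ^+ 2) =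
  dp #|K| ^+ 2 * \sum_(t in PM) \sum_(u in PM) correlation (n_agree t u).
Proof.
rewrite (eq_expect _ (G := fun f => \sum_(t in PM) \sum_(u in PM)
    (rainbow_on K (slots t) f)%:R * (rainbow_on K (slots u) f)%:R)) => [|f]; last first.
  by rewrite expr2 /rainbow_count mulr_suml; apply: eq_bigr => t _; rewrite mulr_sumr.
rewrite expect_sum mulr_sumr; apply: eq_bigr => t tP.
rewrite expect_sum mulr_sumr; apply: eq_bigr => u uP.
have dp_gt0 : 0 < dp (n_agree t u * D) by rewrite distinct_prob_gt0 ?slots_le ?n_agree_le.
apply: (mulIf (lt0r_neq0 dp_gt0)); rewrite /correlation divfK ?gt_eqF //.
rewrite -card_matching_slotsI (expect_rainbow_pair K_gt0 mu_pmf mu_unif) ?card_matching_slots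
  ?matching_slots_sub //.
by rewrite (prob_rainbow_on K_gt0 mu_pmf mu_unif) ?card_matching_slots ?matching_slots_sub.
Qed.

Let overlap := (#|V| %/ (16 * c))%N.

Let overlap_facts : [/\ (overlap <= #|V|)%N, (#|V| <= 32 * c * overlap)%N &
  (2 * c * (4 * (overlap.+1 + 3)) <= #|V|)%N].
Proof.
have lower : (16 * c * overlap <= #|V|)%N by rewrite mulnC leq_divM.
have upper : (#|V| < 16 * c * overlap.+1)%N by rewrite mulnC; apply: ltn_ceil; lia.
by move: lower upper V_large c_gt0; move: overlap #|V| => o s; split; nia.
Qed.

Let PM_gt0 : (0 < #|PM|)%N.
Proof.
apply: (perfect_matchings_gt0 many_cycles) => //; rewrite /few_fixed cards0.
by move: V_large; lia.
Qed.

Local Notation base := ((4 ^ (D * (32 * c)))%N%:R : R).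

Lemma correlation_le_pow (L i j : nat) : (i <= j)%N -> (j <= #|V|)%N -> (j <= 32 * c * i)%N ->
  (L < i <= overlap)%N ->
  correlation j <= \sum_(L.+1 <= l < overlap.+1) base ^+ l * (l <= j)%N%:R.
Proof.
move=> ij jV j_le /andP[Li io]; have jK := slots_le jV.
apply: le_trans (_ : base ^+ i <= _); last first.
  rewrite (bigD1_seq i) ?iota_uniq //=; last by rewrite mem_index_iota Li ltnS.
  by rewrite ij mulr1 lerDl; apply: sumr_ge0 => l _; rewrite mulr_ge0 ?exprn_ge0.
rewrite natrX -exprM; apply: le_trans (_ : 4 ^+ (j * D) <= _).
  rewrite /correlation -[leRHS]invrK lef_pV2 ?posrE ?distinct_prob_gt0 ?invr_gt0 ?exprn_gt0 //.
  by rewrite -exprVn distinct_prob_ge_quarter.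
by apply: ler_weXn2l; [lra | rewrite [X in (X <= _)%N]mulnC -mulnA leq_mul2l j_le orbT].
Qed.

Lemma correlation_le (L j : nat) : (L < overlap)%N -> (j <= #|V|)%N ->
  correlation j - 1 <= correlation L - 1 +
    \sum_(L.+1 <= l < overlap.+1) base ^+ l * (l <= j)%N%:R.
Proof.
move=> Lo jV; have [oV V_le _] := overlap_facts.
have LV := leq_trans (ltnW Lo) oV; have LK := slots_le LV.
set total := \sum_(_ <= _ < _) _; have total_ge0 : 0 <= total.
  by apply: sumr_ge0 => l _; rewrite mulr_ge0 ?exprn_ge0.
have corr_ge1 : 1 <= correlation L by rewrite invf_ge1 ?distinct_prob_le1 ?distinct_prob_gt0.
have [jL|Lj] := leqP j L.
  suff : correlation j <= correlation L by lra.
  rewrite lef_pV2 ?posrE ?distinct_prob_gt0 ?slots_le //.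
  by rewrite ler_distinct_prob // leq_mul2r jL orbT.
suff : correlation j <= total by lra.
have [jo|oj] := leqP j overlap.
  by apply: (@correlation_le_pow L j); rewrite ?Lj ?leq_pmull ?muln_gt0 ?c_gt0.
apply: (@correlation_le_pow L overlap); rewrite ?leqnn ?andbT ?(ltnW oj) //.
exact: leq_trans V_le.
Qed.

Lemma sum_correlation_le (L : nat) t : (L < overlap)%N ->
  \sum_(u in PM) (correlation (n_agree t u) - 1) <= #|PM|%:R * (correlation L - 1 +
    \sum_(L.+1 <= j < overlap.+1) (2 * c%:R * base) ^+ j / j`!%:R).
Proof.
move=> Lo; have [_ _ few] := overlap_facts.
apply: le_trans (ler_sum _ (fun u _ => correlation_le Lo (n_agree_le t u))) _.
rewrite big_split /= sumr_const mulrDr mulr_natl lerD2l.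
rewrite exchange_big /= mulr_sumr !big_nat; apply: ler_sum => j /andP[_ jo].
have -> : \sum_(u in PM) base ^+ j * (j <= n_agree t u)%N%:R =
    base ^+ j * #|[set u in PM | (j <= n_agree t u)%N]|%:R.
  rewrite -mulr_sumr -sum1_card natr_sum; congr (_ * _).
  rewrite [RHS](eq_bigl (fun u => (u \in PM) && (j <= n_agree t u)%N)) => [|u]; last by rewrite inE.
  by rewrite [RHS]big_mkcondr /=; apply: eq_bigr => u _; case: leqP.
have fact_gt0' : (0 : R) < j`!%:R by rewrite ltr0n fact_gt0.
have base_ge0 : 0 <= base ^+ j by rewrite exprn_ge0.
have few_j : (2 * c * (4 * (j.+1 + 3)) <= #|V|)%N.
  by apply: leq_trans few; rewrite leq_mul2l leq_mul2l leq_add2r jo !orbT.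
have := card_n_agree_ge many_cycles t V_gt0 few_j.
rewrite -(ler_nat R) !natrM natrX natrM -ler_pdivlMr // => /(ler_wpM2l base_ge0)/le_trans.
apply; rewrite !exprMn le_eqVlt; apply/orP; left; apply/eqP; move: (base ^+ j) => z; ring.
Qed.

Lemma prob_no_rainbow_matching (L : nat) : (L < overlap)%N ->
  prob mu (fun f => ~~ [exists t in PM, rainbow_on K (slots t) f]) <=
  correlation L - 1 + \sum_(L.+1 <= j < overlap.+1) (2 * c%:R * base) ^+ j / j`!%:R.
Proof.
move=> Lo; have PM_pos : (0 : R) < #|PM|%:R by rewrite ltr0n.
have dp_gt0 : 0 < dp #|K| by rewrite distinct_prob_gt0.
have mean_gt0 : 0 < expect mu rainbow_count by rewrite expect_rainbow_count mulr_gt0.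
apply: le_trans (_ : prob mu (fun f => rainbow_count f == 0) <= _).
  apply: prob_le => // f /exists_inPn none; rewrite /rainbow_count big1 // => t tP.
  by rewrite (negbTE (none t tP)).
apply: le_trans (chebyshev mu_pmf mean_gt0) _.
rewrite expect_rainbow_count_sqr expect_rainbow_count.
have -> : \sum_(t in PM) \sum_(u in PM) correlation (n_agree t u) =
    \sum_(t in PM) \sum_(u in PM) (correlation (n_agree t u) - 1) + #|PM|%:R ^+ 2.
  have -> : #|PM|%:R ^+ 2 = \sum_(t in PM) \sum_(u in PM) 1 :> R.
    by rewrite !sumr_const -[RHS]mulr_natl expr2.
  rewrite -big_split; apply: eq_bigr => t _; rewrite -big_split.
  by apply: eq_bigr => u _ /=; rewrite subrK.
set total := \sum_(t in PM) _; set bound := (X in _ <= X).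
have : total <= #|PM|%:R * bound *+ #|PM|.
  by rewrite -sumr_const; apply: ler_sum => t _; apply: sum_correlation_le.
rewrite -mulr_natl mulrA -expr2 mulrC -ler_pdivrMr ?exprn_gt0 //; apply: le_trans.
by rewrite le_eqVlt; apply/orP; left; apply/eqP; field; rewrite !gt_eqF.
Qed.

End SecondMoment.

(** * Exposing which coordinates take a colour in a given set *)

Section Exposure.
Variables (R : realFieldType) (J S : finType) (K : {set S}) (T : {set J}) (mu : J -> S -> R).
Variable m : nat.
Hypothesis mu_pmf : is_pmf mu.
Hypothesis K_gt0 : (0 < #|K|)%N.
Hypothesis K_lt : (#|K| < m)%N.
Hypothesis mu_unif : forall e v, e \in T -> v \in K -> mu e v = m%:R^-1.

Definition hit_prob : R := #|K|%:R / m%:R.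

Definition hit_pmf (j : J) (b : bool) : R := if b then hit_prob else 1 - hit_prob.

(* The law of a coordinate in [T] given whether its colour is in [K]. *)
Definition exposed_pmf (b : bool) (j : J) (v : S) : R :=
  if j \in T then
    if b then (v \in K)%:R / #|K|%:R else (v \notin K)%:R * mu j v / (1 - hit_prob)
  else mu j v.

Let m_gt0 : (0 : R) < m%:R.
Proof. by rewrite ltr0n (leq_ltn_trans _ K_lt). Qed.

Let K_pos : (0 : R) < #|K|%:R.
Proof. by rewrite ltr0n. Qed.

Lemma hit_prob_gt0 : 0 < hit_prob.
Proof. by rewrite divr_gt0. Qed.

Lemma hit_prob_lt1 : hit_prob < 1.
Proof. by rewrite ltr_pdivrMr // mul1r ltr_nat. Qed.

Lemma hit_pmf_pmf : is_pmf hit_pmf.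
Proof.
split=> [j []|j]; rewrite /hit_pmf.
- exact: ltW hit_prob_gt0.
- by rewrite subr_ge0 ltW // hit_prob_lt1.
by rewrite big_bool /= addrC subrK.
Qed.

Lemma sum_missed j : j \in T -> \sum_v (v \notin K)%:R * mu j v = 1 - hit_prob.
Proof.
move=> jT; have hit : \sum_(v in K) mu j v = hit_prob.
  rewrite (eq_bigr (fun=> m%:R^-1)) => [|v]; last exact: mu_unif.
  by rewrite sumr_const -[LHS]mulr_natl.
transitivity (\sum_(v | v \notin K) mu j v).
  by rewrite [RHS]big_mkcond; apply: eq_bigr => v _; case: (v \in K); rewrite ?mul0r ?mul1r.
by have := mu_pmf.2 j; rewrite (bigID (mem K)) /= hit; lra.
Qed.

Lemma exposed_pmf_pmf (b : {ffun J -> bool}) : is_pmf (fun j => exposed_pmf (b j) j).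
Proof.
have [mu_ge0 mu_sum] := mu_pmf; have miss_gt0 : 0 < 1 - hit_prob by rewrite subr_gt0 hit_prob_lt1.
split=> [j v|j]; rewrite /exposed_pmf.
  case: (j \in T) => //; case: (b j); rewrite divr_ge0 ?(ltW miss_gt0) //.
  by rewrite mulr_ge0.
case: (boolP (j \in T)) => // jT; case: (b j); rewrite -mulr_suml; last first.
  by rewrite sum_missed // mulfV ?gt_eqF.
rewrite -natr_sum (eq_bigr (fun v => if v \in K then 1%N else 0%N)) => [|v _]; last by case: (v \in K).
by rewrite -big_mkcond sum1_card mulfV ?gt_eqF.
Qed.

Lemma exposed_mixture j v : mu j v = \sum_b hit_pmf j b * exposed_pmf b j v.
Proof.
have miss_neq0 : 1 - hit_prob != 0 by rewrite gt_eqF // subr_gt0 hit_prob_lt1.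
rewrite big_bool /= /exposed_pmf /hit_pmf; case: (boolP (j \in T)) => jT; last first.
  by rewrite -mulrDl addrC subrK mul1r.
case: (boolP (v \in K)) => vK /=.
  by rewrite !mul0r mulr0 addr0 mul1r mu_unif // /hit_prob; field; rewrite !gt_eqF.
by rewrite mul0r mulr0 add0r mul1r mulrCA mulfV ?mulr1.
Qed.

Lemma exposed_pmf_hit (b : {ffun J -> bool}) e v :
  e \in [set e in T | b e] -> v \in K -> exposed_pmf (b e) e v = #|K|%:R^-1.
Proof. by rewrite inE /exposed_pmf => /andP[-> ->] ->; rewrite mul1r. Qed.

Lemma hit_prob_expn_ge (Lm s D : nat) : (0 < Lm)%N -> (0 < D)%N -> #|K| = (s * D)%N ->
  (m <= Lm * s)%N -> (Lm ^ D)%:R^-1 <= hit_prob ^+ D.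
Proof.
move=> Lm_gt0 D_gt0 card_K m_le; rewrite natrX -exprVn.
apply: lerXn2r; rewrite ?nnegrE ?invr_ge0 ?divr_ge0 //.
rewrite ler_pdivlMr // mulrC ler_pdivrMr ?ltr0n // -natrM ler_nat card_K.
by apply: leq_trans m_le _; rewrite mulnC leq_mul2r leq_pmulr ?orbT.
Qed.

Lemma prob_le_exposed (A : pred {ffun J -> S}) (bad : pred {ffun J -> bool}) (e1 e2 : R) :
  0 <= e2 -> prob hit_pmf bad <= e1 ->
  (forall b : {ffun J -> bool}, ~~ bad b -> prob (fun j => exposed_pmf (b j) j) A <= e2) ->
  prob mu A <= e1 + e2.
Proof.
move=> e2_ge0 bad_le A_le; rewrite /prob (expect_mixture _ exposed_mixture).
apply: le_trans (_ : expect hit_pmf (fun b => (bad b)%:R + e2) <= _); last first.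
  by rewrite expectD expect_cst ?lerD2r //; apply: hit_pmf_pmf.
apply: ler_expect; first exact: hit_pmf_pmf.
move=> b; case: (boolP (bad b)) => [_|/A_le]; last by rewrite add0r.
by apply: le_trans (prob_le1 (exposed_pmf_pmf b) _) _; rewrite lerDl.
Qed.

End Exposure.

Definition pairs_in (X Y : finType) (r : X -> Y -> bool) (A : {set X}) (B : {set Y}) :
    {set X * Y} :=
  [set p | [&& p.1 \in A, p.2 \in B & r p.1 p.2]].

Lemma card_pairs_in (X Y : finType) (r : X -> Y -> bool) (A : {set X}) (B : {set Y}) :
  #|pairs_in r A B| = nedges r A B.
Proof.
rewrite nedgesE pair_big_dep /= -sum1_card big_mkcond [RHS]big_mkcond /=.
by apply: eq_bigr => -[x y] _; rewrite inE /=; case: (x \in A); case: (y \in B); case: (r x y).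
Qed.

Section Sampling.
Variables (R : realFieldType) (J V : finType) (D Z L c : nat) (comp : rel V).
Variables (mu : J -> bool -> R) (lam : R) (slot : V * V -> 'I_D -> J).
Hypothesis mu_pmf : is_pmf mu.
Hypothesis slot_inj : injective (fun p : (V * V) * 'I_D => slot p.1 p.2).
Hypothesis mu_true : forall q l, mu (slot q l) true = lam.
Hypothesis Z_gt0 : (0 < Z)%N.
Hypothesis Z_lam : Z%:R^-1 <= lam ^+ D.
Hypothesis lam_le1 : lam ^+ D <= 1.
Hypothesis comp_row : forall x, (#|V| <= L * deg_in comp [set: V] x)%N.
Hypothesis comp_col : forall y, (#|V| <= L * deg_in (transpose comp) [set: V] y)%N.
Hypothesis L_gt0 : (0 < L)%N.
Hypothesis c_gt0 : (0 < c)%N.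

Definition sampled (b : {ffun J -> bool}) : rel V := fun x y => comp x y && survives slot b (x, y).

Definition undersampled (A B : {set V}) (b : {ffun J -> bool}) : bool :=
  (#|pairs_in (sampled b) A B| <= #|pairs_in comp A B| %/ (8 * Z))%N.

Definition dense (AB : {set V} * {set V}) : bool := (#|V| ^ 2 <= c * nedges comp AB.1 AB.2)%N.

Definition sparse_sample (b : {ffun J -> bool}) : bool :=
  [|| [exists x, undersampled [set x] [set: V] b], [exists y, undersampled [set: V] [set y] b] |
    [exists (AB | dense AB), undersampled AB.1 AB.2 b]].

Lemma nedges_set1r y : nedges comp [set: V] [set y] = deg_in (transpose comp) [set: V] y.
Proof. by rewrite nedgesC /nedges big_set1. Qed.

Lemma undersampledPn A B b : ~~ undersampled A B b ->
  (nedges comp A B <= 8 * Z * nedges (sampled b) A B)%N.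
Proof.
by rewrite /undersampled -ltnNge ltn_divLR ?muln_gt0 // !card_pairs_in mulnC => /ltnW.
Qed.

Lemma retains_sampled b : ~~ sparse_sample b -> retains (8 * Z) c comp (sampled b).
Proof.
rewrite !negb_or => /and3P[/existsPn row /existsPn col /existsPn dense_ok]; split.
- by move=> x; have := undersampledPn (row x); rewrite /nedges !big_set1.
- by move=> y; have := undersampledPn (col y); rewrite nedgesC [in X in (_ <= X)%N]nedgesC /nedges !big_set1.
move=> A B AB_dense; apply: undersampledPn.
by have := dense_ok (A, B); rewrite negb_and [dense _]AB_dense.
Qed.

Lemma pairs_in_sampled A B b :
  pairs_in (sampled b) A B = [set q in pairs_in comp A B | survives slot b q].
Proof. by apply/setP => -[x y]; rewrite !inE /sampled /= !andbA. Qed.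

Lemma prob_undersampled_le A B a n : (0 < a)%N -> (n <= a * nedges comp A B)%N ->
  prob mu (undersampled A B) <= 2^-1 ^+ (n %/ (a * (8 * Z))).
Proof.
move=> a_gt0 n_le; apply: le_trans (_ : 2^-1 ^+ (#|pairs_in comp A B| %/ (8 * Z)) <= _).
  apply: le_trans _ (chernoff mu_pmf slot_inj mu_true (pairs_in comp A B) Z_gt0 Z_lam lam_le1).
  by apply: prob_le => // b; rewrite /undersampled pairs_in_sampled.
apply: ler_wiXn2l; rewrite ?invr_ge0 ?invf_le1 ?ler1n ?ltr0n //.
by rewrite card_pairs_in -(@divnMl a (nedges _ _ _)) // leq_div2r.
Qed.

Lemma prob_sparse_sample_le : prob mu sparse_sample <=
  #|V|%:R * 2^-1 ^+ (#|V| %/ (L * (8 * Z))) + (#|V|%:R * 2^-1 ^+ (#|V| %/ (L * (8 * Z))) +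
    4 ^+ #|V| * 2^-1 ^+ (#|V| ^ 2 %/ (c * (8 * Z)))).
Proof.
have half_ge0 k : (0 : R) <= 2^-1 ^+ k by rewrite exprn_ge0 ?invr_ge0.
have bound_sum (I : finType) (P : pred I) k (F : I -> pred {ffun J -> bool}) :
    (forall i, P i -> prob mu (F i) <= 2^-1 ^+ k) ->
    prob mu (fun b => [exists (i | P i), F i b]) <= #|I|%:R * 2^-1 ^+ k.
  move=> F_le; apply: le_trans (prob_exists_le mu_pmf _ _) _.
  apply: le_trans (ler_sum _ F_le) _; rewrite sumr_const -[leLHS]mulr_natl ler_wpM2r // ler_nat.
  exact: max_card.
pose row_bad b := [exists x, undersampled [set x] [set: V] b].
pose col_bad b := [exists y, undersampled [set: V] [set y] b].
pose pair_bad b := [exists (AB | dense AB), undersampled AB.1 AB.2 b].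
rewrite -[prob mu _]/(prob mu (predU row_bad (predU col_bad pair_bad))).
apply: le_trans (prob_predU_le mu_pmf _ _) _; apply: lerD.
  apply: (bound_sum _ predT) => x _; apply: prob_undersampled_le => //.
  by rewrite /nedges big_set1.
apply: le_trans (prob_predU_le mu_pmf _ _) _; apply: lerD.
  by apply: (bound_sum _ predT) => y _; apply: prob_undersampled_le; rewrite ?nedges_set1r.
have -> : 4 ^+ #|V| = #|{: {set V} * {set V}}|%:R :> R.
  by rewrite card_prod -!cardsT -!powersetT !card_powerset !cardsT -expnMn natrX.
by apply: bound_sum => AB AB_dense; apply: prob_undersampled_le.
Qed.

End Sampling.

(** * A random colouring has a rainbow perfect matching of a dense pair *)

Section ExposedMatching.
Variable R : realType.

Lemma rainbow_matching_after_exposure (D c : nat) (eps : R) :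
  (0 < D)%N -> (0 < c)%N -> 0 < eps ->
  exists s0 : nat, forall (J S V : finType) (K : {set S}) (mu : J -> S -> R) (T : {set J})
    (E : rel V) (slot : V * V -> 'I_D -> J),
  (s0 <= #|V|)%N -> is_pmf mu -> #|K| = (#|V| * D)%N ->
  injective (fun p : (V * V) * 'I_D => slot p.1 p.2) ->
  (forall e v, e \in T -> v \in K -> mu e v = #|K|%:R^-1) ->
  (forall x y l, E x y -> slot (x, y) l \in T) ->
  (forall t w, #|V| ^ 4 <= c * #|alternating_cycles E 4 t w|)%N ->
  prob mu (fun f => ~~ [exists t in perfect_matchings E, rainbow_on K (matching_slots slot t) f])
    <= eps.
Proof.
move=> D_gt0 c_gt0 eps_gt0; have eps2_gt0 : 0 < eps / 2 by lra.
have [L L_tail] := exp_series_tail (2 * c%:R * (4 ^ (D * (32 * c)))%N%:R) eps2_gt0.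
have [N N_corr] := inv_distinct_prob_small (L * D) eps2_gt0.
exists (N + 64 * c * L.+2)%N => J S V K mu T E slot V_ge mu_pmf card_K slot_inj mu_unif slot_T cycles.
have V_large : (64 * c <= #|V|)%N.
  by apply: leq_trans V_ge; rewrite (leq_trans _ (leq_addl _ _)) // leq_pmulr.
have L_lt : (L < #|V| %/ (16 * c))%N.
  rewrite leq_divRL ?muln_gt0 // (leq_trans _ V_ge) // (leq_trans _ (leq_addl _ _)) //.
  by clear; nia.
have N_le : (N <= #|K|)%N.
  by rewrite card_K (leq_trans _ (leq_pmulr _ D_gt0)) // (leq_trans (leq_addr _ _) V_ge).
have [_ corr_le] := N_corr _ N_le.
apply: le_trans (prob_no_rainbow_matching mu_pmf mu_unif slot_inj slot_T card_K D_gt0 c_gt0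
  V_large cycles L_lt) _.
rewrite [leRHS](splitr eps); apply: lerD; [exact: corr_le | exact: L_tail].
Qed.

(* Expose first which coordinates take a colour in [K]: by Chernoff bounds the degrees and the
   densities survive, and the remaining randomness is uniform in [K]. *)
Lemma prob_rainbow_matching_ge (D L Lm : nat) (eps : R) :
  (0 < D)%N -> (0 < L)%N -> (0 < Lm)%N -> 0 < eps ->
  exists s0 : nat, forall (J S V : finType) (K : {set S}) (mu : J -> S -> R) (m k : nat)
    (comp : rel V) (slot : V * V -> 'I_D -> J),
  (s0 <= #|V|)%N -> is_pmf mu -> #|K| = (#|V| * D)%N -> (#|K| < m)%N -> (m <= Lm * #|V|)%N ->
  injective (fun p : (V * V) * 'I_D => slot p.1 p.2) ->
  (forall x y l v, comp x y -> v \in K -> mu (slot (x, y) l) v = m%:R^-1) ->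
  (4 * L * k <= #|V|)%N -> superdense L k comp [set: V] [set: V] ->
  1 - eps <= prob mu (fun f =>
    [exists t in perfect_matchings comp, rainbow_on K (matching_slots slot t) f]).
Proof.
move=> D_gt0 L_gt0 Lm_gt0 eps_gt0; pose Z := (Lm ^ D)%N; pose c1 := rectangle_ratio L (8 * Z).
have Z_gt0 : (0 < Z)%N by rewrite expn_gt0 Lm_gt0.
have c1_gt0 : (0 < c1)%N by rewrite /c1 /rectangle_ratio addn_gt0 orbC muln_gt0 expn_gt0 L_gt0.
have c_gt0 : (0 < (c1 * (8 * Z)) ^ 3)%N by rewrite expn_gt0 !muln_gt0 c1_gt0 Z_gt0.
have [eps2_gt0 eps6_gt0] : 0 < eps / 2 /\ 0 < eps / 6 by split; lra.
have [s1 matching_likely] := rainbow_matching_after_exposure D_gt0 c_gt0 eps2_gt0.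
have [N1 lin_small] := @lin_half_pow_small R (L * (8 * Z)) _ ltac:(by rewrite !muln_gt0 L_gt0) eps6_gt0.
have [N2 exp_small] := @exp_quad_small R (c1 * (8 * Z)) _ ltac:(by rewrite !muln_gt0 c1_gt0) eps6_gt0.
exists (s1 + N1 + N2).+1 => J S V K mu m k comp slot V_ge mu_pmf card_K K_lt m_le slot_inj unif k_small dense.
have [s1_le N1_le N2_le V_gt0] : [/\ s1 <= #|V|, N1 <= #|V|, N2 <= #|V| & 0 < #|V|]%N.
  by move: V_ge; clear; split; lia.
have K_gt0 : (0 < #|K|)%N by rewrite card_K muln_gt0 V_gt0.
pose T := [set slot p.1 p.2 | p : (V * V) * 'I_D & comp p.1.1 p.1.2].
have mu_unif e v : e \in T -> v \in K -> mu e v = m%:R^-1.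
  by case/imsetP=> -[[x y] l]; rewrite inE /= => xy -> vK; apply: unif.
pose hit : J -> bool -> R := hit_pmf R K m; have hit_law := hit_pmf_pmf R J K_gt0 K_lt.
pose after (b : {ffun J -> bool}) j := exposed_pmf K T mu m (b j) j.
have after_law := exposed_pmf_pmf mu_pmf K_gt0 K_lt mu_unif.
have lam_ge := hit_prob_expn_ge R K_lt Lm_gt0 D_gt0 card_K m_le.
have lam_le1 : hit_prob R K m ^+ D <= 1.
  by rewrite exprn_ile1 ?divr_ge0 // ltW // hit_prob_lt1.
have row x : (#|V| <= L * deg_in comp [set: V] x)%N.
  by case: dense => _ /(_ x (in_setT x)); rewrite cardsT.
have col y : (#|V| <= L * deg_in (transpose comp) [set: V] y)%N.
  by case: dense => _ _ /(_ y (in_setT y)); rewrite cardsT.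
pose bad := sparse_sample (D := D) Z c1 comp slot.
have bad_unlikely : prob hit bad <= eps / 2.
  apply: le_trans (prob_sparse_sample_le hit_law slot_inj (fun=> fun=> erefl) Z_gt0 lam_ge lam_le1
    row col L_gt0 c1_gt0) _.
  by have := lin_small _ N1_le; have := exp_small _ N2_le; lra.
pose good f := [exists t in perfect_matchings comp, rainbow_on K (matching_slots slot t) f].
suff : prob mu (predC good) <= eps by rewrite probC //; lra.
rewrite [leRHS]splitr; apply: (prob_le_exposed mu_pmf K_gt0 K_lt mu_unif (ltW eps2_gt0) bad_unlikely).
move=> b b_good; have E_retains := retains_sampled Z_gt0 b_good.
apply: le_trans (matching_likely J S V K (after b) [set e in T | b e] (sampled comp slot b) slot
  s1_le (after_law b) card_K slot_inj _ _ _); last first.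
- exact: many_alternating_cycles V_gt0 k_small dense E_retains.
- move=> x y l /andP[xy /forallP/(_ l) b_xy]; rewrite inE b_xy andbT.
  by apply/imsetP; exists ((x, y), l); rewrite ?inE.
- by move=> e v; apply: exposed_pmf_hit.
apply: prob_le => // f; apply: contra => /exists_inP[t tP t_rainbow].
apply/exists_inP; exists t => //; move: tP; rewrite !inE => /forallP t_edges.
by apply/forallP => x; case/andP: (t_edges x).
Qed.

End ExposedMatching.

(** * Removing the colours: a coupling of McDiarmid type *)

Lemma big_option (R : nmodType) (S : finType) (G : option S -> R) :
  \sum_v G v = G None + \sum_c G (Some c).
Proof.
rewrite (bigD1 None) //=; congr (_ + _).
transitivity (\sum_(v in Some @: [set: S]) G v).
  by apply: eq_bigl => -[c|]; [rewrite imset_f | apply/esym/negP => /imsetP[]].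
by rewrite big_imset /= => [|? ? _ _ []] //; apply: eq_bigl => c; rewrite inE.
Qed.

Section McDiarmid.
Variables (R : realFieldType) (J Y : finType) (slots : Y -> {set J}) (m : nat) (p q : J -> R).
Hypothesis m_gt0 : (0 < m)%N.
Hypothesis q_ge0 : forall e, 0 <= q e.
Hypothesis q_le_p : forall e, q e <= p e.
Hypothesis p_le1 : forall e, p e <= 1.
Implicit Types (Q : {set J}) (f : {ffun J -> option 'I_m}).

(* A slot is absent ([None]) or has a uniform colour; the colour of [e] is taken into account only
   for [e] in [Q], where the slot is present with the larger probability. *)
Definition coloured_pmf Q (e : J) (v : option 'I_m) : R :=
  let r := if e \in Q then p e else q e in
  if v is Some c then r / m%:R else 1 - r.

Definition rainbow_in Q f (y : Y) :=
  [forall e in slots y, f e != None] && dinjectiveb f (mem (slots y :&: Q)).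

Definition has_rainbow Q f := [exists y, rainbow_in Q f y].

Let p_ge0 e : 0 <= p e := le_trans (q_ge0 e) (q_le_p e).

Lemma sum_uniform_colour (r : R) : \sum_(c < m) r / m%:R = r.
Proof.
by rewrite sumr_const card_ord -[LHS]mulr_natl mulrCA divff ?mulr1 // pnatr_eq0 -lt0n.
Qed.

Lemma coloured_pmf_pmf Q : is_pmf (coloured_pmf Q).
Proof.
split=> [e v|e]; rewrite /coloured_pmf; last by rewrite big_option sum_uniform_colour subrK.
by case: v => [c|]; case: (e \in Q); rewrite ?divr_ge0 ?subr_ge0 // (le_trans (q_le_p e)).
Qed.

Lemma rainbow_inP Q f y : reflect ({in slots y, forall e, f e != None} /\
  {in slots y :&: Q &, injective f}) (rainbow_in Q f y).
Proof. by apply: (iffP andP) => -[/forall_inP ? /dinjectiveP]. Qed.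

Lemma rainbow_in_absent Q f e v y : rainbow_in Q (update f e None) y ->
  rainbow_in (e |: Q) (update f e v) y.
Proof.
case/rainbow_inP=> present inj.
have ey : e \notin slots y by apply/negP => /present; rewrite ffunE eqxx.
have ne i : i \in slots y -> (i == e) = false by move=> iy; apply: contraTF iy => /eqP->.
have slotsE : slots y :&: (e |: Q) = slots y :&: Q.
  by apply/setP => i; rewrite !inE; case: (boolP (i \in slots y)) => // /ne ->.
apply/rainbow_inP; rewrite slotsE; split=> [i iy|i j iy jy].
  by have := present i iy; rewrite !ffunE ne.
have := inj i j iy jy; rewrite !ffunE !ne //; first by case/setIP: jy.
by case/setIP: iy.
Qed.

Definition used_colours Q f y := [set c | [exists i in slots y :&: Q, f i == Some c]].

Lemma card_used_colours Q f y : (#|used_colours Q f y| <= #|slots y :&: Q|)%N.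
Proof.
have [->|/set0Pn[c0 _]] := eqVneq (used_colours Q f y) set0; first by rewrite cards0.
apply: leq_trans (leq_imset_card (fun i => odflt c0 (f i)) _); apply/subset_leq_card/subsetP => c.
rewrite inE => /exists_inP[i iy /eqP fi]; apply/imsetP; exists i => //.
by rewrite fi.
Qed.

Lemma rainbow_in_fresh Q f e c0 c y : e \notin Q -> rainbow_in Q (update f e (Some c0)) y ->
  c \notin used_colours Q f y -> rainbow_in (e |: Q) (update f e (Some c)) y.
Proof.
move=> eQ /rainbow_inP[present inj] c_new.
have old i : i \in slots y :&: (e |: Q) -> i != e -> i \in slots y :&: Q /\ f i != Some c.
  move=> iy /negbTE ie; have iyQ : i \in slots y :&: Q by move: iy; rewrite !inE ie.
  by split=> //; apply: contraNneq c_new => fi; rewrite inE; apply/exists_inP; exists i; rewrite ?fi.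
apply/rainbow_inP; split=> [i iy|i j iy jy].
  by have := present i iy; rewrite !ffunE; case: (i == e).
rewrite !ffunE; case: (eqVneq i e) => [->|ie]; case: (eqVneq j e) => [->|je] //.
- by case: (old j jy je) => _ /eqP fj /esym.
- by case: (old i iy ie) => _ /eqP.
have [iyQ _] := old i iy ie; have [jyQ _] := old j jy je.
by have := inj i j iyQ jyQ; rewrite !ffunE (negbTE ie) (negbTE je).
Qed.

(* Given the other coordinates, either a structure avoids [e], or a structure through [e] remains
   rainbow for every colour of [e] outside the at most [k] colours it uses. *)
Lemma colour_step Q e k : e \notin Q -> (forall y, #|slots y :&: Q| <= k)%N ->
  q e * m%:R <= p e * (m - k)%:R ->
  prob (coloured_pmf Q) (has_rainbow Q) <= prob (coloured_pmf (e |: Q)) (has_rainbow (e |: Q)).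
Proof.
move=> eQ few_slots q_small.
apply: (expect_hybrid_step (j := e)); [exact: coloured_pmf_pmf | exact: coloured_pmf_pmf | |].
  by move=> i ie v; rewrite /coloured_pmf !inE (negbTE ie).
move=> f; set lhs := \sum_v _; set rhs := \sum_v _.
have total S : \sum_v coloured_pmf S e v = 1 by case: (coloured_pmf_pmf S).
have term_ge0 v : 0 <= coloured_pmf (e |: Q) e v * (has_rainbow (e |: Q) (update f e v))%:R.
  by rewrite mulr_ge0 // (coloured_pmf_pmf _).1.
have lhs_le (b : option 'I_m -> bool) : (forall v, has_rainbow Q (update f e v) -> b v) ->
    lhs <= \sum_(v | b v) coloured_pmf Q e v.
  move=> has_b; rewrite [leRHS]big_mkcond; apply: ler_sum => v _.
  case: (boolP (has_rainbow _ _)) => [/has_b->|_]; rewrite ?mulr1 // mulr0.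
  by case: ifP => // _; apply: (coloured_pmf_pmf Q).1.
case: (boolP (has_rainbow Q (update f e None))) => [/existsP[y avoid]|none].
  apply: le_trans (lhs_le predT _) _ => //; rewrite total -[leLHS](total (e |: Q)).
  apply: ler_sum => v _; rewrite (_ : has_rainbow _ _ = true) ?mulr1 //.
  by apply/existsP; exists y; apply: rainbow_in_absent avoid.
case: (pickP (fun c => has_rainbow Q (update f e (Some c)))) => [c0 /existsP[y through]|no_c].
  apply: le_trans (lhs_le (fun v => v != None) _) _; first by case=> //; rewrite (negbTE none).
  rewrite big_mkcond big_option /= add0r /coloured_pmf (negbTE eQ) sum_uniform_colour.
  pose used := used_colours Q f y.
  apply: le_trans (_ : \sum_(c in ~: used) p e / m%:R <= _).
    rewrite sumr_const -[leRHS]mulr_natl mulrCA mulrA ler_pdivlMr ?ltr0n //.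
    apply: le_trans q_small _; rewrite ler_wpM2l // ler_nat.
    have := leq_trans (card_used_colours Q f y) (few_slots y); rewrite -/used.
    by have := cardsC used; rewrite card_ord; lia.
  rewrite /rhs big_option -[leLHS]add0r; apply: lerD => //.
  rewrite big_mkcond; apply: ler_sum => c _; rewrite inE; case: ifP => // c_new.
  rewrite (_ : has_rainbow _ _ = true) /= ?mulr1 /coloured_pmf ?setU11 //.
  by apply/existsP; exists y; apply: rainbow_in_fresh through c_new.
apply: le_trans (lhs_le pred0 _) _; last by rewrite big_pred0_eq sumr_ge0.
by case=> [c|]; rewrite ?no_c // (negbTE none).
Qed.

Lemma colour_steps (S Q : {set J}) k : [disjoint S & Q] ->
  (forall y, #|slots y :&: (S :|: Q)| <= k)%N ->
  (forall e, e \in S -> q e * m%:R <= p e * (m - k)%:R) ->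
  prob (coloured_pmf Q) (has_rainbow Q) <= prob (coloured_pmf (S :|: Q)) (has_rainbow (S :|: Q)).
Proof.
have [n] := ubnP #|S|; elim: n S Q => // n IH S Q; rewrite ltnS => S_le dis few_slots q_small.
have [->|/set0Pn[e eS]] := eqVneq S set0; first by rewrite set0U.
have eQ : e \notin Q by rewrite (disjointFr dis eS).
have SQ : S :|: Q = (S :\ e) :|: (e |: Q) by rewrite setUCA setUA setD1K.
apply: le_trans (colour_step (k := k) eQ _ (q_small e eS)) _.
  by move=> y; apply: leq_trans (few_slots y); rewrite subset_leq_card // setIS // subsetUr.
rewrite SQ in few_slots *; apply: IH => //.
- by move: S_le; rewrite (cardsD1 e S) eS.
- rewrite disjoints_subset; apply/subsetP => i /setD1P[ie iS].
  by rewrite !inE negb_or ie (disjointFr dis iS).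
by move=> i /setD1P[_ /q_small].
Qed.

Theorem mcdiarmid_coupling (J1 : {set J}) k1 k2 :
  (forall y, #|slots y :&: J1| <= k1)%N -> (forall y, #|slots y| <= k2)%N ->
  (forall e, e \in J1 -> q e * m%:R <= p e * (m - k1)%:R) ->
  (forall e, e \notin J1 -> q e * m%:R <= p e * (m - k2)%:R) ->
  prob (coloured_pmf set0) (has_rainbow set0) <= prob (coloured_pmf setT) (has_rainbow setT).
Proof.
move=> few1 few2 q_small1 q_small2.
apply: le_trans (colour_steps (S := J1) (k := k1) _ _ q_small1) _.
- by rewrite disjoint_sym disjoints_subset sub0set.
- by rewrite setU0.
rewrite setU0 -(setUCr J1) setUC; apply: (colour_steps (k := k2)).
- by rewrite disjoints_subset.
- by move=> y; apply: leq_trans (few2 y); rewrite subset_leq_card // subsetIl.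
by move=> e; rewrite inE => /q_small2.
Qed.

Definition bernoulli_pmf (r : J -> R) (e : J) (b : bool) : R := if b then r e else 1 - r e.

Lemma bernoulli_pmf_pmf (r : J -> R) : (forall e, 0 <= r e <= 1) -> is_pmf (bernoulli_pmf r).
Proof.
move=> r01; split=> [e b|e]; have /andP[r_ge0 r_le1] := r01 e; last by rewrite big_bool /= addrC subrK.
by case: b; rewrite /bernoulli_pmf // subr_ge0.
Qed.

Lemma expect_presence (F : {ffun J -> bool} -> R) :
  expect (coloured_pmf set0) (fun f => F [ffun e => f e != None]) = expect (bernoulli_pmf q) F.
Proof.
rewrite (expect_map (coloured_pmf set0) (fun e v => v != None)).
apply: eq_bigr => f _; congr (_ * _); apply: eq_bigr => e _.
rewrite big_mkcond big_option /coloured_pmf in_set0 /bernoulli_pmf.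
by case: (f e) => /=; rewrite ?add0r ?sum_uniform_colour // big1 ?addr0.
Qed.

Lemma prob_all_absent (r : J -> R) (Es : {set J}) : (forall e, 0 <= r e <= 1) ->
  prob (bernoulli_pmf r) (fun b => [forall e in Es, ~~ b e]) = \prod_(e in Es) (1 - r e).
Proof.
move=> r01; pose g e (b : bool) : R := if e \in Es then (~~ b)%:R else 1.
rewrite /prob (eq_expect _ (G := fun b => \prod_e g e (b e))) => [|b]; last first.
  case: (boolP [forall e in Es, ~~ b e]) => [/forall_inP absent|/forall_inPn[e eE be]].
    by rewrite big1 // => e _; rewrite /g; case: ifP => // /absent ->.
  by rewrite (bigD1 e) //= /g eE (negbTE be) mul0r.
rewrite expect_prod [RHS]big_mkcond; apply: eq_bigr => e _; rewrite big_bool /= /g /bernoulli_pmf.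
by case: (e \in Es) => /=; rewrite ?mulr0 ?mulr1 ?add0r // addrC subrK.
Qed.

End McDiarmid.

(** * Random graphs with independent edges *)

Definition cross (V : finType) (X Z : {set V}) : {set {set V}} :=
  [set [set p.1; p.2] | p in setX X Z].

Lemma card_cross (V : finType) (X Z : {set V}) : [disjoint X & Z] ->
  #|cross X Z| = (#|X| * #|Z|)%N.
Proof.
move=> dis; have ne x z : x \in X -> z \in Z -> (x == z) = false.
  by move=> xX zZ; apply: contraTF xX => /eqP ->; rewrite (disjointFl dis zZ).
rewrite card_in_imset ?cardsX // => -[x z] [x' z']; rewrite !inE /= => /andP[xX zZ] /andP[xX' zZ'] eq_pair.
have := set21 x z; have := set22 x z; rewrite eq_pair !inE (ne x z') // orbF.
by rewrite eq_sym (ne x' z) //= => /eqP-> /eqP->.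
Qed.

Section RandomGraph.
Variables (R : realFieldType) (V : finType) (r : {set V} -> R).
Hypothesis r01 : forall e, 0 <= r e <= 1.
Implicit Types (A : {set V}) (b : {ffun {set V} -> bool}).

Definition test_pair A beta (XZ : {set V} * {set V}) :=
  [&& XZ.1 \subset ~: A, XZ.2 \subset ~: A, [disjoint XZ.1 & XZ.2], #|XZ.1| == beta & #|XZ.2| == beta].

Definition unjoined_pair A beta b :=
  [exists (XZ | test_pair A beta XZ), [forall e in cross XZ.1 XZ.2, ~~ b e]].

Lemma joined_of_pairs A beta b (G : rel V) : ~~ unjoined_pair A beta b ->
  (forall x z, x \notin A -> z \notin A -> x != z -> b [set x; z] -> G x z) -> joined G A beta.
Proof.
move=> joined_b b_G X Z XA ZA XZ X_ge Z_ge.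
have [X' sX cX] := exists_subset_card X_ge; have [Z' sZ cZ] := exists_subset_card Z_ge.
have dXZ : [disjoint X' & Z'] by apply: disjointWl sX (disjointWr sZ XZ).
have XA' := subset_trans sX XA; have ZA' := subset_trans sZ ZA.
have := existsPn joined_b (X', Z'); rewrite /test_pair /= XA' ZA' dXZ cX cZ !eqxx /=.
case/forall_inPn=> _ /imsetP[[x z] /setXP[/= xX zZ] ->]; rewrite negbK => b_xz.
have [xA zA] : x \notin A /\ z \notin A.
  by rewrite -!in_setC (subsetP XA') ?(subsetP ZA').
exists x, z; split; [exact: (subsetP sX) | exact: (subsetP sZ) | apply: b_G => //].
by apply: contraTneq zZ => <-; rewrite (disjointFr dXZ).
Qed.

Lemma prob_unjoined_pair_le A beta (r0 : R) : 0 <= r0 -> r0 <= 1 ->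
  (forall x z, x \notin A -> z \notin A -> x != z -> r0 <= r [set x; z]) ->
  prob (bernoulli_pmf r) (unjoined_pair A beta) <= 4 ^+ #|V| * (1 - r0) ^+ (beta ^ 2).
Proof.
move=> r0_ge0 r0_le1 r_ge; have pow_ge0 : 0 <= (1 - r0) ^+ (beta ^ 2) by rewrite exprn_ge0 ?subr_ge0.
apply: le_trans (prob_exists_le (bernoulli_pmf_pmf r01) _ _) _.
apply: le_trans (_ : \sum_(XZ : {set V} * {set V}) (1 - r0) ^+ (beta ^ 2) <= _); last first.
  by rewrite sumr_const card_prod -!cardsT -!powersetT !card_powerset cardsT -expnMn -[leLHS]mulr_natl natrX.
rewrite [leLHS]big_mkcond; apply: ler_sum => -[X Z] _; case: ifP => //.
case/and5P=> /= XA ZA XZ /eqP card_X /eqP card_Z.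
rewrite prob_all_absent // -mulnn -{1}card_X -card_Z -card_cross // -prodr_const.
apply: ler_prod => _ /imsetP[[x z] /setXP[/= xX zZ] ->].
have /andP[_ r_le1] := r01 [set x; z]; rewrite subr_ge0 r_le1 lerD2l lerN2 /=.
apply: r_ge; [by rewrite -in_setC (subsetP XA) | by rewrite -in_setC (subsetP ZA) |].
by apply: contraTneq zZ => <-; rewrite (disjointFr XZ).
Qed.

Lemma prob_few_nbrs_le (v : V) (S : {set V}) :
  (forall y, y \in S -> r [set v; y] = 2^-1) -> v \notin S ->
  prob (bernoulli_pmf r) (fun b => #|[set y in S | b [set v; y]]| <= #|S| %/ 16)%N <=
  2^-1 ^+ (#|S| %/ 16).
Proof.
move=> r_half vS; pose Q : finType := {y | y \in S}.
pose slot (y : Q) (l : 'I_1) : {set V} := [set v; val y].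
have slot_inj : injective (fun p : Q * 'I_1 => slot p.1 p.2).
  move=> [y l] [y' l'] /= slot_eq; rewrite (ord1 l) (ord1 l'); congr (_, _); apply: val_inj.
  have := set22 v (val y); rewrite -/(slot y l) slot_eq !inE => /orP[/eqP y_v|/eqP //].
  by have := valP y; rewrite y_v (negbTE vS).
have slot_half (y : Q) l : bernoulli_pmf r (slot y l) true = 2^-1.
  by rewrite /bernoulli_pmf r_half // (valP y).
have card_Q : #|[set: Q]| = #|S| by rewrite cardsT card_sig; apply: eq_card => y; rewrite !inE.
have nbrsE b : [set y in S | b [set v; y]] = val @: [set q in [set: Q] | survives slot b q].
  apply/setP => y; apply/idP/imsetP => [|[q]].
    rewrite inE => /andP[yS b_y]; exists (Sub y yS : Q) => //; rewrite !inE /=.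
    exact/forallP.
  by rewrite !inE /= => /forallP/(_ ord0) b_q ->; rewrite (valP q).
have := chernoff (bernoulli_pmf_pmf r01) slot_inj slot_half (Z := 2) setT.
rewrite card_Q expr1 => chern; apply: le_trans (chern _ _ _); [|by []|by []|by lra].
apply: prob_le; first exact: bernoulli_pmf_pmf.
by move=> b; rewrite nbrsE card_imset //; apply: val_inj.
Qed.

End RandomGraph.

(** * The coloured perturbed graph as a product measure *)

Section ExtendColouring.
Variables (V : finType) (E : {set {set V}}) (m : nat).
Hypothesis m_gt0 : (0 < m)%N.

Definition extend_colouring (c : colouring E m) : {ffun {set V} -> option 'I_m} :=
  [ffun e => if insub e is Some e' then Some (c e') else None].

Lemma extend_colouring_in c e (eE : e \in E) : extend_colouring c e = Some (c (Sub e eE)).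
Proof. by rewrite ffunE insubT. Qed.

Lemma extend_colouring_val c (e : edge E) : extend_colouring c (val e) = Some (c e).
Proof. by rewrite ffunE valK. Qed.

Lemma extend_colouring_out c e : e \notin E -> extend_colouring c e = None.
Proof. by move=> eE; rewrite ffunE insubN. Qed.

Lemma extend_colouring_inj : injective extend_colouring.
Proof.
move=> c c' ext_eq; apply/ffunP => e; have := congr1 (fun f : {ffun _} => f (val e)) ext_eq.
by rewrite !extend_colouring_val => -[].
Qed.

Lemma extend_colouring_surj (f : {ffun {set V} -> option 'I_m}) :
  (forall e, (e \in E) = (f e != None)) -> f \in extend_colouring @: [set: colouring E m].
Proof.
move=> f_E; apply/imsetP; exists [ffun e : edge E => odflt (Ordinal m_gt0) (f (val e))] => //.
apply/ffunP => e; have := f_E e; case: (boolP (e \in E)) => eE f_e.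
  by rewrite extend_colouring_in ffunE /=; case: (f e) f_e.
by rewrite extend_colouring_out //; case: (f e) f_e.
Qed.

End ExtendColouring.

Section Conversion.
Variables (R : realType) (V U : finType) (G0 : {set {set V}}) (T : {set {set U}}) (p : R) (m : nat).
Hypothesis p_ge0 : 0 <= p.
Hypothesis p_le1 : p <= 1.
Hypothesis m_gt0 : (0 < m)%N.

Definition edge_prob (e : {set V}) : R := if e \in G0 then 1 else if e \in vpairs V then p else 0.

Definition coloured_copy (f : {ffun {set V} -> option 'I_m}) :=
  [exists phi : {ffun U -> V}, [&& injectiveb phi, [forall e in image_graph phi T, f e != None] &
    dinjectiveb f (mem (image_graph phi T))]].

Definition uniform_colour_pmf (present : bool) (v : option 'I_m) : R :=
  if present then (if v is Some _ then m%:R^-1 else 0) else (v == None)%:R.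

Lemma coloured_copy_extend (E : {set {set V}}) (c : colouring E m) :
  coloured_copy (extend_colouring c) -> has_rainbow_copy T c.
Proof.
case/existsP=> phi /and3P[phi_inj /forall_inP present /dinjectiveP rainbow].
apply/existsP; exists phi; rewrite phi_inj /=; apply/andP; split.
  by apply/subsetP => e /present; apply: contraNT => eE; rewrite extend_colouring_out.
apply/dinjectiveP => x y; rewrite !inE => xI yI c_eq; apply/val_inj/rainbow => //.
by rewrite !extend_colouring_val c_eq.
Qed.

Lemma colouring_prob_ge (E : {set {set V}}) :
  prob (fun e => uniform_colour_pmf (e \in E)) coloured_copy <=
  colouring_prob R (fun c : colouring E m => has_rainbow_copy T c).
Proof.
pose ext := @extend_colouring V E m.
rewrite /prob /expect (bigID (mem (ext @: [set: colouring E m]))) /= [X in _ + X]big1 ?addr0; last first.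
  move=> f f_out; apply/eqP; rewrite mulf_eq0; apply/orP; left; apply/negPn/negP => weight_neq0.
  case/negP: f_out; apply: extend_colouring_surj => // e; have /prodf_neq0/(_ e isT) := weight_neq0.
  by rewrite /uniform_colour_pmf; case: (e \in E); case: (f e) => [c|] //=; rewrite eqxx.
rewrite big_imset /=; last by move=> c c' _ _; apply: extend_colouring_inj.
rewrite /colouring_prob [leRHS]big_mkcond (eq_bigl predT) => [|c]; last by rewrite inE.
apply: ler_sum => c _.
have -> : \prod_(e : {set V}) uniform_colour_pmf (e \in E) (ext c e) = \prod_(e : edge E) m%:R^-1.
  rewrite [RHS]prodr_const card_sig -prodr_const [RHS]big_mkcond; apply: eq_bigr => e _; rewrite inE.
  rewrite /uniform_colour_pmf; case: (boolP (e \in E)) => eE; first by rewrite extend_colouring_in.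
  by rewrite /ext extend_colouring_out.
case: (boolP (coloured_copy _)) => [/coloured_copy_extend-> /=|_]; first by rewrite mulr1.
by rewrite mulr0; case: ifP => // _; apply: prodr_ge0 => e _; rewrite invr_ge0.
Qed.

Lemma expect_edge_sets (F : {ffun {set V} -> bool} -> R) :
  expect (bernoulli_pmf (fun e => if e \in vpairs V then p else 0)) F =
  \sum_(H : {set {set V}} | is_graph H) gnp_mass p H * F [ffun e => e \in H].
Proof.
pose indicator (H : {set {set V}}) : {ffun {set V} -> bool} := [ffun e => e \in H].
have indicator_bij : bijective indicator.
  exists (fun b : {ffun {set V} -> bool} => [set e | b e]) => [H|b].
    by apply/setP => e; rewrite inE ffunE.
  by apply/ffunP => e; rewrite ffunE inE.
rewrite /expect (reindex indicator) /=; last exact: onW_bij.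
rewrite [RHS]big_mkcond /=; apply: eq_bigr => H _; case: ifP => H_graph; last first.
  have /subsetPn[e eH eV] : ~~ (H \subset vpairs V) by rewrite -/(is_graph H) H_graph.
  by rewrite (bigD1 e) //= /bernoulli_pmf ffunE eH (negbTE eV) !mul0r.
congr (_ * _); rewrite /gnp_mass [RHS]big_mkcond; apply: eq_bigr => e _.
rewrite /bernoulli_pmf ffunE; case: (boolP (e \in vpairs V)) => // eV; rewrite ifN ?subr0 //.
by apply: contra eV; apply: (subsetP H_graph).
Qed.

Lemma perturbed_prob_ge q : prob (coloured_pmf (m := m) edge_prob q setT) coloured_copy <=
  perturbed_prob G0 p (fun E (c : colouring E m) => has_rainbow_copy T c).
Proof.
pose r e : R := if e \in vpairs V then p else 0.
pose nu (b : bool) (e : {set V}) := uniform_colour_pmf ((e \in G0) || b).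
rewrite /prob (@expect_mixture R _ _ _ (coloured_pmf edge_prob q setT) (bernoulli_pmf r) nu); last first.
  move=> e v; rewrite big_bool /nu /uniform_colour_pmf /bernoulli_pmf /coloured_pmf in_setT /edge_prob.
  case: (e \in G0); case: v => [c|] /=; rewrite -/(r e) ?mulr0 ?mulr1 ?add0r ?addr0 ?subrr //.
  by rewrite -mulrDl addrC subrK.
rewrite expect_edge_sets /perturbed_prob; apply: ler_sum => H H_graph.
apply: ler_wpM2l; first by apply: prodr_ge0 => e _; case: ifP; rewrite ?subr_ge0.
apply: le_trans (colouring_prob_ge (G0 :|: H)).
rewrite le_eqVlt; apply/orP; left; apply/eqP; apply: eq_bigr => f _; congr (_ * _).
by apply: eq_bigr => e _; rewrite /nu ffunE inE.
Qed.

End Conversion.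

(** * Partial copies and their completion *)

Section PartialCopies.
Variables (U V : finType) (T : {set {set U}}) (m s D : nat).
Variables (hub : 'I_s -> U) (nb : 'I_s -> 'I_D -> U) (a : 'I_s -> 'I_D -> V) (B Z : {set V}).

Definition slot_set : {set V} := [set a p.1 p.2 | p : 'I_s * 'I_D].
Definition hub_set : {set U} := [set hub i | i : 'I_s].

(* The pairs whose state is used in the first phase. *)
Definition first_phase : {set {set V}} :=
  [set e in vpairs V | [disjoint e & slot_set] || ~~ [disjoint e & Z]].

Definition hubless_edges : {set {set U}} := [set e in T | [disjoint e & hub_set]].

Definition is_partial_copy (phi : {ffun U -> V}) :=
  [&& dinjectiveb phi (mem (~: hub_set)), [forall i, forall l, phi (nb i l) == a i l],
      [forall x, (x \in phi @: (~: hub_set)) || (x \in B)] &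
      [forall e in hubless_edges, phi @: (e : {set U}) \in first_phase]].

Definition partial_copy := {phi : {ffun U -> V} | is_partial_copy phi}.

Definition copy_edges (y : partial_copy) : {set {set V}} :=
  [set (val y) @: (e : {set U}) | e in hubless_edges].

Record hub_stars : Prop := HubStars {
  hub_inj : injective hub;
  nb_not_hub : forall i l, nb i l \notin hub_set;
  hub_edge : forall e, e \in T -> ~~ [disjoint e & hub_set] -> exists i l, e = [set hub i; nb i l] }.

Definition completion_slot (r : 'I_s -> V) (p : 'I_s * 'I_s) (l : 'I_D) : {set V} :=
  [set a p.1 l; r p.2].

Lemma partial_copy_inj (y : partial_copy) : {in ~: hub_set &, injective (val y)}.
Proof. by have /and4P[/dinjectiveP] := valP y. Qed.

Lemma partial_copy_nb (y : partial_copy) i l : val y (nb i l) = a i l.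
Proof. by have /and4P[_ /forallP/(_ i)/forallP/(_ l)/eqP] := valP y. Qed.

Lemma copy_edges_first_phase y e : e \in copy_edges y -> e \in first_phase.
Proof. by case/imsetP=> e' eT ->; have /and4P[_ _ _ /forall_inP] := valP y; apply. Qed.

Lemma card_copy_edges y : (#|copy_edges y| <= #|hubless_edges|)%N.
Proof. exact: leq_imset_card. Qed.

Hypothesis stars : hub_stars.

Definition complete (phi : U -> V) (r : 'I_s -> V) : {ffun U -> V} :=
  [ffun u => if [pick i | hub i == u] is Some i then r i else phi u].

Lemma complete_hub phi r i : complete phi r (hub i) = r i.
Proof.
by rewrite ffunE; case: pickP => [j /eqP/(hub_inj stars)->|/(_ i)] //; rewrite eqxx.
Qed.

Lemma complete_other phi r u : u \notin hub_set -> complete phi r u = phi u.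
Proof.
by move=> u_hub; rewrite ffunE; case: pickP => // i /eqP hub_i; rewrite -hub_i imset_f in u_hub.
Qed.

Lemma complete_inj phi r : {in ~: hub_set &, injective phi} -> injective r ->
  (forall j, r j \notin phi @: (~: hub_set)) -> injective (complete phi r).
Proof.
move=> phi_inj r_inj r_new u v.
case: (boolP (u \in hub_set)) => [/imsetP[i _ ->]|uH]; case: (boolP (v \in hub_set)) => [/imsetP[j _ ->]|vH].
- by rewrite !complete_hub => /r_inj ->.
- by rewrite complete_hub complete_other // => r_v; have := r_new i; rewrite r_v imset_f // inE.
- by rewrite complete_hub complete_other // => v_r; have := r_new j; rewrite -v_r imset_f // inE.
by rewrite !complete_other // => /phi_inj; apply; rewrite inE.
Qed.

Lemma image_complete (y : partial_copy) (r : 'I_s -> V) (t : {perm 'I_s}) e :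
  e \in image_graph (complete (val y) (r \o t)) T ->
  e \in copy_edges y \/ e \in matching_slots (completion_slot r) t.
Proof.
case/imsetP=> e' eT ->; case: (boolP [disjoint e' & hub_set]) => [dis|meets].
  left; rewrite (_ : _ @: e' = val y @: e'); first by rewrite imset_f // inE eT.
  by apply: eq_in_imset => u ue; rewrite complete_other // (disjointFr dis ue).
have [i [l ->]] := hub_edge stars eT meets; right; apply/imsetP; exists (i, l) => //=.
rewrite imsetU !imset_set1 complete_hub complete_other ?(nb_not_hub stars) // partial_copy_nb.
by rewrite /completion_slot setUC.
Qed.

Hypothesis a_reserve : forall i l, a i l \notin Z.
Hypothesis base_reserve : [disjoint B & Z].

Lemma completion_slot_second_phase r p l : r p.2 \in B -> completion_slot r p l \notin first_phase.
Proof.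
move=> rB; rewrite inE negb_and negb_or negbK; apply/orP; right; apply/andP; split.
  have aS : a p.1 l \in slot_set by apply/imsetP; exists (p.1, l).
  by apply/negP => /disjointFr/(_ (set21 _ _)); rewrite aS.
rewrite disjoints_subset; apply/subsetP => z; rewrite !inE => /orP[] /eqP->; first exact: a_reserve.
by rewrite (disjointFr base_reserve).
Qed.

Lemma coloured_copy_merge (f g : {ffun {set V} -> option 'I_m}) (y : partial_copy)
    (K : {set option 'I_m}) (r : 'I_s -> V) (t : {perm 'I_s}) :
  rainbow_in copy_edges setT f y ->
  injective r -> (forall j, r j \notin val y @: (~: hub_set)) -> (forall j, r j \in B) ->
  None \notin K -> (forall e, e \in copy_edges y -> f e \notin K) ->
  rainbow_on K (matching_slots (completion_slot r) t) g ->
  coloured_copy T (merge [predC first_phase] f g).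
Proof.
move=> /rainbow_inP[present rainbow_f] r_inj r_new r_base K_none f_K /rainbow_onP[g_K rainbow_g].
set h := merge _ f g; pose F := complete (val y) (r \o t).
have hE e : e \in image_graph F T -> (e \in copy_edges y /\ h e = f e) \/
    (e \in matching_slots (completion_slot r) t /\ h e = g e).
  case/image_complete=> eF; [left | right]; split=> //; rewrite ffunE inE.
    by rewrite /= (copy_edges_first_phase eF).
  by case/imsetP: eF => -[i l] _ ->; rewrite /= completion_slot_second_phase //=.
apply/existsP; exists F; apply/and3P; split.
- apply/injectiveP/complete_inj; first exact: partial_copy_inj.
    by move=> i j /r_inj/perm_inj.
  by move=> j; apply: r_new.
- apply/forall_inP => e /hE[[eS ->]|[eM ->]]; first exact: present.
  by apply: contraNneq K_none => <-; apply: g_K.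
apply/dinjectiveP => e e' /hE[[eS ->]|[eM ->]] /hE[[eS' ->]|[eM' ->]].
- by apply: rainbow_f; rewrite setIT.
- by move=> fg; have := f_K _ eS; rewrite fg g_K.
- by move=> gf; have := f_K _ eS'; rewrite -gf g_K.
exact: rainbow_g.
Qed.

Hypothesis card_UV : #|U| = #|V|.

Lemma exists_leftover_enum (y : partial_copy) : exists r : 'I_s -> V,
  [/\ injective r, (forall j, r j \notin val y @: (~: hub_set)) & (forall j, r j \in B)].
Proof.
pose L := ~: (val y @: (~: hub_set)).
have card_L : #|L| = s.
  have := cardsC (val y @: (~: hub_set)); rewrite -/L (card_in_imset (@partial_copy_inj y)).
  have := cardsC hub_set; rewrite (card_imset _ (hub_inj stars)) card_ord.
  by move: card_UV; move: #|~: hub_set| #|L| => x z; clear; lia.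
have in_L j : enum_val (cast_ord (esym card_L) j) \in L := enum_valP _.
exists (fun j => enum_val (cast_ord (esym card_L) j)); split.
- by move=> i j /enum_val_inj/cast_ord_inj.
- by move=> j; rewrite -in_setC.
move=> j; have /and4P[_ _ /forallP/(_ (enum_val (cast_ord (esym card_L) j))) + _] := valP y.
by have := in_L j; rewrite inE => /negbTE->.
Qed.

Lemma exists_unused_colours (f : {ffun {set V} -> option 'I_m}) (y : partial_copy) :
  (#|hubless_edges| + s * D <= m)%N -> exists K : {set option 'I_m},
  [/\ #|K| = (s * D)%N, None \notin K & forall e, e \in copy_edges y -> f e \notin K].
Proof.
move=> enough; have [|K sK cK] := @exists_subset_card _ ([set Some c | c : 'I_m] :\: f @: copy_edges y) (s * D)%N.
  rewrite cardsD card_imset ?card_ord; last by move=> ? ? [].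
  have : (#|[set Some c | c : 'I_m] :&: f @: copy_edges y| <= #|hubless_edges|)%N.
    apply: leq_trans (card_copy_edges y); apply: leq_trans (leq_imset_card f _).
    by rewrite subset_leq_card // subsetIr.
  by move: enough; move: #|_ :&: _| => x; clear; lia.
exists K; split=> //.
  by apply/negP => /(subsetP sK)/setDP[/imsetP[]].
by move=> e eS; apply/negP => /(subsetP sK)/setDP[_]; rewrite imset_f.
Qed.

Lemma card_edges_meeting (S : {set U}) d : (forall u, degree T u <= d)%N -> is_graph T ->
  (#|[set e in T | ~~ [disjoint e & S]]| <= d * #|S|)%N.
Proof.
move=> deg_le T_graph.
have sub : [set e in T | ~~ [disjoint e & S]] \subset
    \bigcup_(u in S) [set [set u; v] | v in [set v | adj T u v]].
  apply/subsetP => e; rewrite inE -setI_eq0 => /andP[eT /set0Pn[u /setIP[ue uS]]].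
  apply/bigcupP; exists u => //.
  have := subsetP T_graph _ eT; rewrite inE => /cards2P[x [x' [_ e_xx]]].
  move: ue; rewrite e_xx !inE => /orP[] /eqP ->; apply/imsetP.
    by exists x'; rewrite // inE /adj -e_xx.
  by exists x; [rewrite inE /adj setUC -e_xx | rewrite setUC].
apply: leq_trans (subset_leq_card sub) _; rewrite mulnC; apply: card_bigcup_le_const => u _.
exact: leq_trans (leq_imset_card _ _) (deg_le u).
Qed.

Lemma card_copy_edges_reserve y d : (forall u, degree T u <= d)%N -> is_graph T ->
  (#|copy_edges y :&: [set e : {set V} | ~~ [disjoint e & Z]]| <= d * #|Z|)%N.
Proof.
move=> deg_le T_graph; pose S := [set u in ~: hub_set | val y u \in Z].
have card_S : (#|S| <= #|Z|)%N.
  rewrite -(card_in_imset (f := val y) (D := mem S)).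
    by apply/subset_leq_card/subsetP => _ /imsetP[u /setIdP[_ uZ] ->].
  by move=> u v /setIdP[uH _] /setIdP[vH _]; apply: partial_copy_inj.
apply: (@leq_trans #|[set e in T | ~~ [disjoint e & S]]|); last first.
  by apply: leq_trans (card_edges_meeting _ deg_le T_graph) _; rewrite leq_mul2l card_S orbT.
apply: leq_trans (leq_imset_card (fun e : {set U} => val y @: e) _); apply/subset_leq_card/subsetP => e.
case/setIP=> /imsetP[e' /setIdP[eT dis] ->]; rewrite inE -setI_eq0 => /set0Pn[z /setIP[/imsetP[u ue ->] uZ]].
apply: imset_f; rewrite inE eT -setI_eq0; apply/set0Pn; exists u.
by rewrite in_setI ue inE in_setC uZ (disjointFr dis ue).
Qed.

End PartialCopies.

Section TwoPhases.
Variables (R : realType) (U V : finType) (T : {set {set U}}) (G0 : {set {set V}}) (p : R).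
Variables (m s D d : nat) (hub : 'I_s -> U) (nb : 'I_s -> 'I_D -> U) (a : 'I_s -> 'I_D -> V).
Variables (B Z : {set V}).
Local Notation first_phase := (first_phase a Z).
Local Notation partial_copy := (partial_copy T hub nb a B Z).
Local Notation copy_edges := (@copy_edges U V T s D hub nb a B Z).
Local Notation zeta := ((s * D)%:R / m%:R : R).
Local Notation meets_reserve := [set e : {set V} | ~~ [disjoint e & Z]].

(* Edges touching the reserve are few in a partial copy, so colouring them only costs a factor 2. *)
Definition thin_prob (e : {set V}) : R :=
  if e \in first_phase then (if (e \in G0) && ~~ [disjoint e & Z] then 2^-1 else zeta * p) else 0.

Hypothesis m_gt0 : (0 < m)%N.
Hypothesis p_ge0 : 0 <= p.
Hypothesis p_le1 : p <= 1.
Hypothesis slots_le : (s * D <= m)%N.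

Let zeta_le1 : zeta <= 1.
Proof. by rewrite ler_pdivrMr ?ltr0n // mul1r ler_nat. Qed.

Let zeta_ge0 : 0 <= zeta.
Proof. by rewrite divr_ge0. Qed.

Lemma edge_prob01 e : 0 <= edge_prob G0 p e <= 1.
Proof. by rewrite /edge_prob; case: ifP => _; [|case: ifP => _]; rewrite ?lexx ?ler01 ?p_ge0 ?p_le1. Qed.

Lemma edge_prob_ge0 e : 0 <= edge_prob G0 p e.
Proof. by case/andP: (edge_prob01 e). Qed.

Lemma edge_prob_le1 e : edge_prob G0 p e <= 1.
Proof. by case/andP: (edge_prob01 e). Qed.

Lemma edge_prob_first_phase e : e \in first_phase -> p <= edge_prob G0 p e.
Proof. by rewrite inE /edge_prob => /andP[eV _]; case: ifP => // _; rewrite eV. Qed.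

Lemma thin_prob_ge0 e : 0 <= thin_prob e.
Proof. by rewrite /thin_prob; case: ifP => // _; case: ifP => _; rewrite ?invr_ge0 // mulr_ge0. Qed.

Lemma thin_prob_le e : thin_prob e <= edge_prob G0 p e.
Proof.
rewrite /thin_prob; case: ifP => e_first; last exact: edge_prob_ge0.
case: ifP => [/andP[eG _]|_]; first by rewrite /edge_prob eG; lra.
by apply: le_trans (edge_prob_first_phase e_first); rewrite -[leRHS]mul1r ler_wpM2r.
Qed.

Lemma thin_prob01 e : 0 <= thin_prob e <= 1.
Proof. by rewrite thin_prob_ge0 (le_trans (thin_prob_le e)) ?edge_prob_le1. Qed.

Lemma thin_prob_scaled e (k : nat) : (s * D <= m - k)%N -> (k <= m)%N ->
  (e \in G0) && ~~ [disjoint e & Z] ==> (2 * k <= m)%N ->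
  thin_prob e * m%:R <= edge_prob G0 p e * (m - k)%:R.
Proof.
move=> slots_k k_le reserve_k; rewrite /thin_prob; case: ifP => e_first; last first.
  by rewrite mul0r mulr_ge0 ?edge_prob_ge0.
case: ifP reserve_k => [/andP[eG _] /= k2|_ _].
  rewrite /edge_prob eG mul1r natrB //.
  have : (2 * k)%:R <= m%:R :> R by rewrite ler_nat.
  by rewrite natrM; lra.
rewrite mulrAC divfK ?pnatr_eq0 -?lt0n // mulrC; apply: ler_pM => //.
  exact: edge_prob_first_phase.
by rewrite ler_nat.
Qed.

Hypothesis T_graph : is_graph T.
Hypothesis T_degree : forall u, (degree T u <= d)%N.
Hypothesis stars : hub_stars T hub nb.
Hypothesis a_reserve : forall i l, a i l \notin Z.
Hypothesis base_reserve : [disjoint B & Z].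
Hypothesis card_UV : #|U| = #|V|.
Hypothesis enough_colours : (#|hubless_edges T hub| + s * D <= m)%N.
Hypothesis small_reserve : (2 * (d * #|Z|) <= m)%N.
Hypothesis slots_reserve : (s * D + d * #|Z| <= m)%N.

Local Notation mu := (coloured_pmf (m := m) (edge_prob G0 p) thin_prob setT).

Lemma prob_coloured_partial_copy_ge (good : pred {ffun {set V} -> bool}) :
  (forall b, good b -> exists y : partial_copy, forall e, e \in copy_edges y -> b e) ->
  prob (bernoulli_pmf thin_prob) good <= prob mu (has_rainbow copy_edges setT).
Proof.
move=> good_copy.
apply: le_trans (mcdiarmid_coupling (J1 := meets_reserve) (k1 := d * #|Z|) (k2 := m - s * D)
  m_gt0 thin_prob_ge0 thin_prob_le edge_prob_le1 _ _ _ _).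
- rewrite /prob -(expect_presence (edge_prob G0 p) thin_prob m_gt0); apply: prob_le => [|f].
    exact: coloured_pmf_pmf m_gt0 thin_prob_ge0 thin_prob_le edge_prob_le1 _.
  case/good_copy=> y y_present; apply/existsP; exists y; apply/rainbow_inP; split=> [e /y_present|e e'].
    by rewrite ffunE.
  by rewrite setI0 inE.
- by move=> y; apply: card_copy_edges_reserve.
- by move=> y; have := card_copy_edges y; move: enough_colours; move: #|copy_edges y| => x; lia.
- move=> e; rewrite inE => e_reserve; apply: thin_prob_scaled.
  + by move: slots_reserve; lia.
  + by move: small_reserve; lia.
  by rewrite small_reserve implybT.
move=> e; rewrite inE negbK => e_off; apply: thin_prob_scaled; rewrite ?e_off ?andbF //; lia.
Qed.

Lemma two_phases (e1 e2 : R) (good : pred {ffun {set V} -> bool}) : e1 <= 1 ->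
  (forall b, good b -> exists y : partial_copy, forall e, e \in copy_edges y -> b e) ->
  1 - e2 <= prob (bernoulli_pmf thin_prob) good ->
  (forall (r : 'I_s -> V) (K : {set option 'I_m}), injective r -> (forall j, r j \in B) ->
     #|K| = (s * D)%N -> None \notin K ->
     1 - e1 <= prob mu (fun g => [exists t : {perm 'I_s},
        rainbow_on K (matching_slots (completion_slot a r) t) g])) ->
  (1 - e1) * (1 - e2) <= perturbed_prob G0 p (fun E (c : colouring E m) => has_rainbow_copy T c).
Proof.
move=> e1_le1 good_copy good_likely completion_likely.
have mu_pmf : is_pmf mu by exact: coloured_pmf_pmf m_gt0 thin_prob_ge0 thin_prob_le edge_prob_le1 _.
apply: le_trans (perturbed_prob_ge G0 T p_ge0 p_le1 m_gt0 thin_prob).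
rewrite /prob (expect_merge mu_pmf [predC first_phase]).
apply: le_trans (_ : expect mu (fun f => (1 - e1) * (has_rainbow copy_edges setT f)%:R) <= _).
  rewrite expectZ; apply: ler_wpM2l; first by rewrite subr_ge0.
  exact: le_trans good_likely (prob_coloured_partial_copy_ge good_copy).
apply: ler_expect => // f; case: (boolP (has_rainbow _ _ f)) => [/existsP[y y_rainbow]|_]; last first.
  by rewrite mulr0 prob_ge0.
rewrite mulr1; have [r [r_inj r_new r_base]] := exists_leftover_enum stars card_UV y.
have [K [card_K K_none f_K]] := exists_unused_colours f y enough_colours.
apply: le_trans (completion_likely r K r_inj r_base card_K K_none) _; apply: prob_le => // g.
by case/existsP=> t; apply: coloured_copy_merge y_rainbow r_inj r_new r_base K_none f_K.
Qed.

End TwoPhases.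

(** * Good first-phase graphs contain a partial copy *)

Section TreeStars.
Variables (U : finType) (T : {set {set U}}) (par : U -> U) (dep : U -> nat) (cuts S : {set U}).
Variables (s D : nat) (hub : 'I_s -> U) (nb : 'I_s -> 'I_D -> U).
Local Notation forest_edge := (forest_edge par dep).

Record forest_stars : Prop := ForestStars {
  star_hub_inj : injective hub;
  star_edge : forall i l, forest_edge (hub i) (nb i l);
  star_nbr : forall i u, forest_edge (hub i) u -> exists l, u = nb i l;
  star_nb_inj : forall i, injective (nb i) }.

Hypothesis edgeE : forest_edge =2 adj T.
Hypothesis T_graph : is_graph T.
Hypothesis stars : forest_stars.
Hypothesis hub_scat : scattered par dep cuts S.
Hypothesis hub_S : hub_set hub \subset S.

Lemma hub_in_S i : hub i \in S.
Proof. by apply: (subsetP hub_S); apply: imset_f. Qed.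

Lemma star_nb_not_hub i l : nb i l \notin hub_set hub.
Proof.
apply/negP => /(subsetP hub_S) nb_S.
have := scattered_eq hub_scat (hub_in_S i) nb_S (within2_edge (star_edge stars i l)) (within2_refl _ _ _).
by have := star_edge stars i l => /[swap] <-; rewrite forest_edge_irr.
Qed.

Lemma star_inj : injective (fun p : 'I_s * 'I_D => nb p.1 p.2).
Proof.
move=> [i l] [j l'] /= nb_eq; have near_j := within2_edge (star_edge stars j l'); rewrite -nb_eq in near_j.
have /(star_hub_inj stars) ij := scattered_eq hub_scat (hub_in_S i) (hub_in_S j)
  (within2_edge (star_edge stars i l)) near_j.
by move: nb_eq; rewrite -ij => /(star_nb_inj stars) ->.
Qed.

Lemma forest_nbrs_hubs : forest_nbrs par dep (hub_set hub) = [set nb p.1 p.2 | p : 'I_s * 'I_D].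
Proof.
apply/setP => w; apply/forest_nbrsP/imsetP => [[_ /imsetP[i _ ->] /(star_nbr stars)[l ->]]|[[i l] _ ->]].
  by exists (i, l).
by exists (hub i); rewrite ?imset_f //; apply: star_edge.
Qed.

Lemma card_forest_nbrs_hubs : #|forest_nbrs par dep (hub_set hub)| = (s * D)%N.
Proof. by rewrite forest_nbrs_hubs (card_imset _ star_inj) card_prod !card_ord. Qed.

Lemma hub_stars_of_forest : hub_stars T hub nb.
Proof.
split=> [|i l|e eT]; [exact: star_hub_inj | exact: star_nb_not_hub |].
rewrite -setI_eq0 => /set0Pn[u /setIP[ue /imsetP[i _ u_hub]]].
have := subsetP T_graph _ eT; rewrite inE => /cards2P[x [y [_ e_xy]]].
have [w -> /(star_nbr stars)[l ->]] : exists2 w, e = [set hub i; w] & forest_edge (hub i) w.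
  move: ue; rewrite e_xy !inE -u_hub => /orP[] /eqP->.
    by exists y; rewrite // edgeE /adj -e_xy.
  by exists x; rewrite ?edgeE /adj setUC // -e_xy.
by exists i, l.
Qed.

Lemma card_hubless_edges : (#|hubless_edges T hub| + s * D <= #|T|)%N.
Proof.
pose hub_edges : {set {set U}} := [set [set hub p.1; nb p.1 p.2] | p : 'I_s * 'I_D].
have card_hub_edges : #|hub_edges| = (s * D)%N.
  rewrite card_imset ?card_prod ?card_ord // => -[i l] [j l'] /= edge_eq.
  apply: star_inj => /=; have := set22 (hub i) (nb i l); rewrite edge_eq !inE => /orP[/eqP nb_hub|/eqP //].
  by have := star_nb_not_hub i l; rewrite nb_hub imset_f.
have disj : hubless_edges T hub :&: hub_edges = set0.
  apply/setP => e; rewrite in_setI in_set0; apply/negP => /andP[/setIdP[_ dis] /imsetP[[i l] _ e_hub]].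
  by have := disjointFr dis (x := hub i); rewrite e_hub set21 imset_f // => /(_ isT).
rewrite -card_hub_edges -cardsUI disj cards0 addn0; apply/subset_leq_card/subsetP => e.
rewrite inE => /orP[/setIdP[]//|/imsetP[[i l] _ ->]].
by have := star_edge stars i l; rewrite edgeE.
Qed.

End TreeStars.

Lemma exists_forest_stars (U : finType) (par : U -> U) (dep : U -> nat) (Q : {set U}) (s D : nat) :
  #|Q| = s -> (forall u, u \in Q -> #|[set v | forest_edge par dep u v]| = D) ->
  exists (hub : 'I_s -> U) (nb : 'I_s -> 'I_D -> U),
    hub_set hub = Q /\ forest_stars par dep hub nb.
Proof.
move=> card_Q deg_Q; pose hub (i : 'I_s) : U := enum_val (cast_ord (esym card_Q) i).
have hub_Q i : hub i \in Q by apply: enum_valP.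
pose nb i (l : 'I_D) : U := enum_val (cast_ord (esym (deg_Q _ (hub_Q i))) l).
exists hub, nb; split; last split.
- apply/setP => u; apply/imsetP/idP => [[i _ ->]|uQ]; first exact: hub_Q.
  by exists (cast_ord card_Q (enum_rank_in uQ u)); rewrite // /hub cast_ordK enum_rankK_in.
- by move=> i j /enum_val_inj/cast_ord_inj.
- by move=> i l; have := enum_valP (cast_ord (esym (deg_Q _ (hub_Q i))) l); rewrite inE.
- move=> i u iu; have u_nbr : u \in [set v | forest_edge par dep (hub i) v] by rewrite inE.
  by exists (cast_ord (deg_Q _ (hub_Q i)) (enum_rank_in u_nbr u)); rewrite /nb cast_ordK enum_rankK_in.
by move=> i l l' /enum_val_inj/cast_ord_inj.
Qed.

Definition reserve_region (k : 'I_3) : region := nth Bulk [:: EarlyReserve; MidReserve; LateReserve] k.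

Definition reserves (V : finType) (reg : V -> region) : {set V} := [set x | [exists k, reg x == reserve_region k]].

Section GoodGraph.
Variables (R : realType) (U V : finType) (T : {set {set U}}) (G0 : {set {set V}}) (p : R).
Variables (m s D d b beta : nat) (par : U -> U) (dep pos : U -> nat) (cuts : {set U}).
Variables (reg : V -> region) (a : 'I_s -> 'I_D -> V).
Local Notation Z := (reserves reg).
Local Notation zeta := ((s * D)%:R / m%:R : R).

Definition base_nbrs x k := [set y in Reg reg k | adj G0 x y].

Definition few_kept_nbrs (g : {ffun {set V} -> bool}) (xk : V * 'I_3) : bool :=
  (#|[set y in base_nbrs xk.1 (reserve_region xk.2) | g [set xk.1; y]]| <=
     #|base_nbrs xk.1 (reserve_region xk.2)| %/ 16)%N.

Definition good_graph (g : {ffun {set V} -> bool}) : bool :=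
  ~~ unjoined_pair (Reg reg Tuples) beta g && ~~ [exists xk, few_kept_nbrs g xk].

Hypothesis G0_graph : is_graph G0.
Hypothesis slot_reg : slot_set a = Reg reg Tuples.

Lemma first_phase_off_slots x z : x != z -> x \notin slot_set a -> z \notin slot_set a ->
  [set x; z] \in first_phase a Z.
Proof.
move=> xz xA zA; rewrite inE inE cards2 xz /=; apply/orP; left.
by rewrite disjoints_subset; apply/subsetP => u; rewrite !inE => /orP[] /eqP->.
Qed.

Lemma reserves_reg k y : reg y = reserve_region k -> y \in Z.
Proof. by move=> y_k; rewrite inE; apply/existsP; exists k; rewrite y_k. Qed.

Lemma first_phase_reserve x k y : y \in base_nbrs x (reserve_region k) ->
  ([set x; y] \in first_phase a Z) && ~~ [disjoint [set x; y] & Z].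
Proof.
rewrite inE in_Reg => /andP[/eqP/reserves_reg yZ xy].
have meets : ~~ [disjoint [set x; y] & Z] by apply/negP => /disjointFr/(_ (set22 _ _)); rewrite yZ.
by rewrite inE meets orbT (subsetP G0_graph _ xy).
Qed.

Lemma prob_good_graph_ge t : (0 < m)%N -> 0 <= p -> p <= 1 -> (s * D <= m)%N ->
  (forall x k, t <= #|base_nbrs x (reserve_region k)| %/ 16)%N -> zeta * p <= 2^-1 ->
  1 - (4 ^+ #|V| * (1 - zeta * p) ^+ (beta ^ 2) + (#|V| * 3)%:R * 2^-1 ^+ t) <=
  prob (bernoulli_pmf (thin_prob G0 p m a Z)) good_graph.
Proof.
move=> m_gt0 p_ge0 p_le1 slots_le many_nbrs thin_half; set r := thin_prob _ _ _ _ _.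
have r01 e : 0 <= r e <= 1 by apply: thin_prob01.
have r_pmf := bernoulli_pmf_pmf r01.
pose bad := predU (unjoined_pair (Reg reg Tuples) beta) (fun g => [exists xk, few_kept_nbrs g xk]).
rewrite (eq_prob _ (B := predC bad)) => [|g]; last by rewrite /= negb_or.
rewrite probC // lerD2l lerN2; apply: le_trans (prob_predU_le r_pmf _ _) _; apply: lerD.
  apply: prob_unjoined_pair_le => //; [by rewrite mulr_ge0 ?divr_ge0 | by lra |].
  move=> x z; rewrite -slot_reg => xA zA xz; rewrite /r /thin_prob first_phase_off_slots //.
  by case: ifP.
apply: le_trans (prob_exists_le r_pmf predT _) _.
have -> : (#|V| * 3)%:R * 2^-1 ^+ t = \sum_(xk : V * 'I_3) 2^-1 ^+ t :> R.
  by rewrite sumr_const card_prod card_ord -[RHS]mulr_natl.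
apply: ler_sum => -[x k] _; apply: le_trans (prob_few_nbrs_le r01 _ _) _.
- move=> y y_nbr; rewrite /r /thin_prob; case/andP: (first_phase_reserve y_nbr) => -> ->.
  by case/setIdP: y_nbr => _; rewrite /adj => ->.
- rewrite inE negb_and /adj setUid; apply/orP; right; apply/negP => /(subsetP G0_graph).
  by rewrite inE cards1.
by apply: ler_wiXn2l; rewrite ?invr_ge0 ?invf_le1 ?ler1n ?ltr0n //; apply: many_nbrs.
Qed.

Definition first_phase_adj (g : {ffun {set V} -> bool}) : rel V :=
  fun x y => ([set x; y] \in first_phase a Z) && g [set x; y].

Lemma good_graph_joined g : good_graph g -> joined (first_phase_adj g) (Reg reg Tuples) beta.
Proof.
case/andP=> joined_g _; apply: joined_of_pairs joined_g _ => x z; rewrite -slot_reg => xA zA xz g_xz.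
by rewrite /first_phase_adj g_xz first_phase_off_slots.
Qed.

Lemma good_graph_degree g x k : good_graph g ->
  (#|base_nbrs x (reserve_region k)| %/ 16 <= deg_in (first_phase_adj g) (Reg reg (reserve_region k)) x)%N.
Proof.
case/andP=> _ /existsPn/(_ (x, k)); rewrite -ltnNge => /ltnW/leq_trans; apply.
apply/subset_leq_card/subsetP => y /setIdP[y_nbr g_xy]; rewrite inE /first_phase_adj g_xy andbT.
by case/andP: (first_phase_reserve y_nbr) => -> _; case/setIdP: y_nbr => ->.
Qed.

Variables (hub : 'I_s -> U) (nb : 'I_s -> 'I_D -> U).
Variables (i j : nat) (absorbers fillers : {set U}) (spare : U -> V).
Local Notation hubs := (hub_set hub).
Hypothesis edgeE : forest_edge par dep =2 adj T.
Hypothesis T_graph : is_graph T.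
Hypothesis T_degree : forall u, (degree T u <= d)%N.
Hypothesis pos_pieces : pieces par dep cuts pos b.
Hypothesis beta_gt0 : (0 < beta)%N.
Hypothesis layout : tree_layout par dep pos cuts i j hubs absorbers fillers.
Hypothesis stars : forest_stars par dep hub nb.
Hypothesis a_inj : injective (fun p : 'I_s * 'I_D => a p.1 p.2).
Hypothesis spare_inj : {in absorbers &, injective spare}.
Hypothesis spare_im : spare @: absorbers = Reg reg LateReserve :|: Reg reg LateBulk.
Hypothesis card_UV : #|U| = #|V|.
Hypothesis rooms : forall G : rel V,
  (forall x k, #|base_nbrs x (reserve_region k)| %/ 16 <= deg_in G (Reg reg (reserve_region k)) x)%N ->
  embedding_room par dep pos cuts i j d (b * (d.+1 * beta)) hubs absorbers fillers G reg.

Let nb_inj : injective (fun p : 'I_s * 'I_D => nb p.1 p.2) :=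
  star_inj stars (early_scattered layout) (subsetUl _ _).

Definition place (u : U) : V := if [pick p : 'I_s * 'I_D | nb p.1 p.2 == u] is Some p then a p.1 p.2 else spare u.

Lemma place_nb k l : place (nb k l) = a k l.
Proof.
rewrite /place; case: pickP => [q /eqP nb_eq|/(_ (k, l))]; last by rewrite eqxx.
by have -> := nb_inj (nb_eq : nb q.1 q.2 = nb (k, l).1 (k, l).2).
Qed.

Lemma good_graph_embedding g : good_graph g -> exists phi : U -> V,
  [/\ {in forest_nbrs par dep hubs, phi =1 place},
      embeds par dep (first_phase_adj g) (~: hubs) phi &
      forall x, x \notin phi @: (~: hubs) -> reg x = Base].
Proof.
move=> g_good; have hub_nbrsE := forest_nbrs_hubs stars.
apply: (hubless_tree_embedding (d := d) (spare := spare) _ pos_pieces _ beta_gt0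
  (good_graph_joined g_good) layout (rooms _)) => //.
- by move=> u; apply: leq_trans (T_degree u); apply/eq_leq/eq_card => v; rewrite !inE edgeE.
- by move=> x y; rewrite /first_phase_adj setUC.
- by move=> x k; apply: good_graph_degree.
- rewrite hub_nbrsE => _ _ /imsetP[[k l] _ ->] /imsetP[[k' l'] _ ->] /=; rewrite !place_nb => a_eq.
  by have [-> ->] := a_inj (a_eq : a (k, l).1 (k, l).2 = a (k', l').1 (k', l').2).
by rewrite hub_nbrsE -slot_reg -imset_comp; apply: eq_imset => -[k l] /=; apply: place_nb.
Qed.

Lemma good_graph_partial_copy g : good_graph g ->
  exists y : partial_copy T hub nb a (Reg reg Base) Z, forall e, e \in copy_edges y -> g e.
Proof.
case/good_graph_embedding=> phi [phi_place [phi_inj phi_edge] phi_cover].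
have edge (e : {set U}) : e \in hubless_edges T hub -> (phi @: e \in first_phase a Z) && g (phi @: e).
  case/setIdP=> eT dis; have := subsetP T_graph _ eT; rewrite inE => /cards2P[x [y [_ e_xy]]].
  have [xH yH] : x \in ~: hubs /\ y \in ~: hubs.
    by rewrite !in_setC !(disjointFr dis) // e_xy ?set21 ?set22.
  by have := phi_edge x y xH yH; rewrite edgeE /adj -e_xy => /(_ eT); rewrite e_xy imsetU !imset_set1.
pose psi : {ffun U -> V} := finfun phi.
have psi_im (S : {set U}) : psi @: S = phi @: S by apply: eq_imset => u; rewrite ffunE.
have psi_copy : is_partial_copy T hub nb a (Reg reg Base) Z psi.
  apply/and4P; split.
  - by apply/dinjectiveP => u v uH vH; rewrite !ffunE; apply: phi_inj.
  - apply/forallP => k; apply/forallP => l; rewrite ffunE phi_place ?place_nb //.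
    by rewrite (forest_nbrs_hubs stars); apply/imsetP; exists (k, l).
  - apply/forallP => x; rewrite psi_im; case: (boolP (x \in phi @: ~: hubs)) => //= /phi_cover x_base.
    by rewrite in_Reg x_base.
  by apply/forall_inP => e /edge/andP[]; rewrite psi_im.
exists (Sub psi psi_copy : partial_copy T hub nb a (Reg reg Base) Z) => _ /imsetP[e /edge/andP[_ g_e] ->].
by rewrite SubK psi_im.
Qed.

End GoodGraph.

(** * Placing the regions and the parts of the tree *)

Lemma exists_region_map (V : finType) (X : region -> {set V}) :
  (forall k l x, x \in X k -> x \in X l -> k = l) ->
  exists reg : V -> region, forall k, k != Bulk -> Reg reg k = X k.
Proof.
move=> X_disjoint; pose reg x := nth Bulk regions (find (fun k => x \in X k) regions).
exists reg => k k_bulk; apply/setP => x; rewrite in_Reg.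
have k_region : k \in regions by case: k {k_bulk}.
case: (boolP (has (fun k => x \in X k) regions)) => [has_k|/hasPn no_k].
  have x_reg : x \in X (reg x) := nth_find Bulk has_k.
  by apply/eqP/idP => [<- //|xk]; apply: X_disjoint x_reg xk.
rewrite (negbTE (no_k k k_region)) /reg hasNfind ?nth_default //; last by apply/hasPn.
by rewrite eq_sym (negbTE k_bulk).
Qed.

Section Reserves.
Variables (V : finType) (G : rel V) (L K : nat).
Hypothesis G_sym : symmetric G.
Hypothesis V_gt0 : (0 < #|V|)%N.
Hypothesis L_gt0 : (0 < L)%N.
Hypothesis min_degree : forall v, (#|V| <= L * #|[set w | G v w]|)%N.
Hypothesis K_large : (4 * (4 * L - 1) ^ K <= (4 * L) ^ K)%N.

Lemma dominating_family (F : {set V}) (t : nat -> nat) n :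
  (2 * L * (#|F| + \sum_(k < n) t k) <= #|V|)%N -> (forall k, #|V| ^ K < 2 ^ t k)%N ->
  exists Y : nat -> {set V}, [/\ forall k, (k < n)%N -> [disjoint Y k & F],
    forall k l, (k < l)%N -> (l < n)%N -> [disjoint Y l & Y k] &
    forall k, (k < n)%N -> #|Y k| = t k /\ forall v, (t k <= K * deg_in G (Y k) v)%N].
Proof.
move=> + t_large; elim: n => [|n IH] room; first by exists (fun=> set0); split.
have [|Y [Y_F Y_Y Y_dom]] := IH.
  by apply: leq_trans room; rewrite leq_mul2l leq_add2l big_ord_recr leq_addr orbT.
pose used := F :|: \bigcup_(k < n) Y k.
have card_used : (#|used| <= #|F| + \sum_(k < n) t k)%N.
  apply: leq_trans (leq_card_setU _ _) _; rewrite leq_add2l.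
  apply: leq_trans (card_bigcup_le _ _) _; apply: leq_sum => k _.
  by have [-> _] := Y_dom k (ltn_ord k).
have [|Z [Z_used card_Z Z_dom]] := dominating_set G_sym V_gt0 L_gt0 min_degree (F := used) _ K_large (t_large n).
  by apply: leq_trans room; rewrite leq_mul2l big_ord_recr /= addnA leq_add2r card_used orbT.
have lt_n k : (k < n.+1)%N -> (k == n) = false -> (k < n)%N.
  by rewrite ltnS leq_eqVlt => /orP[->|].
exists (fun k => if k == n then Z else Y k); split.
- move=> k; case: eqVneq => [_ _|/negbTE kn k_lt]; last by apply: Y_F; apply: lt_n.
  by apply: disjointWr Z_used; rewrite subsetUl.
- move=> k l kl l_lt; have k_lt : (k < n)%N by apply: leq_trans kl _.
  rewrite (ltn_eqF k_lt); case: eqVneq => [_|/negbTE ln]; last by apply: Y_Y => //; apply: lt_n.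
  apply: disjointWr Z_used; apply: subset_trans (subsetUr _ _).
  exact: (bigcup_sup (Ordinal k_lt)).
by move=> k; case: eqVneq => [-> _|/negbTE kn k_lt]; [split | apply: Y_dom; apply: lt_n].
Qed.

Lemma exists_reserve_regions (A B : {set V}) (t : nat -> nat) (late_bulk : nat) :
  [disjoint A & B] -> (2 * L * (#|A| + #|B| + (t 0 + t 1 + t 2)) <= #|V|)%N ->
  (#|A| + #|B| + (t 0 + t 1 + t 2) + late_bulk <= #|V|)%N -> (forall k, #|V| ^ K < 2 ^ t k)%N ->
  exists reg : V -> region,
  [/\ Reg reg Tuples = A, Reg reg Base = B, #|Reg reg LateBulk| = late_bulk &
    forall k : 'I_3, #|Reg reg (reserve_region k)| = t k /\
      forall v, (t k <= K * deg_in G (Reg reg (reserve_region k)) v)%N].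
Proof.
move=> AB room total t_large.
have sum_t : (\sum_(k < 3) t k = t 0 + t 1 + t 2)%N by rewrite !big_ord_recr big_ord0.
have card_AB : #|A :|: B| = (#|A| + #|B|)%N by rewrite -cardsUI (disjoint_setI0 AB) cards0 addn0.
have [|Y [Y_AB Y_Y Y_dom]] := @dominating_family (A :|: B) t 3 _ t_large; first by rewrite sum_t card_AB.
pose used := A :|: B :|: \bigcup_(k < 3) Y k.
have [|M M_used card_M] := @exists_subset_card _ (~: used) late_bulk.
  have : (#|used| <= #|A| + #|B| + (t 0 + t 1 + t 2))%N.
    rewrite -card_AB -sum_t; apply: leq_trans (leq_card_setU _ _) _; rewrite leq_add2l.
    apply: leq_trans (card_bigcup_le _ _) _; apply: leq_sum => k _.
    by have [-> _] := Y_dom k (ltn_ord k).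
  by have := cardsC used; move: total; clear; lia.
have Y_off k x : x \in Y k -> (k < 3)%N -> (x \in A) = false /\ (x \in B) = false.
  by move=> xY k3; have /negbT := disjointFr (Y_AB k k3) xY; rewrite in_setU => /norP[/negbTE-> /negbTE->].
have M_off x : x \in M -> x \notin used by move/(subsetP M_used); rewrite inE.
have M_Y k x : x \in Y k -> x \in M -> (k < 3)%N -> False.
  move=> xk /M_off; rewrite in_setU => /norP[_ /negP xY] k3; apply: xY.
  by apply/bigcupP; exists (Ordinal k3).
have M_AB x : x \in M -> (x \in A) = false /\ (x \in B) = false.
  by move/M_off; rewrite !in_setU => /norP[/norP[/negbTE-> /negbTE->] _].
have Y_sep k l x : x \in Y k -> x \in Y l -> (k < l)%N -> (l < 3)%N -> False.
  by move=> xk xl kl l3; rewrite (disjointFr (Y_Y k l kl l3) xl) in xk.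
pose X k := match k with Tuples => A | Base => B | EarlyReserve => Y 0 | MidReserve => Y 1
  | LateReserve => Y 2 | LateBulk => M | Bulk => set0 end.
have X_disjoint k l x : (region_index k < region_index l)%N -> x \in X k -> x \in X l -> False.
{ case: l => //=; case: k => //= _ xk xl.
  all: try by rewrite (disjointFr AB xk) in xl.
  all: try by rewrite inE in xl.
  all: try by have [] := Y_off _ _ xl isT; rewrite xk.
  all: try by have [] := M_AB _ xl; rewrite xk.
  all: try exact: (M_Y _ _ xk xl isT).
  all: exact: (Y_sep _ _ _ xk xl isT isT). }
have [|reg regE] := @exists_region_map V X.
  move=> k l x xk xl; apply: (can_inj region_indexK).
  by case: (ltngtP (region_index k) (region_index l)) => // lt; [case: (X_disjoint k l x) | case: (X_disjoint l k x)].
exists reg; split; rewrite ?regE //.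
by move=> [[|[|[|//]]] k3]; rewrite /reserve_region /= regE //; apply: Y_dom.
Qed.

End Reserves.

Record tree_parts (U : finType) (T : {set {set U}}) (d b max_cuts x y : nat) (par : U -> U)
    (dep pos : U -> nat) (cuts : {set U}) (i j : nat) (Se Sl : {set U}) (D : nat) : Prop := TreeParts {
  parts_edge : forest_edge par dep =2 adj T;
  parts_pieces : pieces par dep cuts pos b;
  parts_cuts : (#|cuts| <= max_cuts)%N;
  parts_le : (i <= j)%N;
  parts_early : (#|early pos i| <= x + b)%N;
  parts_late : (y <= #|late pos j| <= y + b)%N;
  parts_Se : Se \subset early pos i /\ scattered par dep cuts Se;
  parts_Sl : Sl \subset late pos j /\ scattered par dep cuts Sl;
  parts_many_Se : forall k, ((d + 1) ^ 2 * max_cuts + (d + 1) ^ 4 * k <= x -> k <= #|Se|)%N;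
  parts_many_Sl : forall k, ((d + 1) ^ 2 * max_cuts + (d + 1) ^ 4 * k <= y -> k <= #|Sl|)%N;
  parts_popular : (#|Se| <= d * #|[set u in Se | degree T u == D]|)%N }.

Lemma tree_degree_gt0 (U : finType) (T : {set {set U}}) u :
  is_tree T -> (1 < #|U|)%N -> (0 < degree T u)%N.
Proof.
move=> [_ _ connected _] U_gt1.
have [v vu] : exists v, v != u.
  have : (0 < #|[set~ u]|)%N by rewrite cardsC1; case: #|U| U_gt1 => [|[]].
  by case/card_gt0P=> v; rewrite !inE; exists v.
have /connectP[[|w p] /= path_p v_last] := connected u v; first by rewrite v_last eqxx in vu.
by case/andP: path_p => uw _; apply/card_gt0P; exists w; rewrite inE.
Qed.

Lemma exists_tree_parts (U : finType) (T : {set {set U}}) (d h max_cuts x y : nat) :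
  is_tree T -> (forall u, degree T u <= d)%N -> (0 < d)%N -> (0 < h)%N -> (1 < #|U|)%N ->
  (x + y + 2 * (h * d ^ h) < #|U|)%N -> (forall c, c * h <= #|U| + h -> c <= max_cuts)%N ->
  ((d + 1) ^ 2 * max_cuts + (d + 1) ^ 4 <= x)%N ->
  exists par dep pos cuts i j Se Sl D, (0 < D <= d)%N /\
    tree_parts T d (h * d ^ h) max_cuts x y par dep pos cuts i j Se Sl D.
Proof.
move=> tree deg d_gt0 h_gt0 U_gt1 U_large cuts_le x_large.
have [par [dep [pos [cuts [i [j [Se [Sl [[edgeE ps card_cuts ij]
  [/andP[x_le early_le] late_size [Se_early Se_scat Se_many] [Sl_late Sl_scat Sl_many]]]]]]]]]]] :=
  tree_selection tree deg d_gt0 h_gt0 U_large.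
have max_cutsP := cuts_le _ card_cuts.
have many (q S k : nat) : (q <= (d + 1) ^ 2 * #|cuts| + (d + 1) ^ 4 * S)%N ->
    ((d + 1) ^ 2 * max_cuts + (d + 1) ^ 4 * k <= q)%N -> (k <= S)%N.
  move=> q_le le_q; have pow_gt0 : (0 < (d + 1) ^ 4)%N by rewrite expn_gt0 addn1.
  rewrite -(leq_pmul2l pow_gt0) -(leq_add2l ((d + 1) ^ 2 * max_cuts)).
  by apply: leq_trans le_q (leq_trans q_le _); rewrite leq_add2r leq_mul2l max_cutsP orbT.
have Se_gt0 : (0 < #|Se|)%N by apply: (many _ _ 1%N Se_many); rewrite muln1 (leq_trans x_large).
have [u _|D D_range D_popular] := popular_value (f := degree T) (d := d) _ Se_gt0.
  by rewrite deg tree_degree_gt0.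
exists par, dep, pos, cuts, i, j, Se, Sl, D; split=> //; split=> //.
- by move=> k k_le; apply: many Se_many _; apply: leq_trans k_le x_le.
by move=> k k_le; apply: many Sl_many _; apply: leq_trans k_le _; case/andP: late_size.
Qed.

Lemma exists_tree_layout (U : finType) (T : {set {set U}}) (d b max_cuts x y : nat) par dep pos
    cuts i j (Se Sl : {set U}) D s q ell :
  tree_parts T d b max_cuts x y par dep pos cuts i j Se Sl D -> (0 < d)%N ->
  (d * s + q <= #|Se|)%N -> (ell <= #|Sl|)%N ->
  exists (hub : 'I_s -> U) (nb : 'I_s -> 'I_D -> U) (absorbers fillers : {set U}),
  [/\ tree_layout par dep pos cuts i j (hub_set hub) absorbers fillers,
      forest_stars par dep hub nb, #|absorbers| = q & #|fillers| = ell].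
Proof.
move=> parts d_gt0 Se_large Sl_large.
have [Se_early Se_scat] := parts_Se parts; have [Sl_late Sl_scat] := parts_Sl parts.
have [|Q Q_pop card_Q] := @exists_subset_card _ [set u in Se | degree T u == D] s.
  rewrite -(leq_pmul2l d_gt0); apply: leq_trans (parts_popular parts).
  exact: leq_trans (leq_addr _ _) Se_large.
have Q_Se : Q \subset Se by apply: subset_trans Q_pop _; apply/subsetP => u /setIdP[].
have [|absorbers abs_sub card_abs] := @exists_subset_card _ (Se :\: Q) q.
  by rewrite cardsDS // card_Q; have := leq_pmull s d_gt0; move: Se_large; lia.
have [fillers fill_sub card_fill] := exists_subset_card Sl_large.
have [u uQ|hub [nb [hubQ stars]]] := @exists_forest_stars U par dep Q s D card_Q.
  have := subsetP Q_pop u uQ; rewrite inE => /andP[_ /eqP <-].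
  by apply: eq_card => v; rewrite !inE (parts_edge parts).
have abs_Se : absorbers \subset Se := subset_trans abs_sub (subsetDl _ _).
exists hub, nb, absorbers, fillers; split=> //; rewrite hubQ; split.
- exact: parts_le parts.
- exact: subset_trans Q_Se Se_early.
- exact: subset_trans abs_Se Se_early.
- exact: subset_trans fill_sub Sl_late.
- by rewrite disjoint_sym disjoints_subset; apply/subsetP => u /(subsetP abs_sub)/setDP[_]; rewrite inE.
- by apply: scatteredW Se_scat; rewrite subUset Q_Se.
exact: scatteredW Sl_scat.
Qed.

(** * Placing the tuples, the base and the reserves in the dense graph *)

Record tuple_constants (d L K c M A : nat) : Prop := TupleConstants {
  domination : (4 * (4 * L - 1) ^ K <= (4 * L) ^ K)%N;
  sparse_tuples : forall D, (0 < D <= d)%N -> (4 * L * D <= c)%N /\ (tuple_ratio L D * D <= c)%N;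
  family_ratio_le : forall D, (0 < D <= d)%N -> (tuple_family_ratio L D c <= M)%N;
  loss_ge3 : (3 <= A)%N;
  loss_ratio : forall D, (0 < D <= d)%N -> (16 * tuple_ratio L D <= A)%N }.

(* [k] is the size from which subsets of the tuples and of the base are dense to each other; only
   [s] of the [N] tuples are used, so that [N - s] vertices of the base are covered by the tree. *)
Record host (V : finType) (G : rel V) (L K c M D N s k : nat) (t : nat -> nat)
    (a : 'I_s -> 'I_D -> V) (reg : V -> region) : Prop := Host {
  host_slots : slot_set a = Reg reg Tuples;
  host_inj : injective (fun p : 'I_s * 'I_D => a p.1 p.2);
  host_base : #|Reg reg Base| = N;
  host_ratio : (#|V| <= M * N)%N;
  host_sparse : (c * N <= #|V|)%N;
  host_reserve : forall l : 'I_3, #|Reg reg (reserve_region l)| = t l /\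
    forall v, (t l <= K * deg_in G (Reg reg (reserve_region l)) v)%N;
  host_late_bulk : #|Reg reg LateBulk| = t 2%N;
  host_bulk : (#|V| <= #|Reg reg Bulk| + (s * D + N + (t 0 + t 1 + t 2) + t 2))%N;
  host_small : (4 * (16 * tuple_ratio L D) * k <= s)%N;
  host_dense : forall r : 'I_s -> V, injective r -> (forall j, r j \in Reg reg Base) ->
    superdense (16 * tuple_ratio L D) k (fun i j => joint_adj G a i (r j)) [set: 'I_s] [set: 'I_s] }.

Lemma superdense_subfamily (V : finType) (G : rel V) (L k N s D : nat) (a : 'I_N -> 'I_D -> V)
    (B : {set V}) (sN : (s <= N)%N) (r : 'I_s -> V) :
  #|B| = N -> (2 * L * (N - s) <= N)%N -> superdense L k (joint_adj G a) [set: 'I_N] B ->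
  injective r -> (forall j, r j \in B) ->
  superdense (2 * L) k (fun i j => joint_adj G (fun i => a (widen_ord sN i)) i (r j))
    [set: 'I_s] [set: 'I_s].
Proof.
move=> card_B few dense r_inj r_B; pose w := widen_ord sN.
have w_inj : injective w by move=> x y /(congr1 val) /= ?; apply: val_inj.
apply: (superdense_imset (r := joint_adj G a) w_inj r_inj).
have card_im (W : finType) (f : 'I_s -> W) : injective f -> #|f @: [set: 'I_s]| = s.
  by move=> f_inj; rewrite card_imset // cardsT card_ord.
have r_sub : r @: [set: 'I_s] \subset B by apply/subsetP => _ /imsetP[j _ ->].
apply: superdense_sub dense; rewrite ?subsetT // cardsDS ?subsetT // card_im //.
  by rewrite cardsT card_ord.
by rewrite card_B.
Qed.

Lemma exists_host (V : finType) (G : rel V) (d L K c M A D q : nat) (t : nat -> nat) :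
  symmetric G -> (0 < #|V|)%N -> (0 < L)%N -> (forall v, #|V| <= L * #|[set w | G v w]|)%N ->
  tuple_constants d L K c M A -> (0 < D <= d)%N -> (M <= #|V|)%N ->
  (forall l, #|V| ^ K < 2 ^ t l)%N -> (q <= t 2)%N ->
  (forall N, #|V| <= M * N -> A * t 2 <= N)%N ->
  (forall N, c * N <= #|V| ->
    2 * L * ((d + 1) * N + (t 0 + t 1 + t 2)) <= #|V| /\
    (d + 1) * N + (t 0 + t 1 + t 2) + t 2 <= #|V|)%N ->
  exists N k (a : 'I_(N - q) -> 'I_D -> V) reg, host G L K c M N k t a reg.
Proof.
move=> G_sym V_gt0 L_gt0 min_deg consts D_range M_le t_large q_le many room.
have /andP[D_gt0 D_le] := D_range; have [c_deg c_tuple] := sparse_tuples consts D_range.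
have [|N [k [a [B [[a_inj card_B a_B] [V_le N_le k_small dense]]]]]] :=
  superdense_tuple_family G_sym V_gt0 L_gt0 min_deg D_gt0 _ c_deg c_tuple.
  exact: leq_trans (family_ratio_le consts D_range) M_le.
have V_MN : (#|V| <= M * N)%N by apply: leq_trans V_le _; rewrite leq_mul2r (family_ratio_le consts) ?orbT.
have sN := leq_subr q N; set s := (N - q)%N in sN *.
have At2 := many N V_MN; have t2_3 : (3 * t 2 <= N)%N.
  by apply: leq_trans At2; rewrite leq_mul2r (loss_ge3 consts) orbT.
pose as_ (i : 'I_s) := a (widen_ord sN i).
have as_inj : injective (fun p : 'I_s * 'I_D => as_ p.1 p.2).
  move=> [i l] [j l'] /= a_eq; have := a_inj (widen_ord sN i, l) (widen_ord sN j, l') a_eq.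
  by case=> ij ->; congr (_, _); apply: val_inj.
have card_slots : #|slot_set as_| = (s * D)%N by rewrite (card_imset _ as_inj) card_prod !card_ord.
have slots_le : (s * D + N <= (d + 1) * N)%N.
  by rewrite mulnDl mul1n leq_add2r mulnC; apply: leq_mul.
have [room_dom room_bulk] := room N N_le.
have [|||reg [regT regB reg_bulk reg_res]] := exists_reserve_regions G_sym V_gt0 L_gt0 min_deg (domination consts)
  (A := slot_set as_) (B := B) (late_bulk := t 2%N) _ _ _ t_large.
- by rewrite disjoints_subset; apply/subsetP => _ /imsetP[[i l] _ ->]; rewrite in_setC a_B.
- by apply: leq_trans room_dom; rewrite leq_mul2l leq_add2r card_slots card_B slots_le orbT.
- by apply: leq_trans room_bulk; rewrite !leq_add2r card_slots card_B.
exists N, k, as_, reg; split; rewrite ?regT ?regB //.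
- have all_regs : [set x | reg x \in regions] = [set: V].
    by apply/setP => x; rewrite !inE; case: (reg x).
  have := card_Regs reg (isT : uniq regions); rewrite all_regs cardsT => ->.
  rewrite !big_cons big_nil regT regB reg_bulk card_slots card_B.
  have c0 : #|Reg reg EarlyReserve| = t 0%N := (reg_res ord0).1.
  have c1 : #|Reg reg MidReserve| = t 1%N := (reg_res (Ordinal (isT : 1 < 3)%N)).1.
  have c2 : #|Reg reg LateReserve| = t 2%N := (reg_res (Ordinal (isT : 2 < 3)%N)).1.
  by rewrite c0 c1 c2 -/s; clear; lia.
- have : (4 * (16 * tuple_ratio L D) * k * 2 = 128 * tuple_ratio L D * k)%N by clear; lia.
  by move: k_small t2_3 q_le; rewrite /s; move: (128 * _ * k)%N (4 * _ * k)%N; clear; lia.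
move=> r r_inj r_B; rewrite -[16%N]/(2 * 8)%N -mulnA; apply: superdense_subfamily dense _ _ => //.
rewrite mulnA; apply: leq_trans At2; apply: leq_mul; first exact: loss_ratio consts _ D_range.
by rewrite /s; move: q_le; clear; lia.
Qed.

Record scales := Scales {
  piece_height : nat;
  join_size : nat;
  max_cuts : nat;
  reserve_degree : nat -> nat;
  filler_count : nat;
  late_min : nat }.

Definition piece_bound (d : nat) (sc : scales) := (piece_height sc * d ^ piece_height sc)%N.
Definition piece_slack (d : nat) (sc : scales) := (piece_bound d sc * (d.+1 * join_size sc))%N.

(* A vertex has [1 / K] of a reserve as neighbours in the dense graph, and keeps a sixteenth of them. *)
Definition reserve_size (K : nat) (sc : scales) (l : nat) := (16 * K * reserve_degree sc l)%N.

Record admissible (d L K c M A n : nat) (sc : scales) (t := reserve_size K sc)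
    (slack := piece_slack d sc) : Prop := Admissible {
  height_gt0 : (0 < piece_height sc)%N;
  join_gt0 : (0 < join_size sc)%N;
  cuts_le : forall q, (q * piece_height sc <= n + piece_height sc -> q <= max_cuts sc)%N;
  reserve_degree_ge : forall l, (join_size sc <= reserve_degree sc l)%N;
  join_large : (n ^ K < 2 ^ join_size sc)%N;
  mid_degree_ge : (max_cuts sc + slack <= reserve_degree sc 1)%N;
  fillers_ge : (t 1 + slack <= filler_count sc)%N;
  late_degree_ge : (max_cuts sc + d * filler_count sc + slack <= reserve_degree sc 2)%N;
  late_min_ge : ((d + 1) ^ 2 * max_cuts sc + (d + 1) ^ 4 * filler_count sc <= late_min sc)%N;
  late_reserve_ge : (late_min sc + piece_bound d sc + slack <= t 2)%N;
  many_tuples : forall N, (n <= M * N -> A * t 2 <= N)%N;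
  early_degree_ge : forall N, (c * N <= n ->
    max_cuts sc + d * (d * N) + d * (2 * t 2) + slack <= reserve_degree sc 0)%N;
  dominated_room : forall N, (c * N <= n -> 2 * L * ((d + 1) * N + (t 0 + t 1 + t 2)) <= n)%N;
  free_room : forall N, (c * N <= n ->
    n %/ 2 + piece_bound d sc + slack + ((d + 1) * N + (t 0 + t 1 + t 2) + t 2) <= n)%N;
  colours_room : forall N, (c * N <= n -> 2 * (d * (t 0 + t 1 + t 2)) + d * N < n)%N;
  early_parts_room : forall N, (c * N <= n ->
    (d + 1) ^ 2 * max_cuts sc + (d + 1) ^ 4 * (d * N + 2 * t 2) <= n %/ 2)%N }.

Definition rainbow_matching_likely (R : realType) (L Lm D s : nat) (eps : R) : Prop :=
  forall (J S : finType) (K : {set S}) (mu : J -> S -> R) (m k : nat) (comp : rel 'I_s)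
    (slot : 'I_s * 'I_s -> 'I_D -> J),
  is_pmf mu -> #|K| = (s * D)%N -> (s * D < m)%N -> (m <= Lm * s)%N ->
  injective (fun p : ('I_s * 'I_s) * 'I_D => slot p.1 p.2) ->
  (forall i j l v, comp i j -> v \in K -> mu (slot (i, j) l) v = m%:R^-1) ->
  (4 * (16 * tuple_ratio L D) * k <= s)%N ->
  superdense (16 * tuple_ratio L D) k comp [set: 'I_s] [set: 'I_s] ->
  1 - eps <= prob mu (fun f =>
    [exists t in perfect_matchings comp, rainbow_on K (matching_slots slot t) f]).

Lemma completion_likely (R : realType) (V : finType) (G0 : {set {set V}}) (p eps : R)
    (q : {set V} -> R) (L K c M D N s k m Lm : nat) (t : nat -> nat) (a : 'I_s -> 'I_D -> V)
    (reg : V -> region) (r : 'I_s -> V) (C : {set option 'I_m}) :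
  host (adj G0) L K c M N k t a reg -> rainbow_matching_likely L Lm D s eps ->
  is_pmf (coloured_pmf (m := m) (edge_prob G0 p) q setT) ->
  injective r -> (forall j, r j \in Reg reg Base) -> #|C| = (s * D)%N -> None \notin C ->
  (s * D < m)%N -> (m <= Lm * s)%N ->
  1 - eps <= prob (coloured_pmf (edge_prob G0 p) q setT) (fun g =>
    [exists t : {perm 'I_s}, rainbow_on C (matching_slots (completion_slot a r) t) g]).
Proof.
move=> hostP likely mu_pmf r_inj r_base card_C C_none few_slots m_le.
have a_base i j l : a i l != r j.
  apply/eqP => a_r; have := r_base j; rewrite -a_r in_Reg.
  have : a i l \in Reg reg Tuples by rewrite -(host_slots hostP); apply/imsetP; exists (i, l).
  by rewrite in_Reg => /eqP ->.
have slot_inj : injective (fun p : ('I_s * 'I_s) * 'I_D => completion_slot a r p.1 p.2).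
  move=> [[i j] l] [[i' j'] l']; rewrite /completion_slot /= => slot_eq.
  have := set21 (a i l) (r j); have := set22 (a i l) (r j); rewrite slot_eq !inE.
  rewrite (negbTE (a_base i j' l)) orbF eq_sym (negbTE (a_base i' j l')) /=.
  move=> /eqP/r_inj -> /eqP a_eq.
  by have := host_inj hostP (a_eq : a (i, l).1 (i, l).2 = a (i', l').1 (i', l').2) => -[-> ->].
pose comp i j := joint_adj (adj G0) a i (r j).
apply: le_trans (likely _ _ C _ m k comp _ mu_pmf card_C few_slots m_le slot_inj _ (host_small hostP)
  (host_dense hostP r_inj r_base)) _; last first.
  by apply: prob_le => // g /exists_inP[u _ u_rainbow]; apply/existsP; exists u.
move=> i j l [col|] /forallP/(_ l) ij vC; last by rewrite vC in C_none.
by rewrite /coloured_pmf in_setT /edge_prob ifT ?mul1r.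
Qed.

Section RainbowCopy.
Variables (R : realType) (d L K c M A n : nat) (sc : scales).
Local Notation t := (reserve_size K sc).
Local Notation b := (piece_bound d sc).
Local Notation slack := (piece_slack d sc).
Local Notation ell := (filler_count sc).
Hypothesis d_gt0 : (0 < d)%N.
Hypothesis L_gt0 : (0 < L)%N.
Hypothesis K_gt0 : (0 < K)%N.
Hypothesis consts : tuple_constants d L K c M A.
Hypothesis scP : admissible d L K c M A n sc.
Hypothesis M_le : (M <= n)%N.

Let join_pos := join_gt0 scP.
Let late_reserve := late_reserve_ge scP.

Lemma reserve_size_ge l : (join_size sc <= t l)%N.
Proof.
by apply: leq_trans (reserve_degree_ge scP l) _; rewrite leq_pmull // muln_gt0 K_gt0.
Qed.

Lemma reserve_size_large l : (n ^ K < 2 ^ t l)%N.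
Proof. by apply: leq_trans (join_large scP) _; rewrite leq_exp2l // reserve_size_ge. Qed.

Lemma reserve_size2_gt0 : (0 < t 2)%N.
Proof. exact: leq_trans join_pos (reserve_size_ge 2). Qed.

Section Rooms.
Variables (U V : finType) (T : {set {set U}}) (G0 : {set {set V}}) (par : U -> U) (dep pos : U -> nat).
Variables (cuts : {set U}) (i j : nat) (Se Sl : {set U}) (D N k : nat).
Local Notation q := (#|late pos j| - ell)%N.
Local Notation s := (N - q)%N.
Variables (a : 'I_s -> 'I_D -> V) (reg : V -> region).
Variables (hub : 'I_s -> U) (nb : 'I_s -> 'I_D -> U) (absorbers fillers : {set U}).
Hypothesis card_V : #|V| = n.
Hypothesis D_range : (0 < D <= d)%N.
Hypothesis parts : tree_parts T d b (max_cuts sc) (n %/ 2) (late_min sc) par dep pos cuts i j Se Sl D.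
Hypothesis hostP : host (adj G0) L K c M N k t a reg.
Hypothesis layout : tree_layout par dep pos cuts i j (hub_set hub) absorbers fillers.
Hypothesis stars : forest_stars par dep hub nb.
Hypothesis card_absorbers : #|absorbers| = (2 * t 2)%N.
Hypothesis card_fillers : #|fillers| = ell.

Lemma loss_facts : [/\ (ell <= #|late pos j|)%N, (#|late pos j| + slack <= t 2)%N & (3 * t 2 <= N)%N].
Proof.
have V_MN : (n <= M * N)%N by rewrite -card_V (host_ratio hostP).
have /andP[late_ge late_le] := parts_late parts; split.
- apply: leq_trans late_ge; apply: leq_trans (late_min_ge scP); apply: leq_trans (leq_addl _ _).
  by rewrite leq_pmull // expn_gt0 addn1.
- by move: late_le late_reserve; clear; lia.
by apply: leq_trans (many_tuples scP V_MN); rewrite leq_mul2r (loss_ge3 consts) orbT.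
Qed.

Lemma slots_le_dN : (s * D <= d * N)%N.
Proof. by case/andP: D_range => _ D_le; rewrite mulnC leq_mul // leq_subr. Qed.

Lemma host_sparse_n : (c * N <= n)%N.
Proof. by rewrite -card_V (host_sparse hostP). Qed.

Lemma base_nbrs_ge x (l : 'I_3) : (reserve_degree sc l <= #|base_nbrs G0 reg x (reserve_region l)| %/ 16)%N.
Proof.
have [_ /(_ x)] := host_reserve hostP l; rewrite /reserve_size => many.
rewrite leq_divRL // -(leq_pmul2l K_gt0); apply: leq_trans many.
by move: (reserve_degree sc l) => g; clear; lia.
Qed.

Lemma embedding_rooms (G : rel V) :
  (forall x l, #|base_nbrs G0 reg x (reserve_region l)| %/ 16 <= deg_in G (Reg reg (reserve_region l)) x)%N ->
  embedding_room par dep pos cuts i j d slack (hub_set hub) absorbers fillers G reg.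
Proof.
move=> G_deg; have [ell_le late_le N_ge] := loss_facts; have N_sparse := host_sparse_n.
have cuts_max := parts_cuts parts; have slots_le := slots_le_dN.
have deg_ge x (l : 'I_3) : (reserve_degree sc l <= deg_in G (Reg reg (reserve_region l)) x)%N.
  exact: leq_trans (base_nbrs_ge x l) (G_deg x l).
split.
- rewrite (card_imset _ (star_hub_inj stars)) card_ord (host_base hostP) card_fillers.
  by move: late_le N_ge ell_le; clear; lia.
- by rewrite card_absorbers (host_base hostP); move: late_le N_ge; clear; lia.
- move=> x; apply: leq_trans (deg_ge x ord0); apply: leq_trans (early_degree_ge scP N_sparse).
  rewrite (card_forest_nbrs_hubs stars (early_scattered layout) (subsetUl _ _)) card_absorbers.
  by rewrite !leq_add2r leq_add // leq_mul2l slots_le orbT.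
- have bulk_ge := host_bulk hostP; rewrite card_V in bulk_ge.
  have := free_room scP N_sparse; have := parts_early parts; move: slots_le bulk_ge.
  by rewrite mulnDl mul1n; move: (s * D)%N (d * N)%N; clear; lia.
- move=> x; apply: leq_trans (deg_ge x (Ordinal (isT : 1 < 3)%N)).
  by apply: leq_trans (mid_degree_ge scP); rewrite leq_add2r.
- have -> : #|Reg reg MidReserve| = t 1 := (host_reserve hostP (Ordinal (isT : 1 < 3)%N)).1.
  by rewrite card_fillers; apply: fillers_ge scP.
- move=> x; apply: leq_trans (deg_ge x (Ordinal (isT : 2 < 3)%N)); rewrite card_fillers.
  by apply: leq_trans (late_degree_ge scP); rewrite !leq_add2r.
by rewrite (host_late_bulk hostP).
Qed.

Lemma card_reserves : #|reserves reg| = (t 0 + t 1 + t 2)%N.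
Proof.
have -> : reserves reg = [set x | reg x \in [:: EarlyReserve; MidReserve; LateReserve]].
  apply/setP => x; rewrite !inE; apply/existsP/or3P => [[[[|[|[|//]]] l3] /eqP ->]|].
  - by constructor.
  - by constructor.
  - by constructor.
  by case=> /eqP ->; [exists ord0 | exists (Ordinal (isT : 1 < 3)%N) | exists (Ordinal (isT : 2 < 3)%N)].
rewrite card_Regs // !big_cons big_nil addn0 addnA.
have res l : #|Reg reg (reserve_region l)| = t l := (host_reserve hostP l).1.
by rewrite [X in (X + _ + _)%N](res ord0) [X in (_ + X + _)%N](res (Ordinal (isT : 1 < 3)%N))
  [X in (_ + _ + X)%N](res (Ordinal (isT : 2 < 3)%N)).
Qed.

End Rooms.

Definition first_phase_failure (s D : nat) (p : R) : R :=
  4 ^+ n * (1 - (s * D)%:R / n.-1%:R * p) ^+ (join_size sc ^ 2) + (n * 3)%:R * 2^-1 ^+ join_size sc.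

Section MainBound.
Variables (U : finType) (T : {set {set U}}) (G0 : {set {set 'I_n}}) (p e1 : R).
Hypothesis card_U : #|U| = n.
Hypothesis tree : is_tree T.
Hypothesis T_degree : forall u, (degree T u <= d)%N.
Hypothesis G0_graph : is_graph G0.
Hypothesis G0_degree : forall v, (n <= L * degree G0 v)%N.
Hypothesis p_ge0 : 0 <= p.
Hypothesis p_half : p <= 2^-1.
Hypothesis e1_le1 : e1 <= 1.

Lemma n_gt1 : (1 < n)%N.
Proof.
have := free_room scP (N := 0); have := colours_room scP (N := 0); rewrite muln0 => /(_ isT) + /(_ isT).
have := late_reserve; have := reserve_size2_gt0; move: (t 0) (t 1) (t 2) => x y z; clear -d_gt0; nia.
Qed.

Section WithHost.
Variables (par : U -> U) (dep pos : U -> nat) (cuts : {set U}) (i j : nat) (Se Sl : {set U}).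
Variables (D N k : nat).
Local Notation q := (#|late pos j| - ell)%N.
Local Notation s := (N - q)%N.
Variables (a : 'I_s -> 'I_D -> 'I_n) (reg : 'I_n -> region).
Hypothesis D_range : (0 < D <= d)%N.
Hypothesis parts : tree_parts T d b (max_cuts sc) (n %/ 2) (late_min sc) par dep pos cuts i j Se Sl D.
Hypothesis hostP : host (adj G0) L K c M N k t a reg.
Hypothesis likely : rainbow_matching_likely L (2 * M) D s e1.

Lemma host_scale : [/\ (n <= 2 * M * s)%N, (s * D < n.-1)%N &
  (2 * (d * #|reserves reg|) + s * D <= n.-1)%N].
Proof.
have [ell_le late_le N_ge] := loss_facts (card_ord n) parts hostP.
have sD_le : (s * D <= d * N)%N by apply: slots_le_dN.
have colours := colours_room scP (host_sparse_n (card_ord n) hostP); rewrite (card_reserves hostP).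
have V_MN : (n <= M * N)%N by rewrite -{1}(card_ord n) (host_ratio hostP).
have N2s : (N <= 2 * s)%N by move: late_le N_ge; clear; lia.
split.
- by apply: leq_trans V_MN _; rewrite [(2 * M)%N]mulnC -mulnA leq_mul2l N2s orbT.
- have t2_pos : (0 < d * t 2)%N by rewrite muln_gt0 d_gt0 reserve_size2_gt0.
  move: colours sD_le t2_pos; rewrite !mulnDr.
  by move: (s * D)%N (d * N)%N (d * t 0)%N (d * t 1)%N (d * t 2)%N; clear; lia.
by move: colours sD_le; move: (s * D)%N (d * N)%N (d * _)%N; clear; lia.
Qed.

Lemma exists_host_layout :
  exists (hub : 'I_s -> U) (nb : 'I_s -> 'I_D -> U) (absorbers fillers : {set U}),
  [/\ tree_layout par dep pos cuts i j (hub_set hub) absorbers fillers,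
      forest_stars par dep hub nb, #|absorbers| = (2 * t 2)%N & #|fillers| = ell].
Proof.
apply: (exists_tree_layout parts d_gt0); last exact: parts_many_Sl parts _ (late_min_ge scP).
apply: leq_trans (_ : d * N + 2 * t 2 <= _)%N; first by rewrite leq_add2r leq_mul2l leq_subr orbT.
exact: parts_many_Se parts _ (early_parts_room scP (host_sparse_n (card_ord n) hostP)).
Qed.

Lemma rainbow_copy_of_host : (1 - e1) * (1 - first_phase_failure s D p) <=
  perturbed_prob G0 p (fun E (c : colouring E n.-1) => has_rainbow_copy T c).
Proof.
have [n_le sD_lt colours] := host_scale; have sD_le := ltnW sD_lt.
have m_gt0 : (0 < n.-1)%N by have := n_gt1; lia.
have p_le1 : p <= 1 by apply: le_trans p_half _; lra.
have T_graph : is_graph T by case: tree.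
have [hub [nb [absorbers [fillers [layout stars card_abs card_fill]]]]] := exists_host_layout.
have card_UV : #|U| = #|'I_n| by rewrite card_U card_ord.
have spare_card : #|absorbers| = #|Reg reg LateReserve :|: Reg reg LateBulk|.
  have := card_Regs reg (isT : uniq [:: LateReserve; LateBulk]); rewrite !big_cons big_nil addn0.
  have -> : #|Reg reg LateReserve| = t 2%N := (host_reserve hostP (Ordinal (isT : 2 < 3)%N)).1.
  rewrite (host_late_bulk hostP) card_abs mul2n -addnn => <-.
  by apply: eq_card => x; rewrite !inE.
have [spare spare_inj spare_im] := exists_bij_imset (fun=> Ordinal (ltnW n_gt1)) spare_card.
have reserve_off x : x \in reserves reg -> (reg x != Tuples) && (reg x != Base).
  by rewrite inE => /existsP[[[|[|[|//]]] l3] /eqP ->].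
have scat := early_scattered layout.
have enough : (#|hubless_edges T hub| + s * D <= n.-1)%N.
  apply: leq_trans (card_hubless_edges (parts_edge parts) stars scat (subsetUl _ _)) _.
  by have := card_tree_edges tree; rewrite card_U; case: (n).
apply: (two_phases m_gt0 p_ge0 p_le1 sD_le T_graph T_degree
  (hub_stars_of_forest (parts_edge parts) T_graph stars scat (subsetUl _ _))
  (B := Reg reg Base) (Z := reserves reg) _ _ card_UV enough _ _ e1_le1 (good := good_graph G0 (join_size sc) reg)).
- move=> l l'; apply/negP => /reserve_off/andP[/negP + _]; apply.
  by rewrite -in_Reg -(host_slots hostP); apply/imsetP; exists (l, l').
- rewrite disjoint_sym disjoints_subset; apply/subsetP => x /reserve_off/andP[_].
  by rewrite in_setC in_Reg.
- exact: leq_trans (leq_addr _ _) colours.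
- by apply: leq_trans colours; rewrite addnC leq_add2r leq_pmull.
- move=> g; apply: (good_graph_partial_copy G0_graph (host_slots hostP) (parts_edge parts) T_graph T_degree
    (parts_pieces parts) join_pos layout stars (host_inj hostP) spare_inj spare_im card_UV).
  exact: embedding_rooms (card_ord n) D_range parts hostP layout stars card_abs card_fill.
- rewrite /first_phase_failure -[in 4 ^+ _](card_ord n) -[in (n * 3)%:R](card_ord n).
  apply: prob_good_graph_ge => //; first exact: host_slots hostP.
    by move=> x l; apply: leq_trans (reserve_degree_ge scP l) (base_nbrs_ge hostP x l).
  rewrite -[leRHS]mul1r; apply: ler_pM; rewrite ?divr_ge0 //.
  by rewrite ler_pdivrMr ?ltr0n // mul1r ler_nat.
move=> r C r_inj r_base card_C C_none.
apply: (completion_likely hostP likely) => //; last exact: leq_trans (leq_pred n) n_le.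
apply: coloured_pmf_pmf => // e; [exact: thin_prob_ge0 | exact: thin_prob_le | exact: edge_prob_le1].
Qed.

End WithHost.

Lemma rainbow_copy_bound :
  (forall D s, (0 < D <= d)%N -> (n <= 2 * M * s)%N -> rainbow_matching_likely L (2 * M) D s e1) ->
  exists D s, [/\ (0 < D)%N, (n <= 2 * M * s)%N, (s * D <= n.-1)%N &
    (1 - e1) * (1 - first_phase_failure s D p) <=
    perturbed_prob G0 p (fun E (c : colouring E n.-1) => has_rainbow_copy T c)].
Proof.
move=> likely; have n0 : (0 < n)%N := ltnW n_gt1.
have room0 := free_room scP (N := 0); rewrite !muln0 in room0.
have [||||par [dep [pos [cuts [i [j [Se [Sl [D [D_range parts]]]]]]]]]] :=
  @exists_tree_parts U T d (piece_height sc) (max_cuts sc) (n %/ 2) (late_min sc) tree T_degree d_gt0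
    (height_gt0 scP).
- by rewrite card_U n_gt1.
- by rewrite card_U; move: (room0 isT) late_reserve reserve_size2_gt0; rewrite /piece_bound; clear; lia.
- by rewrite card_U; apply: cuts_le scP.
- have := early_parts_room scP (N := 0); rewrite !muln0 add0n => /(_ isT); apply: leq_trans.
  by rewrite leq_add2l leq_pmulr // muln_gt0 reserve_size2_gt0.
have G_sym : symmetric (adj G0) by move=> x y; rewrite /adj setUC.
have G_deg v : (#|'I_n| <= L * #|[set w | adj G0 v w]|)%N by rewrite card_ord; apply: G0_degree.
have [||||||N [k [a [reg hostP]]]] := @exists_host 'I_n (adj G0) d L K c M A D (#|late pos j| - ell) t
  G_sym _ L_gt0 G_deg consts D_range.
- by rewrite card_ord.
- by rewrite card_ord.
- by move=> l; rewrite card_ord; apply: reserve_size_large.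
- by have /andP[_] := parts_late parts; move: late_reserve; rewrite /piece_bound; clear; lia.
- by move=> N; rewrite card_ord => n_le; apply: (many_tuples scP n_le).
- move=> N; rewrite card_ord => N_sparse; split; first exact: (dominated_room scP N_sparse).
  by apply: leq_trans (free_room scP N_sparse); rewrite leq_addl.
have [n_le sD_lt _] := host_scale D_range parts hostP.
have D_gt0 : (0 < D)%N by case/andP: D_range.
exists D, (N - (#|late pos j| - ell))%N; split=> //; first exact: ltnW.
exact: rainbow_copy_of_host D_range parts hostP (likely _ _ D_range n_le).
Qed.

End MainBound.

End RainbowCopy.

(** * Choice of the parameters *)

Local Close Scope ring_scope.

Lemma poly_lt_exp K c : 0 < K -> 0 < c -> exists w0, forall w, w0 <= w -> (c * w) ^ K < 2 ^ w.
Proof.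
move=> K_gt0 c_gt0; pose q := (4 * K * c) ^ K; exists (2 * q + 2 * K) => w w_ge.
pose v := w %/ (2 * K); have K2_gt0 : 0 < 2 * K by rewrite muln_gt0.
have w_lt : w < 2 * K * v.+1 by rewrite mulnC ltn_ceil.
have v_le : 2 * K * v <= w by rewrite mulnC leq_divM.
have cw_le : c * w <= 4 * K * c * 2 ^ v.
  apply: (@leq_trans (c * (2 * K * v.+1))); first by rewrite leq_mul2l ltnW ?orbT.
  have v_exp : v.+1 <= 2 ^ v by rewrite ltn_expl.
  apply: (@leq_trans (c * (2 * K * 2 ^ v))); first by rewrite !leq_mul2l v_exp !orbT.
  by move: (2 ^ v) => x; clear; nia.
apply: (@leq_ltn_trans (q * 2 ^ (v * K))).
  by apply: leq_trans (_ : (4 * K * c * 2 ^ v) ^ K <= _); rewrite ?leq_exp2r // expnMn -expnM.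
have q_lt : q < 2 ^ q by rewrite ltn_expl.
apply: (@leq_trans (2 ^ q * 2 ^ (v * K))); first by rewrite ltn_pmul2r ?expn_gt0.
rewrite -expnD leq_exp2l //; have : 2 * (v * K) <= w by rewrite mulnA [X in X <= _]mulnAC.
by move: w_ge; move: (v * K) (q) => x y; clear; lia.
Qed.

Section Constants.
Variables d L : nat.
Hypotheses (d_gt0 : 0 < d) (L_gt0 : 0 < L).
Local Notation z := (d + 1).

Definition domination_constant := 3 * (4 * L - 1).
Local Notation K := domination_constant.

(* The ratio between [n] and the size of the first reserve. *)
Definition reserve_ratio := 64 * d * L.

Definition sparsity_constant := 1024 * K * d * d * reserve_ratio * L * z ^ 5 + tuple_ratio L d * d + 4 * L * d.
Local Notation c := sparsity_constant.

Definition family_constant := \sum_(D < d.+1) tuple_family_ratio L D c + 1.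
Local Notation M := family_constant.

Definition loss_constant := 128 * d * K * z ^ 4 + 16 * tuple_ratio L d + 3.
Local Notation A := loss_constant.

Definition height_constant := reserve_ratio * (M * A * (1536 * K ^ 2 * z ^ 4)).
Local Notation h := height_constant.

Definition slack_constant := h * d ^ h * z.
Definition scale_constant := h * slack_constant.

Lemma constants_gt0 : [/\ 0 < K, 0 < reserve_ratio, 0 < M, 0 < A & 0 < h].
Proof.
have K_gt0 : 0 < K by rewrite /domination_constant; lia.
have ratio_gt0 : 0 < reserve_ratio by rewrite !muln_gt0 d_gt0.
have M_gt0 : 0 < M by rewrite /family_constant addn1.
have A_gt0 : 0 < A by rewrite /loss_constant addnS.
have K2_gt0 : 0 < K ^ 2 by rewrite expn_gt0 K_gt0.
have z4_gt0 : 0 < z ^ 4 by rewrite expn_gt0 addn1.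
split=> //; rewrite /height_constant; move: M A reserve_ratio (K ^ 2) (z ^ 4) M_gt0 A_gt0 ratio_gt0 K2_gt0 z4_gt0.
by move=> m a r u v m_gt0 a_gt0 r_gt0 u_gt0 v_gt0; rewrite !muln_gt0 m_gt0 a_gt0 r_gt0 u_gt0.
Qed.

Lemma scale_constant_gt0 : 0 < scale_constant.
Proof.
have [_ _ _ _] := constants_gt0; rewrite /scale_constant /slack_constant; move: h => x x_gt0.
by rewrite !muln_gt0 x_gt0 expn_gt0 d_gt0 addn1.
Qed.

Lemma tuple_constantsP : tuple_constants d L K c M A.
Proof.
have ratio_le D : D <= d -> tuple_ratio L D <= tuple_ratio L d.
  by move=> D_le; rewrite leq_mul2l leq_pexp2l // muln_gt0.
split.
- have [q qE] : exists q, q = 4 * L - 1 by eexists.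
  have := bernoulli_expn q (3 * q); rewrite (_ : q + 3 * q = 4 * q); last by clear; lia.
  rewrite (_ : q + 1 = 4 * L); last by rewrite qE; lia.
  by rewrite mulnA leq_pmul2r ?qE ?[4 * _ ^ _]mulnC //; lia.
- move=> D /andP[D_gt0 D_le]; rewrite /sparsity_constant; split.
    by apply: leq_trans (leq_addl _ _); rewrite leq_mul2l D_le orbT.
  by rewrite -addnA addnCA; apply: leq_trans (leq_addr _ _); rewrite leq_mul ?ratio_le.
- move=> D /andP[_]; rewrite -ltnS => D_lt; apply: leq_trans (leq_addr _ _).
  by rewrite (bigD1 (Ordinal D_lt)) //= leq_addr.
- exact: leq_addl.
move=> D /andP[_ D_le]; rewrite /loss_constant -addnA addnCA; apply: leq_trans (leq_addr _ _).
by rewrite leq_mul2l ratio_le.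
Qed.

Section Scales.
Variables n w : nat.
Hypothesis w_large : scale_constant <= w.
Hypothesis n_ge : scale_constant * w <= n.
Hypothesis n_lt : n < scale_constant * w + scale_constant.
Hypothesis w_exp : n ^ K < 2 ^ w.

(* Every size is a multiple of [scale_unit], which is also the slack of one piece. *)
Definition scale_unit := slack_constant * w.
Definition fillers_scale := 96 * K * scale_unit.
Definition late_scale := z ^ 4 * fillers_scale.

Definition standard_scales :=
  Scales h w (2 * scale_unit) (nth late_scale [:: M * A * late_scale; 3 * scale_unit]) fillers_scale (2 * late_scale).

Local Notation Q := scale_unit.
Local Notation ell := fillers_scale.
Local Notation X := late_scale.
Local Notation t := (reserve_size K standard_scales).

Lemma standard_slack : piece_slack d standard_scales = Q.
Proof. by rewrite /piece_slack /piece_bound /= /scale_unit /slack_constant -addn1 mulnA. Qed.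

Lemma standard_t0 : t 0 = M * A * t 2.
Proof. by rewrite /reserve_size /= mulnCA. Qed.

Lemma standard_t1 : t 1 = 48 * K * Q.
Proof. by rewrite /reserve_size /=; lia. Qed.

Lemma scale_ratio : scale_constant * w = reserve_ratio * t 0.
Proof.
rewrite /scale_constant /reserve_size /= /late_scale /fillers_scale /scale_unit /height_constant -!mulnn.
by move: (z ^ 4) slack_constant; clear; lia.
Qed.

Lemma n_bounds : [/\ 0 < w, reserve_ratio * t 0 <= n & n <= reserve_ratio * t 0 + w].
Proof.
rewrite -scale_ratio; split=> //; first exact: leq_trans scale_constant_gt0 w_large.
by move: w_large n_lt; move: (scale_constant * w) scale_constant; clear; lia.
Qed.

Lemma scale_unit_ge : 2 * w <= Q.
Proof.
have [_ _ _ _ h_gt0] := constants_gt0; rewrite leq_mul2r; apply/orP; right.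
by apply: (@leq_mul 1 2); rewrite ?addn1 // muln_gt0 h_gt0 expn_gt0 d_gt0.
Qed.

Lemma piece_le_w : piece_bound d standard_scales <= w.
Proof.
have [_ _ _ _ h_gt0] := constants_gt0; apply: leq_trans w_large; rewrite /scale_constant.
by apply: (@leq_trans slack_constant); rewrite ?leq_pmull // leq_pmulr // addn1.
Qed.

Lemma pow4_ge : z <= z ^ 4 /\ z ^ 2 <= z ^ 4.
Proof. by rewrite -[X in X <= _]expn1 !leq_pexp2l ?addn1. Qed.

Lemma size_chain : [/\ 96 * Q <= ell, z * ell <= X, 16 * X <= t 2 & 128 * (z ^ 4 * t 2) <= t 0].
Proof.
have [K_gt0 _ M_gt0 _ _] := constants_gt0; have [z4 _] := pow4_ge; split.
- by rewrite /fillers_scale -mulnA leq_mul2l leq_pmull.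
- by rewrite leq_mul2r z4 orbT.
- by rewrite /reserve_size /= -mulnA leq_mul2l leq_pmull.
rewrite standard_t0 mulnA leq_mul2r; apply/orP; right; apply: leq_trans (leq_pmull _ M_gt0).
rewrite /loss_constant -addnA; apply: leq_trans (leq_addr _ _).
by rewrite leq_mul2r -mulnA leq_pmulr ?orbT // muln_gt0 d_gt0.
Qed.

Lemma size_order : [/\ ell <= X, 128 * t 2 <= t 0, 128 * Q <= t 0, t 1 <= t 0 & w <= t 0].
Proof.
have [ellQ Xell t2X t0t2] := size_chain; have wQ := scale_unit_ge.
have ellX : ell <= X by apply: leq_trans Xell; rewrite leq_pmull // addn1.
have t2t0 : 128 * t 2 <= t 0.
  by apply: leq_trans t0t2; rewrite leq_mul2l leq_pmull // expn_gt0 addn1.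
have t1_ell : t 1 <= ell by rewrite standard_t1 /fillers_scale; clear; lia.
by split=> //; move: ellQ ellX t2X t2t0 t1_ell wQ; clear; lia.
Qed.

Lemma standard_cuts q : q * h <= n + h -> q <= 2 * Q.
Proof.
have [_ _ _ _ h_gt0] := constants_gt0; have [w_gt0 _ n_le] := n_bounds.
move=> q_le; rewrite -(leq_pmul2r h_gt0); apply: leq_trans q_le _.
apply: leq_trans (_ : reserve_ratio * t 0 + w + h <= _); first by rewrite leq_add2r.
have -> : reserve_ratio * t 0 = Q * h by rewrite -scale_ratio /scale_constant /scale_unit; clear; lia.
rewrite mul2n -addnn mulnDl -addnA leq_add2l.
apply: (@leq_trans (w * h + w * h)); first by apply: leq_add; rewrite ?leq_pmulr ?leq_pmull.
by rewrite -mulnDl addnn -mul2n leq_mul2r scale_unit_ge orbT.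
Qed.

Lemma tuples_small N : c * N <= n ->
  [/\ 32 * (d * (d * N)) <= M * A * X, 1024 * (d * (z ^ 4 * N)) <= n & 1024 * (L * (z * N)) <= n].
Proof.
move=> N_le; have [K_gt0 ratio_gt0 _ _ _] := constants_gt0; have [_ _ n_le] := n_bounds.
have [_ _ _ _ w_le] := size_order.
have big_N : 1024 * K * d * d * reserve_ratio * L * z ^ 5 * N <= n.
  by apply: leq_trans N_le; rewrite leq_mul2r /sparsity_constant -addnA leq_addr orbT.
have factor u v : 0 < u -> v * u = 1024 * K * d * d * reserve_ratio * L * z ^ 5 -> v * N <= n.
  by move=> u_gt0 vu; apply: leq_trans big_N; rewrite -vu leq_mul2r leq_pmulr ?orbT.
have z5 : z ^ 5 = z ^ 4 * z by rewrite expnSr.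
split.
- have pos : 0 < 32 * (reserve_ratio * K) by rewrite muln_gt0 muln_gt0 ratio_gt0 K_gt0.
  rewrite -(leq_pmul2l pos); apply: (@leq_trans n).
    rewrite (_ : 32 * _ * _ = 1024 * K * d * d * reserve_ratio * N); last by clear; lia.
    by apply: (factor (L * z ^ 5)); rewrite ?muln_gt0 ?L_gt0 ?expn_gt0 ?addn1 // mulnA.
  apply: leq_trans n_le _; apply: (@leq_trans (2 * (reserve_ratio * t 0))).
    by move: (leq_pmull (t 0) ratio_gt0) w_le; move: (reserve_ratio * t 0); clear; lia.
  by rewrite /reserve_size /=; apply: eq_leq; move: (M * A * X); clear; lia.
- rewrite (_ : 1024 * _ = 1024 * d * z ^ 4 * N); last by move: (z ^ 4) => u; clear; lia.
  apply: (factor (K * d * reserve_ratio * L * z)).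
    by move: K reserve_ratio K_gt0 ratio_gt0 => x r x_gt0 r_gt0; rewrite !muln_gt0 x_gt0 d_gt0 r_gt0 L_gt0 addn1.
  by rewrite z5; move: (z ^ 4) z => u v; clear; lia.
rewrite (_ : 1024 * _ = 1024 * L * z * N); last by clear; lia.
apply: (factor (K * d * d * reserve_ratio * z ^ 4)).
  by move: K reserve_ratio K_gt0 ratio_gt0 => x r x_gt0 r_gt0; rewrite !muln_gt0 x_gt0 d_gt0 r_gt0 ?expn_gt0 addn1.
by rewrite z5; move: (z ^ 4) z => u v; clear; lia.
Qed.

Lemma reserve_small : [/\ 64 * (L * t 0) <= n, 64 * (d * t 0) <= n & 64 * t 0 <= n].
Proof.
have [_ n_ge' _] := n_bounds; rewrite /reserve_ratio in n_ge'.
move: (t 0) n_ge' => x /(leq_trans _) ratio_le.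
by split; apply: ratio_le; rewrite -!mulnA leq_mul2l ?leq_mul2l /= ?leq_pmull ?orbT //
  mulnA leq_pmull // muln_gt0 d_gt0.
Qed.

Lemma standard_dominated N : c * N <= n -> 2 * L * (z * N + (t 0 + t 1 + t 2)) <= n.
Proof.
case/tuples_small=> _ _ N_small; have [_ t2t0 _ t1t0 _] := size_order; have [t0_small _ _] := reserve_small.
have L1 : L * t 1 <= L * t 0 by rewrite leq_mul2l t1t0 orbT.
have L2 : L * t 2 <= L * t 0 by rewrite leq_mul2l (leq_trans _ t2t0) ?orbT // leq_pmull.
rewrite -mulnA !mulnDr; move: N_small t0_small L1 L2.
by move: (L * (z * N)) (L * t 0) (L * t 1) (L * t 2); clear; lia.
Qed.

Lemma standard_free N : c * N <= n ->
  n %/ 2 + piece_bound d standard_scales + Q + (z * N + (t 0 + t 1 + t 2) + t 2) <= n.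
Proof.
case/tuples_small=> _ _ N_small; have [_ t2t0 Qt0 t1t0 w_le] := size_order.
have [_ _ t0_small] := reserve_small; have [w_gt0 _ _] := n_bounds.
have zN : 1024 * (z * N) <= n by apply: leq_trans N_small; rewrite leq_mul2l leq_pmull.
have := leq_divM n 2; move: piece_le_w zN t0_small t2t0 Qt0 t1t0 w_le w_gt0.
by move: (z * N) (piece_bound _ _) (n %/ 2); clear; lia.
Qed.

Lemma standard_colours N : c * N <= n -> 2 * (d * (t 0 + t 1 + t 2)) + d * N < n.
Proof.
case/tuples_small=> _ _ N_small; have [_ t2t0 _ t1t0 w_le] := size_order; have [_ d_small t0_small] := reserve_small.
have [w_gt0 _ _] := n_bounds; have n_gt0 : 0 < n by move: w_gt0 w_le t0_small; clear; lia.
have d1 : d * t 1 <= d * t 0 by rewrite leq_mul2l t1t0 orbT.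
have d2 : d * t 2 <= d * t 0 by rewrite leq_mul2l (leq_trans _ t2t0) ?orbT // leq_pmull.
have dN : d * N <= L * (z * N) by apply: leq_trans (leq_pmull _ L_gt0); rewrite leq_mul2r leq_addr orbT.
rewrite !mulnDr; move: N_small d_small d1 d2 dN n_gt0.
by move: (L * (z * N)) (d * N) (d * t 0) (d * t 1) (d * t 2); clear; lia.
Qed.

Lemma standard_early_parts N : c * N <= n -> z ^ 2 * (2 * Q) + z ^ 4 * (d * N + 2 * t 2) <= n %/ 2.
Proof.
case/tuples_small=> _ N_small _; have [ellQ _ t2X t0t2] := size_chain; have [_ _ t0_small] := reserve_small.
have [ellX t2t0 _ _ w_le] := size_order; have [w_gt0 _ _] := n_bounds.
have cuts_small : z ^ 2 * (2 * Q) <= X.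
  by apply: leq_mul; [have [] := pow4_ge | move: ellQ; clear; lia].
rewrite mulnDr [z ^ 4 * (d * N)]mulnCA [z ^ 4 * (2 * t 2)]mulnCA; have := ltn_ceil n (isT : 0 < 2).
move: cuts_small N_small t0t2 t2X t2t0 t0_small w_le w_gt0.
by move: (z ^ 2 * (2 * Q)) (d * (z ^ 4 * N)) (z ^ 4 * t 2) (n %/ 2); clear; lia.
Qed.

Lemma standard_early_degree N : c * N <= n -> 2 * Q + d * (d * N) + d * (2 * t 2) + Q <= M * A * X.
Proof.
case/tuples_small=> N_small _ _; have [K_gt0 _ M_gt0 _ _] := constants_gt0.
have [ellQ _ _ _] := size_chain; have [ellX _ _ _ _] := size_order.
have A_le : 128 * d * K <= M * A.
  apply: leq_trans (leq_pmull _ M_gt0); rewrite /loss_constant -addnA; apply: leq_trans (leq_addr _ _).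
  by rewrite leq_pmulr // expn_gt0 addn1.
have absorbed : 128 * (d * (K * X)) <= M * A * X.
  by have := leq_mul A_le (leqnn X); move: (M * A) X K => u v x; clear; lia.
have X_le : 128 * X <= M * A * X.
  by rewrite leq_mul2r (leq_trans _ A_le) ?orbT // -mulnA leq_pmulr // muln_gt0 d_gt0.
rewrite (_ : d * (2 * t 2) = 32 * (d * (K * X))); last by rewrite /reserve_size /=; clear; lia.
by move: N_small absorbed X_le ellX ellQ; move: (M * A * X) (d * (d * N)) (d * (K * X)); clear; lia.
Qed.

Lemma standard_scales_admissible : admissible d L K c M A n standard_scales.
Proof.
have [K_gt0 ratio_gt0 M_gt0 A_gt0 h_gt0] := constants_gt0; have [w_gt0 n_ge' _] := n_bounds.
have [ellQ Xell t2X t0t2] := size_chain; have [ellX t2t0 Qt0 t1t0 w_le] := size_order; have wQ := scale_unit_ge.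
split; rewrite ?standard_slack //=.
- exact: standard_cuts.
- case=> [|[|l]] /=; [|by move: wQ; clear; lia|].
    by apply: leq_trans (leq_pmull _ _); [move: wQ ellQ ellX; clear; lia | rewrite muln_gt0 M_gt0].
  by rewrite nth_default //; move: wQ ellQ ellX; clear; lia.
- by clear; lia.
- by rewrite standard_t1 /fillers_scale; move: (leq_pmull Q K_gt0); rewrite -!mulnA; move: (K * Q); clear; lia.
- by apply: leq_trans Xell; rewrite mulnDl mul1n; move: ellQ; move: (d * ell); clear; lia.
- rewrite [2 * X]mul2n -addnn leq_add2r; apply: leq_mul; first by have [] := pow4_ge.
  by move: ellQ; clear; lia.
- by move: piece_le_w t2X ellX ellQ wQ; move: (piece_bound _ _); clear; lia.
- move=> N N_ge; rewrite -(leq_pmul2l M_gt0); apply: leq_trans N_ge; apply: leq_trans n_ge'.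
  by rewrite mulnA -standard_t0 leq_pmull.
- by move=> N; apply: standard_early_degree.
- by move=> N; apply: standard_dominated.
- by move=> N; apply: standard_free.
- by move=> N; apply: standard_colours.
by move=> N; apply: standard_early_parts.
Qed.

Lemma family_constant_le : M <= n.
Proof.
have [_ ratio_gt0 _ A_gt0 _] := constants_gt0; have [w_gt0 n_ge' _] := n_bounds.
have [ellQ _ t2X _] := size_chain; have [ellX _ _ _ _] := size_order.
apply: leq_trans n_ge'; apply: leq_trans (leq_pmull _ ratio_gt0).
rewrite standard_t0 -mulnA leq_pmulr // muln_gt0 A_gt0 /=.
by move: scale_unit_ge w_gt0 ellQ ellX t2X; clear; lia.
Qed.

End Scales.

End Constants.

(** * Rainbow copies in the coloured perturbed graph *)

Local Open Scope ring_scope.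

Section MainTheorem.
Variables (R : realType) (d L : nat).
Hypotheses (d_gt0 : (0 < d)%N) (L_gt0 : (0 < L)%N).
Implicit Types (eps p : R).
Local Notation M := (family_constant d L).
Local Notation Kb := (scale_constant d L).

Lemma rainbow_matching_likely_uniform Lm eps : (0 < Lm)%N -> 0 < eps ->
  exists s0 : nat, forall D s, (0 < D <= d)%N -> (s0 <= s)%N -> rainbow_matching_likely L Lm D s eps.
Proof.
move=> Lm_gt0 eps_gt0; elim: d => [|d' [s0 likely]]; first by exists 0%N => D s; lia.
have ratio_gt0 : (0 < 16 * tuple_ratio L d'.+1)%N by rewrite !muln_gt0 expn_gt0 muln_gt0 L_gt0.
have [s1 likely1] := prob_rainbow_matching_ge (ltn0Sn d') ratio_gt0 Lm_gt0 eps_gt0.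
exists (s0 + s1)%N => D s /andP[D_gt0 D_le] s_ge.
have [->|D_neq] := eqVneq D d'.+1; last by apply: likely; lia.
move=> J S K mu m k comp slot mu_pmf card_K sD_lt m_le slot_inj unif k_small dense.
by apply: (likely1 J S 'I_s K mu m k comp slot); rewrite ?card_ord ?card_K //; lia.
Qed.

(* [n] is at most [(K + 1) w], so [4 ^ n] is compensated once [w x] is a large multiple of [4 ^ (K + 1)]. *)
Lemma exp_decay (n w K : nat) (x : R) : (n <= K.+1 * w)%N -> 0 <= x -> x <= 1 ->
  2 * 4 ^+ K.+1 <= w%:R * x -> 4 ^+ n * (1 - x) ^+ (w ^ 2) <= 2^-1 ^+ w.
Proof.
move=> n_le x_ge0 x_le1 wx_ge; have pow_gt0 : (0 : R) < 4 ^+ K.+1 by apply: exprn_gt0.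
apply: le_trans (_ : (4 ^+ K.+1) ^+ w * (2 * 4 ^+ K.+1)^-1 ^+ w <= _).
  apply: ler_pM; rewrite ?exprn_ge0 ?subr_ge0 //.
    by rewrite -exprM; apply: ler_weXn2l => //; rewrite ler1n.
  rewrite -mulnn exprM; apply: lerXn2r; rewrite ?nnegrE ?exprn_ge0 ?subr_ge0 ?invr_ge0 ?mulr_ge0 ?exprn_ge0 //.
  apply: le_trans (bernoulli_le_inv _ x_ge0 x_le1) _; rewrite lef_pV2 ?posrE ?mulr_gt0 //.
    by apply: le_trans wx_ge _; rewrite lerDr.
  by apply: ltr_pwDl => //; apply: mulr_ge0.
rewrite -exprMn; apply: lerXn2r; rewrite ?nnegrE ?mulr_ge0 ?invr_ge0 ?mulr_ge0 ?exprn_ge0 //.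
by rewrite invfM mulrCA divff ?mulr1 ?gt_eqF.
Qed.

Definition edge_constant : R := 2 * M%:R * Kb.+1%:R * (2 * 4 ^+ Kb.+1).

Lemma family_gt0 : (0 : R) < 2 * M%:R.
Proof. by have [_ _ M_gt0 _ _] := constants_gt0 d_gt0 L_gt0; rewrite mulr_gt0 ?ltr0n. Qed.

Lemma edge_constant_gt0 : 0 < edge_constant.
Proof.
by apply: mulr_gt0; [apply: mulr_gt0 family_gt0 _; rewrite ltr0n | rewrite mulr_gt0 // exprn_gt0].
Qed.

Lemma first_phase_failure_le (n w s D : nat) p eps : (1 < n)%N -> (n <= Kb.+1 * w)%N ->
  (n <= 2 * M * s)%N -> (0 < D)%N -> (s * D <= n.-1)%N -> p = edge_constant / n%:R -> p <= 2^-1 ->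
  n%:R * 2^-1 ^+ w <= eps / 8 -> 0 <= first_phase_failure n (standard_scales d L w) s D p <= eps / 2.
Proof.
move=> n_gt1 n_le n_s D_gt0 sD_le pE p_half w_small; have M2_gt0 := family_gt0.
have n_gt0 : (0 : R) < n%:R by rewrite ltr0n ltnW.
have m_gt0 : (0 : R) < n.-1%:R by rewrite ltr0n; lia.
have p_ge0 : 0 <= p by rewrite pE divr_ge0 // ltW // edge_constant_gt0.
set x := (s * D)%:R / n.-1%:R * p.
have slots_le1 : (s * D)%:R / n.-1%:R <= 1 :> R by rewrite ler_pdivrMr // mul1r ler_nat.
have x_ge0 : 0 <= x by rewrite mulr_ge0 ?divr_ge0.
have x_le1 : x <= 1.
  by rewrite -[leRHS]mul1r; apply: ler_pM; rewrite ?divr_ge0 //; apply: le_trans p_half _; lra.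
have slots_ge : (2 * M%:R)^-1 <= (s * D)%:R / n.-1%:R :> R.
  rewrite ler_pdivlMr // ler_pdivrMl //; apply: le_trans (_ : n%:R <= _); first by rewrite ler_nat leq_pred.
  by rewrite -!natrM ler_nat; apply: leq_trans n_s _; rewrite leq_mul2l leq_pmulr ?orbT.
have wx_ge : 2 * 4 ^+ Kb.+1 <= w%:R * x.
  apply: le_trans (_ : w%:R * ((2 * M%:R)^-1 * p) <= _); last first.
    by apply: ler_wpM2l => //; apply: ler_wpM2r.
  rewrite pE /edge_constant; have : (0 : R) < 2 * 4 ^+ Kb.+1 by rewrite mulr_gt0 // exprn_gt0.
  move: (2 * 4 ^+ Kb.+1) => q q_gt0.
  rewrite -[2 * M%:R * _ * q]mulrA -[2 * M%:R * _ / _]mulrA mulKf ?gt_eqF //.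
  rewrite mulrA ler_pdivlMr // [w%:R * _]mulrA [_ * _ * q]mulrC ler_wpM2l ?(ltW q_gt0) //.
  by rewrite -natrM ler_nat mulnC.
have half_ge0 : (0 : R) <= 2^-1 ^+ w by rewrite exprn_ge0 ?invr_ge0.
rewrite /first_phase_failure -/x -[join_size _]/w; apply/andP; split.
  by apply: addr_ge0; apply: mulr_ge0; rewrite ?exprn_ge0 ?subr_ge0 ?invr_ge0.
apply: le_trans (lerD (exp_decay n_le x_ge0 x_le1 wx_ge) (lexx _)) _; rewrite natrM mulrAC.
have : 2^-1 ^+ w <= n%:R * 2^-1 ^+ w :> R by rewrite ler_peMl // ler1n ltnW.
by move: w_small; move: (2^-1 ^+ w) => h; clear; lra.
Qed.

Lemma eventually_large (s0 : nat) eps : 0 < eps -> exists N : nat, forall n (w := (n %/ Kb)%N),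
  (N <= n)%N -> [/\ (Kb <= w)%N, (n ^ domination_constant L < 2 ^ w)%N, (2 * M * s0 < n)%N,
    edge_constant / n%:R <= 2^-1 & n%:R * 2^-1 ^+ w <= eps / 8].
Proof.
move=> eps_gt0; have eps8_gt0 : 0 < eps / 8 by rewrite divr_gt0.
have [K_gt0 _ _ _ _] := constants_gt0 d_gt0 L_gt0; have Kb_gt0 := scale_constant_gt0 d_gt0 L_gt0.
have [N1 lin_small] := lin_half_pow_small Kb_gt0 eps8_gt0.
have [w1 poly_small] := poly_lt_exp K_gt0 (ltn0Sn Kb).
pose N2 := (Num.truncn (2 * edge_constant)).+1.
exists (Kb * Kb + N1 + Kb * w1 + 2 * M * s0 + N2)%N => n w n_ge.
have [n_sq nN1 n_w1 n_s nN2] : [/\ Kb * Kb <= n, N1 <= n, Kb * w1 <= n, 2 * M * s0 < n & N2 <= n]%N.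
  move: n_ge; rewrite /N2; move: (Kb * Kb)%N (Kb * w1)%N (2 * M * s0)%N (Num.truncn _) => x y u v.
  by clear=> n_ge; split; lia.
have w_large : (Kb <= w)%N by rewrite leq_divRL.
have n_le : (n <= Kb.+1 * w)%N.
  have := ltn_ceil n Kb_gt0; rewrite -/w mulnC mulSn; move: w_large.
  by rewrite mulnSr; move: (Kb * w)%N; clear; lia.
split=> //; last exact: lin_small.
  have w1_le : (w1 <= w)%N by rewrite leq_divRL // mulnC.
  by apply: leq_ltn_trans (poly_small w w1_le); rewrite leq_exp2r.
have n_gt0 : (0 : R) < n%:R by rewrite ltr0n (leq_ltn_trans _ n_s).
rewrite ler_pdivrMr // mulrC ler_pdivlMr // mulrC; apply: le_trans (ltW (truncnS_gt _)) _.
by rewrite ler_nat.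
Qed.

Lemma rainbow_copy_likely eps : 0 < eps -> exists N : nat, forall n, (N <= n)%N ->
  forall (U : finType) (T : {set {set U}}) (G0 : {set {set 'I_n}}),
  #|U| = n -> is_tree T -> (forall u, (degree T u <= d)%N) ->
  is_graph G0 -> (forall v, (n <= L * degree G0 v)%N) ->
  1 - eps <= perturbed_prob G0 (edge_constant / n%:R)
               (fun E (c : colouring E n.-1) => has_rainbow_copy T c).
Proof.
move=> eps_gt0; have [K_gt0 _ M_gt0 _ _] := constants_gt0 d_gt0 L_gt0.
have Kb_gt0 := scale_constant_gt0 d_gt0 L_gt0.
have M2_gt0 : (0 < 2 * M)%N by rewrite muln_gt0.
pose e1 := Num.min (eps / 2) 2^-1; have e1_gt0 : 0 < e1 by rewrite lt_min divr_gt0 //= invr_gt0.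
have [e1_le e1_half] : e1 <= eps / 2 /\ e1 <= 2^-1 by rewrite !ge_min !lexx orbT.
have e1_le1 : e1 <= 1 by apply: le_trans e1_half _; rewrite invf_le1 ?ler1n ?ltr0n.
have [s0 likely] := rainbow_matching_likely_uniform M2_gt0 e1_gt0.
have [N large] := eventually_large s0 eps_gt0.
exists N => n /large[w_large w_exp n_s p_half w_small] U T G0 card_U tree T_deg G0_graph G0_deg.
set w := (n %/ Kb)%N in w_large w_exp w_small.
have n_ge : (Kb * w <= n)%N by rewrite mulnC leq_divM.
have n_lt : (n < Kb * w + Kb)%N by rewrite -mulnSr mulnC ltn_ceil.
have p_ge0 : 0 <= edge_constant / n%:R by rewrite divr_ge0 // ltW // edge_constant_gt0.
have scP := standard_scales_admissible d_gt0 L_gt0 w_large n_ge n_lt w_exp.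
have M_le := family_constant_le d_gt0 L_gt0 w_large n_ge n_lt w_exp.
have [|D [s [D_gt0 n_le sD_le bound]]] := rainbow_copy_bound d_gt0 L_gt0 K_gt0 (tuple_constantsP d_gt0 L_gt0)
  scP M_le card_U tree T_deg G0_graph G0_deg p_ge0 p_half e1_le1.
  by move=> D s D_range s_ge; apply: likely D_range _; rewrite -(leq_pmul2l M2_gt0) ltnW // (leq_trans n_s).
apply: le_trans bound; have n_gt1 := n_gt1 d_gt0 K_gt0 scP.
have n_w : (n <= Kb.+1 * w)%N by rewrite mulSn addnC; move: n_lt w_large; move: (Kb * w)%N; clear; lia.
have /andP[fail_ge0 fail_le] := first_phase_failure_le n_gt1 n_w n_le D_gt0 sD_le (erefl _) p_half w_small.
by move: e1_le fail_ge0 fail_le e1_gt0; move: (first_phase_failure _ _ _ _ _) (e1); clear => u v; nra.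
Qed.

End MainTheorem.

Theorem theorem1p3 (R : realType) (delta : R) (d : nat) :
  0 < delta < 1 -> (2 <= d)%N ->
  exists2 C : R, 0 < C &
  forall eps : R, 0 < eps ->
  exists N : nat, forall n : nat, (N <= n)%N ->
  forall (U : finType) (T : {set {set U}}),
    #|U| = n -> is_tree T -> (forall u, (degree T u <= d)%N) ->
  forall G0 : {set {set 'I_n}},
    is_graph G0 -> (forall v, delta * n%:R <= (degree G0 v)%:R) ->
  1 - eps <= perturbed_prob G0 (C / n%:R)
               (fun E (c : colouring E n.-1) => has_rainbow_copy T c).
Proof.
move=> /andP[delta_gt0 _] /ltnW d_gt0.
pose L := (Num.truncn delta^-1).+1; have delta_L : delta^-1 <= L%:R by rewrite ltW // truncnS_gt.
exists (edge_constant R d L) => [|eps eps_gt0]; first exact: edge_constant_gt0.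
have [N likely] := rainbow_copy_likely d_gt0 (ltn0Sn _ : (0 < L)%N) eps_gt0.
exists N => n n_ge U T card_U tree T_deg G0 G0_graph G0_deg; apply: likely => // v.
rewrite -(ler_nat R) natrM; apply: le_trans (ler_wpM2l (ler0n R L) (G0_deg v)).
by rewrite mulrA ler_peMl // -ler_pdivrMr // div1r.
Qed.
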